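(* Let $(\phi_t)_{t\ge 0}$ be a non-elliptic semigroup of holomorphic functions in the unit disk $\mathbb{D}$, let $\Delta$ be a petal of $(\phi_t)$, and let $K$ be a compact non-polar subset of $\Delta$. Then $$\lim_{t\to-\infty}\omega(\phi_t(z),\partial\phi_t(K),\mathbb{D}\setminus\phi_t(K))=\omega(z,\partial K,\Delta\setminus K)\quad\text{for every } z\in\Delta\setminus K.$$
   Context: $\mathbb{D}$ is the open unit disk. A (one-parameter) semigroup of holomorphic functions in $\mathbb{D}$ is a family $(\phi_t)_{t\ge0}$ of holomorphic maps $\phi_t:\mathbb{D}\to\mathbb{D}$ such that $\phi_0$ is the identity, $\phi_{t+s}=\phi_t\circ\phi_s$ for all $s,t\ge0$, and $\phi_t(z)\to z$ as $t\to0^+$ uniformly on compact subsets of $\mathbb{D}$. It is called non-elliptic if there is a point $\tau\in\partial\mathbb{D}$ (the Denjoy–Wolff point) with $\lim_{t\to+\infty}\phi_t(z)=\tau$ for every $z\in\mathbb{D}$. A non-elliptic semigroup is called parabolic if the angular derivatives satisfy $\phi_t'(\tau)=1$. Let $d_{\mathbb{D}}(z,w)=\operatorname{arctanh}\left|\frac{z-w}{1-\bar z w}\right|$ be the hyperbolic distance. A backward orbit of $(\phi_t)$ starting at a point $z\in\mathbb{D}$ is a continuous curve $\gamma:[0,+\infty)\to\mathbb{D}$ with $\gamma(0)=z$ and $\phi_s(\gamma(t))=\gamma(t-s)$ for all $t\ge0$, $s\in[0,t]$; it is regular if $\limsup_{t\to+\infty}d_{\mathbb{D}}(\gamma(t),\gamma(t+1))<+\infty$.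 The backward invariant set is $\mathcal{W}=\bigcap_{t\ge0}\phi_t(\mathbb{D})$. A petal $\Delta$ of $(\phi_t)$ is a non-empty simply connected component of the interior of $\mathcal{W}$ such that: (i) $\phi_t(\Delta)=\Delta$ for all $t\ge0$ and $(\phi_t|_{\Delta})$ is a group of automorphisms of $\Delta$; (ii) $\tau\in\partial\Delta$; (iii) there is a point $\sigma\in\partial\mathbb{D}\cap\partial\Delta$ (possibly $\sigma=\tau$) such that for every $z\in\Delta$ the curve $[0,+\infty)\ni t\mapsto(\phi_t|_\Delta)^{-1}(z)$ is a regular backward orbit for $(\phi_t)$ converging to $\sigma$; moreover $\sigma$ is a boundary regular fixed point (a boundary fixed point at which each $\phi_t$ has finite angular derivative), and if $\sigma=\tau$ then the semigroup is parabolic. For $t>0$ and $z\in\Delta$ one writes $\phi_{-t}(z):=(\phi_t|_\Delta)^{-1}(z)$, so $\phi_t$ is defined on $\Delta$ for all $t\in\mathbb{R}$. A compact set is polar if its logarithmic capacity is zero. For a domain $D$ with non-polar boundary and a compact non-polar $E\subset D$, $\omega(z,\partial E,D\setminus E)$ denotes harmonic measure: the Perron solution, evaluated at $z\in D\setminus E$, of the generalized Dirichlet problem on the open set $D\setminus E$ with boundary values $1$ on $\partial E$ and $0$ on $\partial D$. *)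

(* Defs.v *)
From HB Require Import structures.
From mathcomp Require Import all_boot all_order all_algebra.
From mathcomp Require Import all_classical all_reals all_analysis.
From mathcomp Require Import complex.

Set Implicit Arguments.
Unset Strict Implicit.
Unset Printing Implicit Defensive.

Import Order.TTheory GRing.Theory Num.Theory.
Import numFieldNormedType.Exports.

Local Open Scope classical_set_scope.
Local Open Scope ring_scope.

(* MathComp-Analysis puts a topology on variables [K : numFieldType] and on    *)
(* [K^o], but not on the concrete type [R[i]]; these instances transport it.   *)
(* In particular [derivable f z 1], for [f : R[i] -> R[i]], is complex         *)
(* differentiability of [f] at [z].                                            *)
#[non_forgetful_inheritance]
HB.instance Definition _ (R : realType) := PseudoPointedMetric.copy R[i] R[i]^o.
#[non_forgetful_inheritance]
HB.instance Definition _ (R : realType) := GRing.ComAlgebra.copy R[i] R[i]^o.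
#[non_forgetful_inheritance]
HB.instance Definition _ (R : realType) := Vector.copy R[i] R[i]^o.
#[non_forgetful_inheritance]
HB.instance Definition _ (R : realType) := NormedModule.copy R[i] R[i]^o.

(* The MathComp norm [`|z|] of a complex number is itself complex; [cabs z] is *)
(* its modulus as a real number.                                               *)
Definition cabs (R : realType) (z : R[i]) : R := complex.Re `|z|.

Definition boundary (T : topologicalType) (A : set T) : set T :=
  closure A `\` A°.

Definition unit_disk (R : realType) : set R[i] := [set z | cabs z < 1].
Arguments unit_disk R : clear implicits.

Definition unit_circle (R : realType) : set R[i] := [set z | cabs z = 1].
Arguments unit_circle R : clear implicits.

Definition holomorphic_on (R : realType) (U : set R[i]) (f : R[i] -> R[i]) :=
  forall z, U z -> derivable f z 1.

Definition artanh (R : realType) (x : R) : R := ln ((1 + x) / (1 - x)) / 2.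

Definition hyp_dist (R : realType) (z w : R[i]) : R :=
  artanh (cabs ((z - w) / (1 - z^* * w))).

Section SimplyConnected.
Variable R : realType.

Definition path_in (U : set R[i]) (g : R -> R[i]) :=
  {within `[0, 1], continuous g} /\ g @` `[0, 1] `<=` U.

Definition path_connected (U : set R[i]) :=
  forall x y, U x -> U y ->
    exists g, [/\ path_in U g, g 0 = x & g 1 = y].

(* In [H (s, t)], [s] is the homotopy parameter and [t] the loop parameter.    *)
Definition null_homotopic (U : set R[i]) (g : R -> R[i]) :=
  exists H : R * R -> R[i],
    [/\ {within `[0, 1] `*` `[0, 1], continuous H},
        H @` (`[0, 1] `*` `[0, 1]) `<=` U,
        forall t : R, 0 <= t <= 1 -> H (0, t) = g t /\ H (1, t) = g 0 &
        forall s : R, 0 <= s <= 1 -> H (s, 0) = g 0 /\ H (s, 1) = g 0].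

Definition simply_connected (U : set R[i]) :=
  path_connected U /\
  forall g, path_in U g -> g 0 = g 1 -> null_homotopic U g.

End SimplyConnected.

Section AngularLimits.
Variable R : realType.

Definition stolz_region (zeta : R[i]) (M : R) : set R[i] :=
  [set z | cabs z < 1 /\ cabs (zeta - z) < M * (1 - cabs z)].

(* For [M <= 1] the region is empty and the limit condition would be vacuous.  *)
Definition angular_limit (f : R[i] -> R[i]) (zeta l : R[i]) :=
  forall M : R, 1 < M -> f z @[z --> within (stolz_region zeta M) (nbhs zeta)] --> l.

Definition angular_derivative (f : R[i] -> R[i]) (zeta omega l : R[i]) :=
  angular_limit f zeta omega /\
  angular_limit (fun z => (f z - omega) / (z - zeta)) zeta l.

End AngularLimits.

Section Semigroups.
Variable R : realType.
Implicit Types (phi : R -> R[i] -> R[i]) (Delta : set R[i]).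

(* Only the values [phi t z] with [0 <= t] and [z] in the disk matter.         *)
Record holomorphic_semigroup phi : Prop := HolomorphicSemigroup {
  semigroup_holo : forall t : R, 0 <= t -> holomorphic_on (unit_disk R) (phi t) ;
  semigroup_self : forall t : R, 0 <= t ->
    forall z, unit_disk R z -> unit_disk R (phi t z) ;
  semigroup_id : forall z, unit_disk R z -> phi 0 z = z ;
  semigroupD : forall s t : R, 0 <= s -> 0 <= t ->
    forall z, unit_disk R z -> phi (t + s) z = phi t (phi s z) ;
  semigroup_cvg : forall K : set R[i], compact K -> K `<=` unit_disk R ->
    {uniform K, phi t @[t --> 0^'+] --> id} }.

(* [phi] is non-elliptic with Denjoy-Wolff point [tau].                        *)
Definition non_elliptic phi (tau : R[i]) :=
  unit_circle R tau /\
  forall z, unit_disk R z -> phi t z @[t --> +oo] --> tau.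

Definition parabolic phi (tau : R[i]) :=
  non_elliptic phi tau /\
  forall t : R, 0 <= t -> angular_derivative (phi t) tau tau 1.

Definition boundary_regular_fixed_point phi (sigma : R[i]) :=
  unit_circle R sigma /\
  forall t : R, 0 <= t -> exists l, angular_derivative (phi t) sigma sigma l.

Definition backward_orbit phi (z : R[i]) (gamma : R -> R[i]) :=
  [/\ {within `[0, +oo[, continuous gamma},
      forall t : R, 0 <= t -> unit_disk R (gamma t),
      gamma 0 = z &
      forall t s : R, 0 <= s <= t -> phi s (gamma t) = gamma (t - s)].

Definition regular_orbit (gamma : R -> R[i]) :=
  (limf_esup (fun t => (hyp_dist (gamma t) (gamma (t + 1)))%:E) (pinfty_nbhs R)
     < +oo)%E.

Definition backward_invariant_set phi : set R[i] :=
  \bigcap_(t in [set t : R | 0 <= t]) (phi t @` unit_disk R).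

Definition automorphism (U : set R[i]) (f : R[i] -> R[i]) :=
  [/\ holomorphic_on U f, set_bij U U f &
      exists g, [/\ holomorphic_on U g, {in U, cancel f g} & {in U, cancel g f}]].

(* The map phi_t, t : R, on a petal [Delta]: for [t < 0] it is the inverse of  *)
(* the restriction of [phi (- t)] to [Delta].                                  *)
Definition petal_flow phi Delta (t : R) : R[i] -> R[i] :=
  if 0 <= t then phi t else pinv Delta (phi (- t)).

Record petal phi (tau : R[i]) Delta : Prop := Petal {
  petal_neq0 : Delta !=set0 ;
  petal_simply_connected : simply_connected Delta ;
  petal_component : exists2 x, (backward_invariant_set phi)° x &
    Delta = connected_component (backward_invariant_set phi)° x ;
  petal_image : forall t : R, 0 <= t -> phi t @` Delta = Delta ;
  petal_aut : forall t, automorphism Delta (petal_flow phi Delta t) ;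
  petal_group : forall s t z, Delta z ->
    petal_flow phi Delta (s + t) z
      = petal_flow phi Delta s (petal_flow phi Delta t z) ;
  petal_DW : boundary Delta tau ;
  petal_fixed_point : exists sigma : R[i],
    [/\ unit_circle R sigma /\ boundary Delta sigma,
        forall z, Delta z ->
          let gamma := fun t => petal_flow phi Delta (- t) z in
          [/\ backward_orbit phi z gamma, regular_orbit gamma &
              gamma t @[t --> +oo] --> sigma],
        boundary_regular_fixed_point phi sigma &
        sigma = tau -> parabolic phi tau] }.

End Semigroups.

Section Capacity.
Variable R : realType.

Definition borelC := g_sigma_algebraType (@open R[i]).

Definition log_energy (K : set R[i]) (mu : set borelC -> \bar R) : \bar R :=
  (\int[mu]_(z in (K : set borelC)) \int[mu]_(w in (K : set borelC))
     lne (cabs ((z : R[i]) - (w : R[i])))%:E)%E.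

(* c(K) = sup exp I(mu) over the Borel probability measures carried by the     *)
(* compact set K. The value 0 is adjoined so that the capacity of the empty    *)
(* set, which carries no probability measure, is 0 and not -oo.                *)
Definition log_capacity (K : set R[i]) : \bar R :=
  ereal_sup (0%E |` [set c | exists mu : probability borelC R,
    mu (K : set borelC) = 1%E /\ c = expeR (log_energy K mu)]).

Definition polar (K : set R[i]) := log_capacity K = 0%E.

End Capacity.

Section Perron.
Variable R : realType.
Implicit Types (U : set R[i]) (u : R[i] -> \bar R).

Definition circle_mean u (w : R[i]) (r : R) : \bar R :=
  (((2 * pi)^-1)%:E * \int[@lebesgue_measure R]_(t in `[0%R, (2 * pi)%R])
     u (w + r%:C%C * (cos t +i* sin t)%C)%R)%E.

(* Upper semicontinuous with values in [-oo, +oo[ and satisfying the local     *)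
(* submean inequality; [u = -oo] is allowed.                                   *)
Definition subharmonic_on U u :=
  [/\ forall z, U z -> (u z < +oo)%E,
      forall z, U z -> forall a : \bar R, (u z < a)%E ->
        \forall w \near z, U w -> (u w < a)%E &
      forall w, U w -> exists2 rho : R, 0 < rho &
        [set z | cabs (z - w) < rho] `<=` U /\
        forall r, 0 <= r < rho -> (u w <= circle_mean u w r)%E].

Definition perron_family U (f : R[i] -> R) : set (R[i] -> \bar R) :=
  [set u | subharmonic_on U u /\
    forall zeta, boundary U zeta ->
      (limf_esup u (within U (nbhs zeta)) <= (f zeta)%:E)%E].

(* Meant for bounded open [U]: the boundary is taken in C, without the point   *)
(* at infinity.                                                                *)
Definition perron_solution U (f : R[i] -> R) (z : R[i]) : \bar R :=
  ereal_sup [set u z | u in perron_family U f].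

(* omega(z, B, U), for a subset B of the boundary of U.                        *)
Definition harmonic_measure (z : R[i]) (B U : set R[i]) : \bar R :=
  perron_solution U \1_B z.

End Perron.

(* Main.v *)
Require Import Defs.
From mathcomp Require Import all_boot all_order all_algebra.
From mathcomp Require Import all_classical all_reals all_analysis.
From mathcomp Require Import complex ring lra.
Import Order.TTheory GRing.Theory Num.Theory.
Import numFieldNormedType.Exports.
Local Open Scope classical_set_scope.
Local Open Scope ring_scope.
Set Implicit Arguments.
Unset Strict Implicit.
Unset Printing Implicit Defensive.

(** For [s >= 0] let [psi_s] be the inverse of [phi_s] on the petal [Delta].
    Since [phi_s] is univalent on the disk and [phi_s o psi_s] is the identity on
    [Delta], the harmonic measure of [psi_s(K)] in the disk, seen from
    [psi_s(z)], is the harmonic measure of [K] in [phi_s(disk)], seen from [z].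
    The domains [phi_s(disk)] decrease with [s], and [Delta] is a component of
    the interior of their intersection; the theorem says that harmonic measure
    passes to the limit.  Both inequalities come from moving competitors between
    Perron families.

    Lower bound, [perron_image_ge]: a competitor [v] for [Delta \ K] gives the
    competitor [max (v o phi_s, 0)], extended by zero, for the disk minus
    [psi_s(K)].  Hence the limit is approached from above.

    Upper bound, [perron_image_le]: if [v] competes in the disk minus [psi_s(K)],
    then [v o psi_s - e] competes in [Delta \ K] as soon as [v o psi_s <= e] near
    the boundary of [Delta].  A boundary point of [Delta] is not interior to the
    backward invariant set, so it is close to a point [p] omitted by [phi_s] for
    large [s], uniformly on the compact boundary.  By [barrier_bound], [v o psi_s]
    is small near such a [p].  Indeed [phi_s - p] has no zero on the disk, so a
    multiple of it has a root [S] of order [N = 2 ^ k] there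
    ([root2_on_unit_disk]), and [S] can be rotated so that it is positive at the
    image of a base point.  The function [Re (1 / (N (1 - S)))] is positive and
    harmonic, at most [2 / N] where [phi_s - p] is tiny, and on [psi_s(K)] it is
    bounded below independently of [s], [p] and [N], by Harnack's inequality on
    [Delta] ([harnack_compact]).  The maximum principle
    ([comparison_principle]) bounds [v] by a constant times this function.  Here
    [N (1 - S)] plays the part of [- log (phi_s - p)].

    Two facts of complex analysis carry this.  Subharmonicity, defined by circle
    means, is invariant under biholomorphic maps ([subharmonic_conformal]): an
    upper semicontinuous function on a circle is a decreasing limit of Lipschitz
    majorants, each Lipschitz function is uniformly close on the circle to the
    real part of a rational function ([Lipschitz_approx]), and real parts of
    holomorphic functions can be compared with subharmonic functions after a
    change of variables.  This needs the mean value property for functions that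
    are only assumed complex differentiable ([mean_Re]), which is Goursat's
    bisection argument, run in polar coordinates so that periodicity cancels two
    of the four sides. *)

Local Notation Re := complex.Re.
Local Notation Im := complex.Im.

(** * The modulus and the topology of the complex plane *)

Section Modulus.
Variable R : realType.
Local Notation C := R[i].
Implicit Types (z w : C) (A U : set C).

Lemma cabsE z : (cabs z)%:C%C = `|z|.
Proof. by rewrite /cabs normc_def /=. Qed.

Lemma cabs_sqrt z : cabs z = Num.sqrt (Re z ^+ 2 + Im z ^+ 2).
Proof. by rewrite /cabs normc_def /=. Qed.

Lemma sqr_cabs z : cabs z ^+ 2 = Re z ^+ 2 + Im z ^+ 2.
Proof. by rewrite cabs_sqrt sqr_sqrtr // addr_ge0 // sqr_ge0. Qed.

Lemma cabs_ge0 z : 0 <= cabs z.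
Proof. by rewrite cabs_sqrt sqrtr_ge0. Qed.

Lemma cabs0 : cabs (0 : C) = 0.
Proof. by apply: complexI; rewrite cabsE normr0. Qed.

Lemma cabs1 : cabs (1 : C) = 1.
Proof. by apply: complexI; rewrite cabsE normr1. Qed.

Lemma cabs_eq0 z : (cabs z == 0) = (z == 0).
Proof. by rewrite -(normr_eq0 z) -cabsE (inj_eq (@complexI _)). Qed.

Lemma cabs_gt0 z : (0 < cabs z) = (z != 0).
Proof. by rewrite lt0r cabs_eq0 cabs_ge0 andbT. Qed.

Lemma cabsM z w : cabs (z * w) = cabs z * cabs w.
Proof. by apply: complexI; rewrite rmorphM !cabsE normrM. Qed.

Lemma cabsV z : cabs z^-1 = (cabs z)^-1.
Proof. by apply: complexI; rewrite fmorphV !cabsE normfV. Qed.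

Lemma cabsX z n : cabs (z ^+ n) = cabs z ^+ n.
Proof. by apply: complexI; rewrite rmorphXn !cabsE normrX. Qed.

Lemma cabsN z : cabs (- z) = cabs z.
Proof. by apply: complexI; rewrite !cabsE normrN. Qed.

Lemma cabsB z w : cabs (z - w) = cabs (w - z).
Proof. by rewrite -cabsN opprB. Qed.

Lemma cabs_real (x : R) : cabs x%:C%C = `|x|.
Proof. by rewrite cabs_sqrt /= expr0n addr0 sqrtr_sqr. Qed.

Lemma cabsD z w : cabs (z + w) <= cabs z + cabs w.
Proof. by rewrite -lecR rmorphD !cabsE ler_normD. Qed.

Lemma cabsJ z : cabs (conjc z) = cabs z.
Proof. by rewrite !cabs_sqrt; case: z => a b /=; rewrite sqrrN. Qed.

Lemma cabs_sub_ge z w : cabs z - cabs w <= cabs (z - w).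
Proof. by rewrite lerBlDr; have := cabsD (z - w) w; rewrite subrK. Qed.

Lemma cabs_tri z y w : cabs (z - w) <= cabs (z - y) + cabs (y - w).
Proof. by have := cabsD (z - y) (y - w); rewrite addrA subrK. Qed.

Lemma Re_le_cabs z : `|Re z| <= cabs z.
Proof.
by rewrite cabs_sqrt -sqrtr_sqr ler_wsqrtr // lerDl sqr_ge0.
Qed.

Lemma Im_le_cabs z : `|Im z| <= cabs z.
Proof.
by rewrite cabs_sqrt -sqrtr_sqr ler_wsqrtr // lerDr sqr_ge0.
Qed.

Lemma cabs_le_ReIm z : cabs z <= `|Re z| + `|Im z|.
Proof.
rewrite -ler_sqr ?nnegrE ?addr_ge0 ?cabs_ge0 // sqr_cabs.
rewrite -(real_normK (num_real (Re z))) -(real_normK (num_real (Im z))).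
have := mulr_ge0 (normr_ge0 (Re z)) (normr_ge0 (Im z)); nra.
Qed.

Lemma ReD z w : Re (z + w) = Re z + Re w. Proof. by case: z w => [? ?] []. Qed.
Lemma ImD z w : Im (z + w) = Im z + Im w. Proof. by case: z w => [? ?] []. Qed.
Lemma ReN z : Re (- z) = - Re z. Proof. by case: z. Qed.
Lemma ImN z : Im (- z) = - Im z. Proof. by case: z. Qed.
Lemma ReM z w : Re (z * w) = Re z * Re w - Im z * Im w.
Proof. by case: z w => [? ?] []. Qed.
Lemma ImM z w : Im (z * w) = Re z * Im w + Im z * Re w.
Proof. by case: z w => [? ?] []. Qed.

Lemma ReV z : Re z^-1 = Re z / cabs z ^+ 2.
Proof. by rewrite sqr_cabs; case: z. Qed.

Definition cball z (e : R) : set C := [set w | cabs (w - z) < e].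

Lemma cball_center z e : 0 < e -> cball z e z.
Proof. by rewrite /cball /= subrr cabs0. Qed.

Lemma nbhsCP z A : nbhs z A <-> exists2 e : R, 0 < e & cball z e `<=` A.
Proof.
split.
  move/nbhs_ballP => [e /= e0 zA].
  have [er ei] : 0 < Re e /\ Im e = 0.
    by move: e0; rewrite ltcE /= => /andP[/eqP ? ?].
  exists (Re e) => // w zw; apply: zA; rewrite /ball /= -cabsE.
  have -> : e = (Re e)%:C%C by case: (e) ei => a b /= ->.
  by rewrite ltcR cabsB.
move=> [e e0 zA]; apply/nbhs_ballP; exists (e%:C)%C; first by rewrite /= ltcR.
by move=> w; rewrite /ball /= -cabsE ltcR => zw; apply: zA; rewrite /cball /= cabsB.
Qed.
End Modulus.

(** * Continuity and complex differentiability *)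

Section Calculus.
Variable R : realType.
Local Notation C := R[i].
Implicit Types (z w : C) (f g : C -> C) (h : C -> R).

Definition ccont f z := forall e : R, 0 < e ->
  exists2 d, 0 < d & forall w, cabs (w - z) < d -> cabs (f w - f z) < e.

(** Real-valued continuity is continuity of the complexified function, so that
    the algebra of limits is proved once. *)
Definition rcont h z := ccont (fun w => (h w)%:C%C) z.

(** Caratheodory's form of differentiability: the difference quotient extends
    continuously.  Products, inverses and compositions then need no estimates. *)
Definition cdiff f z := exists2 q : C -> C, ccont q z &
  forall w, f w = f z + q w * (w - z).

Lemma continuous_ccont f z : {for z, continuous f} <-> ccont f z.
Proof.
split=> [cf e e0|cf A /nbhsCP [e e0 eA]].
  have /cf/nbhsCP [d d0 dA] : nbhs (f z) (cball (f z) e) by apply/nbhsCP; exists e.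
  by exists d.
have [d d0 dA] := cf e e0; apply/nbhsCP; exists d => // w zw.
exact/eA/dA.
Qed.

Lemma ccont_cst c z : ccont (fun=> c) z.
Proof. by move=> e e0; exists 1 => // w _; rewrite subrr cabs0. Qed.

Lemma ccont_id z : ccont id z.
Proof. by move=> e e0; exists e. Qed.

Lemma ccontD f g z : ccont f z -> ccont g z -> ccont (fun w => f w + g w) z.
Proof.
move=> cf cg e e0; have e20 : 0 < e / 2 by rewrite divr_gt0.
have [d d0 fd] := cf _ e20; have [d' d'0 gd] := cg _ e20.
exists (Num.min d d'); first by rewrite lt_min d0.
move=> w; rewrite lt_min => /andP[/fd h1 /gd h2].
rewrite (_ : _ - _ = (f w - f z) + (g w - g z)); last by ring.
by apply: le_lt_trans (cabsD _ _) _; lra.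
Qed.

Lemma ccontM f g z : ccont f z -> ccont g z -> ccont (fun w => f w * g w) z.
Proof.
move=> cf cg e e0.
pose M := cabs (f z) + cabs (g z) + 1.
have M0 : 0 < M by rewrite /M; have := cabs_ge0 (f z); have := cabs_ge0 (g z); lra.
pose e' := Num.min 1 (e / M / 2).
have e'0 : 0 < e' by rewrite lt_min ltr01 !divr_gt0.
have [d d0 fd] := cf _ e'0; have [d' d'0 gd] := cg _ e'0.
exists (Num.min d d'); first by rewrite lt_min d0.
move=> w; rewrite lt_min => /andP[/fd h1 /gd h2].
rewrite (_ : _ - _ = (f w - f z) * (g w - g z) +
  (f z * (g w - g z) + (f w - f z) * g z)); last by ring.
have e'1 : e' <= 1 by rewrite ge_min lexx.
have e'M : e' * M <= e / 2.
  rewrite -ler_pdivlMr // mulrAC /e' ge_min lexx orbT //.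
apply: le_lt_trans (cabsD _ _) _; apply: le_lt_trans (lerD (lexx _) (cabsD _ _)) _.
rewrite !cabsM.
have a0 := cabs_ge0 (f w - f z); have b0 := cabs_ge0 (g w - g z).
have f0 := cabs_ge0 (f z); have g0 := cabs_ge0 (g z).
have h3 : cabs (f w - f z) * cabs (g w - g z) <= e' * 1.
  by apply: ler_pM => //; lra.
have h4 : cabs (f z) * cabs (g w - g z) <= cabs (f z) * e'.
  by apply: ler_pM => //; lra.
have h5 : cabs (f w - f z) * cabs (g z) <= e' * cabs (g z).
  by apply: ler_pM => //; lra.
move: e'M; rewrite /M; lra.
Qed.

Lemma ccontN f z : ccont f z -> ccont (fun w => - f w) z.
Proof.
move=> cf e /cf [d d0 fd]; exists d => // w /fd.
by rewrite -cabsN opprD opprK.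
Qed.

Lemma ccontB f g z : ccont f z -> ccont g z -> ccont (fun w => f w - g w) z.
Proof. by move=> cf cg; apply: ccontD => //; apply: ccontN. Qed.

Lemma ccontV f z : f z != 0 -> ccont f z -> ccont (fun w => (f w)^-1) z.
Proof.
move=> nz; have := nz; rewrite -cabs_gt0 => fz0 cf e e0.
pose m := cabs (f z); have m0 : 0 < m by [].
have e'0 : 0 < Num.min (m / 2) (e * m ^+ 2 / 2).
  by rewrite lt_min divr_gt0 //= divr_gt0 // mulr_gt0 // exprn_gt0.
have [d d0 fd] := cf _ e'0; exists d => // w /fd.
rewrite lt_min => /andP[h1 h2].
have fw0 : m / 2 < cabs (f w).
  by have := cabs_sub_ge (f z) (f w); rewrite cabsB -/m; lra.
have fw1 : 0 < cabs (f w) by apply: lt_trans fw0; rewrite divr_gt0.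
have -> : (f w)^-1 - (f z)^-1 = (f z - f w) / (f w * f z).
  by field; move: fw1; rewrite cabs_gt0 nz => ->.
rewrite cabsM cabsV cabsM ltr_pdivrMr ?mulr_gt0 // cabsB.
apply: lt_le_trans h2 _; rewrite -/m -mulrA ler_pM2l // expr2.
rewrite -mulrA mulrCA mulrC ler_wpM2r // ltW //.
Qed.

Lemma ccont_comp f g z : ccont f z -> ccont g (f z) -> ccont (fun w => g (f w)) z.
Proof.
move=> cf cg e /cg [d d0 gd]; have [d' d'0 fd] := cf _ d0.
by exists d' => // w /fd /gd.
Qed.

Lemma ccont_near f g z (e : R) : 0 < e -> (forall w, cabs (w - z) < e -> f w = g w) ->
  ccont f z -> ccont g z.
Proof.
move=> e0 fg cf r /cf [d d0 fd]; exists (Num.min d e); first by rewrite lt_min d0.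
move=> w; rewrite lt_min => /andP[/fd h zw]; rewrite -!fg //.
by rewrite subrr cabs0.
Qed.

Lemma rcontP h z : rcont h z <-> forall e : R, 0 < e ->
  exists2 d, 0 < d & forall w, cabs (w - z) < d -> `|h w - h z| < e.
Proof.
by split=> H e /H [d d0 hd]; exists d => // w /hd; rewrite -cabs_real rmorphB.
Qed.

Lemma rcont_cst (c : R) z : rcont (fun=> c) z. Proof. exact: ccont_cst. Qed.

Lemma rcontD h k z : rcont h z -> rcont k z -> rcont (fun w => h w + k w) z.
Proof.
rewrite /rcont => ch ck; have -> : (fun w => (h w + k w)%:C%C) =
  (fun w => (h w)%:C%C + (k w)%:C%C) by apply/funext => w; rewrite rmorphD.
exact: ccontD.
Qed.

Lemma rcontN h z : rcont h z -> rcont (fun w => - h w) z.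
Proof.
rewrite /rcont => ch; have -> : (fun w => (- h w)%:C%C) =
  (fun w => - (h w)%:C%C) by apply/funext => w; rewrite rmorphN.
exact: ccontN.
Qed.

Lemma rcontB h k z : rcont h z -> rcont k z -> rcont (fun w => h w - k w) z.
Proof. by move=> ch ck; apply: rcontD => //; apply: rcontN. Qed.

Lemma rcontM h k z : rcont h z -> rcont k z -> rcont (fun w => h w * k w) z.
Proof.
rewrite /rcont => ch ck; have -> : (fun w => (h w * k w)%:C%C) =
  (fun w => (h w)%:C%C * (k w)%:C%C) by apply/funext => w; rewrite rmorphM.
exact: ccontM.
Qed.

Lemma rcontV h z : h z != 0 -> rcont h z -> rcont (fun w => (h w)^-1) z.
Proof.
rewrite /rcont => h0 ch; have -> : (fun w => ((h w)^-1)%:C%C) =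
  (fun w => ((h w)%:C%C)^-1) by apply/funext => w; rewrite fmorphV.
by apply: ccontV => //; rewrite (inj_eq (@complexI _)).
Qed.

Lemma rcont_Re f z : ccont f z -> rcont (fun w => Re (f w)) z.
Proof.
move=> cf; apply/rcontP => e /cf [d d0 fd]; exists d => // w /fd; apply: le_lt_trans.
by rewrite -ReN -ReD Re_le_cabs.
Qed.

Lemma rcont_Im f z : ccont f z -> rcont (fun w => Im (f w)) z.
Proof.
move=> cf; apply/rcontP => e /cf [d d0 fd]; exists d => // w /fd; apply: le_lt_trans.
by rewrite -ImN -ImD Im_le_cabs.
Qed.

Lemma rcont_cabs f z : ccont f z -> rcont (fun w => cabs (f w)) z.
Proof.
move=> cf; apply/rcontP => e /cf [d d0 fd]; exists d => // w /fd; apply: le_lt_trans.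
rewrite ler_norml cabs_sub_ge andbT lerNl opprB cabsB cabs_sub_ge //.
Qed.

Lemma Lipschitz_rcont (X : C -> R) (L : R) z : 0 <= L ->
  (forall x y, `|X x - X y| <= L * cabs (x - y)) -> rcont X z.
Proof.
move=> L0 XL; apply/rcontP => e e0; exists (e / (L + 1)); first by rewrite divr_gt0 // ltr_wpDl.
move=> y; rewrite ltr_pdivlMr ?ltr_wpDl // => yz; apply: le_lt_trans (XL _ _) _.
by apply: le_lt_trans yz; rewrite mulrC ler_wpM2l ?cabs_ge0 // lerDl.
Qed.

Lemma cdiff_ccont f z : cdiff f z -> ccont f z.
Proof.
move=> [q cq fE]; rewrite (_ : f = fun w => f z + q w * (w - z)); last exact/funext.
apply: ccontD; first exact: ccont_cst.
apply: ccontM => //; apply: ccontB; [exact: ccont_id | exact: ccont_cst].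
Qed.

Lemma cdiff_cst c z : cdiff (fun=> c) z.
Proof. by exists (fun=> 0); [exact: ccont_cst | move=> w; rewrite mul0r addr0]. Qed.

Lemma cdiff_id z : cdiff id z.
Proof. by exists (fun=> 1); [exact: ccont_cst | move=> w /=; ring]. Qed.

Lemma cdiffD f g z : cdiff f z -> cdiff g z -> cdiff (fun w => f w + g w) z.
Proof.
move=> [p cp fE] [q cq gE]; exists (fun w => p w + q w); first exact: ccontD.
by move=> w; rewrite fE gE; ring.
Qed.

Lemma cdiffM f g z : cdiff f z -> cdiff g z -> cdiff (fun w => f w * g w) z.
Proof.
move=> df dg; have cg := cdiff_ccont dg.
move: df dg => [p cp fE] [q cq gE].
exists (fun w => p w * g w + f z * q w).
  by apply: ccontD; apply: ccontM => //; exact: ccont_cst.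
by move=> w; rewrite fE [g w]gE; ring.
Qed.

Lemma cdiffN f z : cdiff f z -> cdiff (fun w => - f w) z.
Proof.
move=> [p cp fE]; exists (fun w => - p w); first exact: ccontN.
by move=> w; rewrite fE; ring.
Qed.

Lemma cdiffB f g z : cdiff f z -> cdiff g z -> cdiff (fun w => f w - g w) z.
Proof. by move=> df dg; apply: cdiffD => //; apply: cdiffN. Qed.

Lemma cdiffX f n z : cdiff f z -> cdiff (fun w => f w ^+ n) z.
Proof.
move=> df; elim: n => [|n IH]; first exact: cdiff_cst.
rewrite (_ : (fun _ => _) = fun w => f w * f w ^+ n); first exact: cdiffM.
by apply/funext => w; rewrite exprS.
Qed.

(** A quotient that is only valid near [z] can be replaced by the true
    difference quotient away from [z]. *)
Lemma cdiff_local f z (e : R) (q : C -> C) : 0 < e -> ccont q z ->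
  (forall w, cabs (w - z) < e -> f w = f z + q w * (w - z)) -> cdiff f z.
Proof.
move=> e0 cq fE.
exists (fun w => if cabs (w - z) < e then q w else (f w - f z) / (w - z)).
  by apply: (ccont_near e0 _ cq) => w ->.
move=> w; case: ifPn => [/fE //|]; rewrite -leNgt => we; rewrite divfK; first by ring.
by rewrite -cabs_gt0 (lt_le_trans e0).
Qed.

Lemma cdiff_near f g z (e : R) : 0 < e -> (forall w, cabs (w - z) < e -> f w = g w) ->
  cdiff f z -> cdiff g z.
Proof.
move=> e0 fg [p cp fE]; apply: (cdiff_local e0 cp) => w we.
by rewrite -!fg // subrr cabs0.
Qed.

Lemma ccont_neq0 f z : f z != 0 -> ccont f z ->
  exists2 e : R, 0 < e & forall w, cabs (w - z) < e -> f w != 0.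
Proof.
move=> fz0 cf; have m0 : 0 < cabs (f z) by rewrite cabs_gt0.
have [e e0 fe] := cf _ m0; exists e => // w /fe; apply: contraTneq => ->.
by rewrite sub0r cabsN ltxx.
Qed.

Lemma cdiffV f z : f z != 0 -> cdiff f z -> cdiff (fun w => (f w)^-1) z.
Proof.
move=> fz0 df; have cf := cdiff_ccont df; move: (df) => [p cp fE].
have [e e0 fn0] := ccont_neq0 fz0 cf.
apply: (cdiff_local e0 (q := fun w => - p w * (f w * f z)^-1)).
  apply: ccontM; first exact: ccontN.
  by apply: ccontV; [rewrite mulf_neq0 | apply: ccontM => //; exact: ccont_cst].
move=> w /fn0 fw0; have -> : - p w * (f w * f z)^-1 * (w - z) =
  - (f w - f z) * (f w * f z)^-1 by rewrite [f w in X in _ = X * _]fE; ring.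
by field; rewrite fw0 fz0.
Qed.

Lemma cdiff_comp f g z : cdiff f z -> cdiff g (f z) -> cdiff (fun w => g (f w)) z.
Proof.
move=> df; have cf := cdiff_ccont df; move: df => [p cp fE] [q cq gE].
exists (fun w => q (f w) * p w).
  by apply: ccontM => //; apply: ccont_comp cf cq.
by move=> w; rewrite gE [in X in _ * X](fE w); ring.
Qed.

Lemma cdiff_affine (k b : C) z : cdiff (fun w => k * w + b) z.
Proof.
apply: cdiffD; last exact: cdiff_cst.
by apply: cdiffM; [exact: cdiff_cst|exact: cdiff_id].
Qed.

Lemma derivable_cdiff f z : derivable f z 1 -> cdiff f z.
Proof.
move=> /cvg_ex[l /= fl].
pose q w := if w == z then l else (f w - f z) / (w - z).
exists q; last first.
  move=> w; rewrite /q; case: eqVneq => [->|wz]; first by ring.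
  by rewrite divfK ?subr_eq0 //; ring.
move=> e e0.
have /fl : nbhs l (cball l e) by apply/nbhsCP; exists e.
move=> /nbhsCP [d d0 dA]; exists d => // w wz.
rewrite /q eqxx; case: eqVneq => [_|wnz]; first by rewrite subrr cabs0.
have := dA (w - z); rewrite /cball /= subr0 subr_eq0 => /(_ wz wnz).
by rewrite /GRing.scale /= mulr1 subrK mulrC.
Qed.
End Calculus.

(** * Integrals over segments and Goursat's bisection *)

Section Interval.
Variable R : realType.
Local Notation mu := (@lebesgue_measure R).
Implicit Types (f g : R -> R) (a b c : R).

Definition seg_integral f a b : R := \int[mu]_(x in `[a, b]) f x.
Definition seg_continuous f a b := forall x, a <= x <= b -> {for x, continuous f}.

Lemma seg_continuous_integrable f a b : seg_continuous f a b ->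
  mu.-integrable `[a, b] (EFin \o f).
Proof.
move=> cf; apply: continuous_compact_integrable; first exact: segment_compact.
apply: continuous_in_subspaceT => x; rewrite inE /= in_itv /= => /cf; exact.
Qed.

Lemma seg_integral_split f a b c : a <= c -> c <= b -> seg_continuous f a b ->
  seg_integral f a b = seg_integral f a c + seg_integral f c b.
Proof.
move=> ac cb cf; rewrite /seg_integral.
have /= := @Rintegral_itvB R f (BLeft a) (BRight b) c (seg_continuous_integrable cf) ac cb.
rewrite (@Rintegral_itv_obnd_cbnd R c (BRight b) f); first by move=> <-; ring.
apply: integrableS (seg_continuous_integrable cf) => //.
by apply: subset_itvr; rewrite bnd_simp.
Qed.

Lemma seg_integral_cst c a b : a <= b -> seg_integral (fun=> c) a b = c * (b - a).
Proof.
move=> ab; rewrite /seg_integral Rintegral_cst //; congr (_ * _).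
rewrite [X in fine X](_ : _ = (b - a)%:E) //.
etransitivity; first exact: (@lebesgue_measure_itv R `[a, b]).
rewrite /= lte_fin; case: ltP => //= ba; congr EFin.
by apply/eqP; rewrite eq_sym subr_eq0 eq_le ab ba.
Qed.

Lemma seg_continuous_cst c a b : seg_continuous (fun=> c) a b.
Proof. by move=> x _; exact: cst_continuous. Qed.

Lemma seg_continuousD f g a b : seg_continuous f a b -> seg_continuous g a b -> seg_continuous (fun x => f x + g x) a b.
Proof. by move=> cf cg x xab; apply: continuousD; [exact: cf | exact: cg]. Qed.

Lemma seg_continuousN f a b : seg_continuous f a b -> seg_continuous (fun x => - f x) a b.
Proof. by move=> cf x xab; apply: continuousN; exact: cf. Qed.

Lemma seg_integralD f g a b : seg_continuous f a b -> seg_continuous g a b ->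
  seg_integral (fun x => f x + g x) a b = seg_integral f a b + seg_integral g a b.
Proof. by move=> cf cg; apply: RintegralD => //; [exact: (seg_continuous_integrable cf)|exact: (seg_continuous_integrable cg)]. Qed.

Lemma seg_integralB f g a b : seg_continuous f a b -> seg_continuous g a b ->
  seg_integral (fun x => f x - g x) a b = seg_integral f a b - seg_integral g a b.
Proof. by move=> cf cg; apply: RintegralB => //; [exact: (seg_continuous_integrable cf)|exact: (seg_continuous_integrable cg)]. Qed.

Lemma seg_integralZ f k a b : seg_continuous f a b -> seg_integral (fun x => k * f x) a b = k * seg_integral f a b.
Proof. by move=> cf; apply: RintegralZl => //; exact: seg_continuous_integrable. Qed.

Lemma seg_integral_le f g a b : seg_continuous f a b -> seg_continuous g a b ->
  (forall x, a <= x <= b -> f x <= g x) -> seg_integral f a b <= seg_integral g a b.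
Proof.
move=> cf cg fg; by apply: le_Rintegral => //; [exact: (seg_continuous_integrable cf)|exact: (seg_continuous_integrable cg)].
Qed.

Lemma eq_seg_integral f g a b : (forall x, a <= x <= b -> f x = g x) -> seg_integral f a b = seg_integral g a b.
Proof.
move=> fg; apply: eq_Rintegral => x; rewrite inE /= in_itv /=; exact: fg.
Qed.

Lemma seg_integral_near_cst f c e a b : a <= b -> seg_continuous f a b ->
  (forall x, a <= x <= b -> `|f x - c| <= e) ->
  `|seg_integral f a b - c * (b - a)| <= e * (b - a).
Proof.
move=> ab cf fc; rewrite ler_norml; apply/andP; split.
  have : seg_integral (fun=> c - e) a b <= seg_integral f a b.
    apply: seg_integral_le => //; first exact: seg_continuous_cst.
    by move=> x /fc; rewrite ler_norml => /andP[? ?]; lra.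
  by rewrite seg_integral_cst //; lra.
have : seg_integral f a b <= seg_integral (fun=> c + e) a b.
  apply: seg_integral_le => //; first exact: seg_continuous_cst.
  by move=> x /fc; rewrite ler_norml => /andP[? ?]; lra.
by rewrite seg_integral_cst //; lra.
Qed.
End Interval.

Section Goursat.
Variable R : realType.
Local Notation C := R[i].
Implicit Types (U V : C -> R) (z w : C).

(** Caratheodory's form of real differentiability in the plane, with partial
    derivatives [a] and [b] at [z]. *)
Definition total_diff U z (a b : R) := exists m n : C -> R,
  [/\ rcont m z, rcont n z, m z = a, n z = b &
      forall w, U w = U z + m w * (Re w - Re z) + n w * (Im w - Im z)].

Lemma total_diff_near U z a b e : total_diff U z a b -> 0 < e ->
  exists2 d, 0 < d & forall w, `|Re w - Re z| + `|Im w - Im z| < d ->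
    `|U w - U z - a * (Re w - Re z) - b * (Im w - Im z)|
      <= e * (`|Re w - Re z| + `|Im w - Im z|).
Proof.
move=> [m [n [/rcontP cm /rcontP cn mz nz UE]]] e0.
have [d d0 dm] := cm _ e0; have [d' d'0 dn] := cn _ e0.
exists (Num.min d d'); first by rewrite lt_min d0.
move=> w; rewrite lt_min => /andP[wd wd'].
have wz : cabs (w - z) <= `|Re w - Re z| + `|Im w - Im z|.
  by apply: le_trans (cabs_le_ReIm _) _; rewrite ReD ReN ImD ImN.
have {}dm := ltW (dm w (le_lt_trans wz wd)).
have {}dn := ltW (dn w (le_lt_trans wz wd')).
rewrite UE -mz -nz (_ : _ - _ = (m w - m z) * (Re w - Re z) + (n w - n z) * (Im w - Im z)); last by ring.
apply: le_trans (ler_normD _ _) _; rewrite !normrM mulrDr.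
by apply: lerD; apply: ler_pM.
Qed.

Lemma total_diff_cont U z a b : total_diff U z a b -> rcont U z.
Proof.
move=> [m [n [cm cn _ _ UE]]].
rewrite (_ : U = fun w => U z + m w * (Re w - Re z) + n w * (Im w - Im z)); last exact/funext.
have ci := ccont_id z.
apply: rcontD; first apply: rcontD; first exact: rcont_cst.
  by apply: rcontM => //; apply: rcontB; [exact: (rcont_Re ci)|exact: rcont_cst].
by apply: rcontM => //; apply: rcontB; [exact: (rcont_Im ci)|exact: rcont_cst].
Qed.

Lemma rcont_vert U (x y : R) : rcont U (x +i* y)%C ->
  {for y, continuous (fun t => U (x +i* t)%C)}.
Proof.
move=> /rcontP cU A /nbhs_ballP [e e0 eA]; have [d d0 dU] := cU e e0.
apply/nbhs_ballP; exists d => // t ty; apply: eA; rewrite /ball /= distrC; apply: dU.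
apply: le_lt_trans (cabs_le_ReIm _) _ => /=.
by rewrite subrr normr0 add0r distrC.
Qed.

Lemma rcont_horiz U (x y : R) : rcont U (x +i* y)%C ->
  {for x, continuous (fun t => U (t +i* y)%C)}.
Proof.
move=> /rcontP cU A /nbhs_ballP [e e0 eA]; have [d d0 dU] := cU e e0.
apply/nbhs_ballP; exists d => // t ty; apply: eA; rewrite /ball /= distrC; apply: dU.
apply: le_lt_trans (cabs_le_ReIm _) _ => /=.
by rewrite subrr normr0 addr0 distrC.
Qed.

(** The outward flux of the field [(U, - V)] through the boundary of the
    rectangle with lower left corner [(a, b)], width [w] and height [l]. *)
Definition flux U V (a b w l : R) : R :=
  seg_integral (fun y => U ((a + w) +i* y)%C) b (b + l) - seg_integral (fun y => U (a +i* y)%C) b (b + l)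
  - seg_integral (fun x => V (x +i* (b + l))%C) a (a + w) + seg_integral (fun x => V (x +i* b)%C) a (a + w).

Definition rect (a b w l : R) : set C :=
  [set z | a <= Re z <= a + w /\ b <= Im z <= b + l].

(** The field [(U, - V)] has divergence zero at [z], in terms of pointwise
    derivatives. *)
Definition balanced U V z := exists a b c, total_diff U z a b /\ total_diff V z c a.

Lemma flux_quarter U V (a b w l : R) : 0 <= w -> 0 <= l ->
  (forall z, rect a b w l z -> rcont U z /\ rcont V z) ->
  flux U V a b w l =
    flux U V a b (w / 2) (l / 2) + flux U V (a + w / 2) b (w / 2) (l / 2) +
    flux U V a (b + l / 2) (w / 2) (l / 2) + flux U V (a + w / 2) (b + l / 2) (w / 2) (l / 2).
Proof.
move=> w0 l0 UV.
have w20 : 0 <= w / 2 by rewrite divr_ge0.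
have l20 : 0 <= l / 2 by rewrite divr_ge0.
have wE : a + w / 2 + w / 2 = a + w by lra.
have lE : b + l / 2 + l / 2 = b + l by lra.
have cU x : a <= x <= a + w -> seg_continuous (fun y => U (x +i* y)%C) b (b + l).
  by move=> xa y yb; apply: rcont_vert; apply: (UV _ _).1; split.
have cV y : b <= y <= b + l -> seg_continuous (fun x => V (x +i* y)%C) a (a + w).
  by move=> yb x xa; apply: rcont_horiz; apply: (UV _ _).2; split.
have sU x : a <= x <= a + w -> seg_integral (fun y => U (x +i* y)%C) b (b + l) =
    seg_integral (fun y => U (x +i* y)%C) b (b + l / 2) + seg_integral (fun y => U (x +i* y)%C) (b + l / 2) (b + l).
  by move=> xa; apply: seg_integral_split (cU _ xa); lra.
have sV y : b <= y <= b + l -> seg_integral (fun x => V (x +i* y)%C) a (a + w) =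
    seg_integral (fun x => V (x +i* y)%C) a (a + w / 2) + seg_integral (fun x => V (x +i* y)%C) (a + w / 2) (a + w).
  by move=> yb; apply: seg_integral_split (cV _ yb); lra.
rewrite /flux !wE !lE (sU a) ?(sU (a + w)) ?(sV b) ?(sV (b + l)); lra.
Qed.

(** The flux of an affine field of zero divergence vanishes, so only the
    remainders of [U] and [V] contribute, and these are at most [e (w + l)] on the
    rectangle. *)
Lemma flux_local U V (a b w l : R) z e : 0 <= w -> 0 <= l -> rect a b w l z ->
  (forall z, rect a b w l z -> rcont U z /\ rcont V z) ->
  forall p q r, 0 <= e ->
  (forall y, rect a b w l y -> `|U y - U z - p * (Re y - Re z) - q * (Im y - Im z)|
      <= e * (`|Re y - Re z| + `|Im y - Im z|)) ->
  (forall y, rect a b w l y -> `|V y - V z - r * (Re y - Re z) - p * (Im y - Im z)|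
      <= e * (`|Re y - Re z| + `|Im y - Im z|)) ->
  `|flux U V a b w l| <= 2 * e * (w + l) ^+ 2.
Proof.
move=> w0 l0 rz UV p q r e0 hU hV.
have cU x : a <= x <= a + w -> seg_continuous (fun y => U (x +i* y)%C) b (b + l).
  by move=> xa y yb; apply: rcont_vert; apply: (UV _ _).1; split.
have cV y : b <= y <= b + l -> seg_continuous (fun x => V (x +i* y)%C) a (a + w).
  by move=> yb x xa; apply: rcont_horiz; apply: (UV _ _).2; split.
have near (y : C) : rect a b w l y -> `|Re y - Re z| + `|Im y - Im z| <= w + l.
  move: rz => [/andP[? ?] /andP[? ?]] [/andP[? ?] /andP[? ?]].
  by apply: lerD; rewrite ler_norml; lra.
have ewl y : rect a b w l y -> e * (`|Re y - Re z| + `|Im y - Im z|) <= e * (w + l).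
  by move=> ry; apply: ler_wpM2l => //; apply: near.
have aw : a <= a + w <= a + w by lra.
have aa : a <= a <= a + w by lra.
have bl : b <= b + l <= b + l by lra.
have bb : b <= b <= b + l by lra.
have H1 : `|seg_integral (fun y => U ((a + w) +i* y)%C - U (a +i* y)%C) b (b + l) - p * w * (b + l - b)|
    <= 2 * e * (w + l) * (b + l - b).
  apply: seg_integral_near_cst; [lra | |].
    by apply: seg_continuousD; [exact: cU | apply: seg_continuousN; exact: cU].
  move=> y yb.
  have r1 : rect a b w l ((a + w) +i* y)%C by split.
  have r2 : rect a b w l (a +i* y)%C by split.
  have := le_trans (hU _ r1) (ewl _ r1); have := le_trans (hU _ r2) (ewl _ r2).
  by rewrite /= !ler_norml => /andP[? ?] /andP[? ?]; lra.
have H2 : `|seg_integral (fun x => V (x +i* (b + l))%C - V (x +i* b)%C) a (a + w) - p * l * (a + w - a)|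
    <= 2 * e * (w + l) * (a + w - a).
  apply: seg_integral_near_cst; [lra | |].
    by apply: seg_continuousD; [exact: cV | apply: seg_continuousN; exact: cV].
  move=> x xa.
  have r1 : rect a b w l (x +i* (b + l))%C by split.
  have r2 : rect a b w l (x +i* b)%C by split.
  have := le_trans (hV _ r1) (ewl _ r1); have := le_trans (hV _ r2) (ewl _ r2).
  by rewrite /= !ler_norml => /andP[? ?] /andP[? ?]; lra.
move: H1 H2; rewrite !seg_integralB; [|exact: cV|exact: cV|exact: cU|exact: cU].
rewrite /flux !ler_norml => /andP[? ?] /andP[? ?]; nra.
Qed.

Section Bisection.
Variables (U V : C -> R) (a b w l : R).
Hypotheses (w0 : 0 <= w) (l0 : 0 <= l).
Hypothesis UV : forall z, rect a b w l z -> balanced U V z.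

Let side (x : R) n := x / 2 ^+ n.
Let child n (p : R * R) : seq (R * R) :=
  [:: p; (p.1 + side w n.+1, p.2); (p.1, p.2 + side l n.+1);
      (p.1 + side w n.+1, p.2 + side l n.+1)].
Let big n (p q : R * R) :=
  `|flux U V p.1 p.2 (side w n) (side l n)| <= 4 * `|flux U V q.1 q.2 (side w n.+1) (side l n.+1)|.
(** The nested rectangles of Goursat's argument: from each one, the first
    quarter that keeps at least a fourth of the flux.  The default [p] of [nth] is
    never reached, by [flux_quarter]. *)
Fixpoint corner n : R * R :=
  if n is m.+1 then let p := corner m in nth p (child m p) (find (big m p) (child m p))
  else (a, b).

Lemma side_ge0 x n : 0 <= x -> 0 <= side x n.
Proof. by move=> x0; rewrite divr_ge0 // exprn_ge0. Qed.

Lemma side_half x n : side x n.+1 = side x n / 2.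
Proof. by rewrite /side exprSr invfM mulrA. Qed.

Lemma corner_step n : let p := corner n in let q := corner n.+1 in
  [/\ p.1 <= q.1, q.1 + side w n.+1 <= p.1 + side w n,
      p.2 <= q.2 & q.2 + side l n.+1 <= p.2 + side l n].
Proof.
move=> p q; rewrite !side_half.
have -> : q = nth p (child n p) (find (big n p) (child n p)) by [].
have := side_ge0 n w0; have := side_ge0 n l0.
case: (find (big n p) (child n p)) => [|[|[|[|k]]]] /=;
  rewrite ?nth_nil ?side_half => ? ?; split; lra.
Qed.

Lemma corner_rect n : rect (corner n).1 (corner n).2 (side w n) (side l n) `<=` rect a b w l.
Proof.
elim: n => [|n IH]; first by rewrite /side !expr0 !divr1.
apply: subset_trans IH; have [h1 h2 h3 h4] := corner_step n.
by move=> z [/andP[? ?] /andP[? ?]]; split; apply/andP; split; lra.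
Qed.

Lemma UV_cont z : rect a b w l z -> rcont U z /\ rcont V z.
Proof.
by move=> /UV [p [q [r [/total_diff_cont ? /total_diff_cont ?]]]].
Qed.

Lemma corner_big n : big n (corner n) (corner n.+1).
Proof.
rewrite /=; set p := corner n.
have hs : has (big n p) (child n p).
  apply/negPn/negP; rewrite -all_predC /= -!ltNge !andbT.
  move=> /and4P[]; rewrite /= !side_half.
  have c : forall z, rect p.1 p.2 (side w n) (side l n) z -> rcont U z /\ rcont V z.
    by move=> z /corner_rect; exact: UV_cont.
  rewrite (flux_quarter (side_ge0 n w0) (side_ge0 n l0) c).
  set f1 := flux _ _ _ _ _ _; set f2 := flux _ _ _ _ _ _.
  set f3 := flux _ _ _ _ _ _; set f4 := flux _ _ _ _ _ _.
  have := ler_normD (f1 + f2 + f3) f4; have := ler_normD (f1 + f2) f3.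
  have := ler_normD f1 f2; lra.
exact: nth_find.
Qed.

Lemma corner_flux n : `|flux U V a b w l| <=
  4 ^+ n * `|flux U V (corner n).1 (corner n).2 (side w n) (side l n)|.
Proof.
elim: n => [|n IH]; first by rewrite expr0 mul1r /side !expr0 !divr1.
apply: le_trans IH _; rewrite exprSr -mulrA ler_wpM2l ?exprn_ge0 //.
exact: corner_big.
Qed.

Lemma corner_mono n m : (n <= m)%N ->
  [/\ (corner n).1 <= (corner m).1, (corner m).1 + side w m <= (corner n).1 + side w n,
      (corner n).2 <= (corner m).2 & (corner m).2 + side l m <= (corner n).2 + side l n].
Proof.
move=> /subnK <-; elim: (m - n)%N => [|k [h1 h2 h3 h4]]; first by [].
by have [g1 g2 g3 g4] := corner_step (k + n)%N; rewrite addSn; split; lra.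
Qed.

Lemma corner_limit : exists z, forall n,
  rect (corner n).1 (corner n).2 (side w n) (side l n) z.
Proof.
pose X := range (fun n => (corner n).1); pose Y := range (fun n => (corner n).2).
have ub n : ubound X ((corner n).1 + side w n) /\ ubound Y ((corner n).2 + side l n).
  split=> _ [m _ <-].
    have [h|/ltnW h] := leqP n m; have [h1 h2 h3 h4] := corner_mono h;
      have := side_ge0 m w0; have := side_ge0 n w0; lra.
  have [h|/ltnW h] := leqP n m; have [h1 h2 h3 h4] := corner_mono h;
      have := side_ge0 m l0; have := side_ge0 n l0; lra.
have hX : has_sup X by split; [exists (corner 0).1, 0%N | exists ((corner 0).1 + side w 0); exact: (ub 0%N).1].
have hY : has_sup Y by split; [exists (corner 0).2, 0%N | exists ((corner 0).2 + side l 0); exact: (ub 0%N).2].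
exists (sup X +i* sup Y)%C => n; split=> /=; apply/andP; split.
- by apply: ub_le_sup; [exact: hX.2 | exists n].
- by apply: ge_sup; [exact: hX.1 | exact: (ub n).1].
- by apply: ub_le_sup; [exact: hY.2 | exists n].
- by apply: ge_sup; [exact: hY.1 | exact: (ub n).2].
Qed.

(** Goursat's argument: the [n]-th rectangle carries at least [4 ^ - n] of the
    flux, but its area is [4 ^ - n] of the area, and near the common point of all
    the rectangles the flux is negligible compared with the area. *)
Lemma flux0 : flux U V a b w l = 0.
Proof.
apply/eqP; rewrite -normr_le0; apply/ler_addgt0Pl => e e0; rewrite addr0.
have [z zn] := corner_limit.
have [p [q [r [dU dV]]]] : balanced U V z by apply: UV; apply: corner_rect (zn 0%N).
pose e' := e / (2 * ((w + l) ^+ 2 + 1)).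
have D0 : 0 < (w + l) ^+ 2 + 1 by rewrite ltr_wpDl // sqr_ge0.
have e'0 : 0 < e' by rewrite divr_gt0 // mulr_gt0.
have [d d0 hU] := total_diff_near dU e'0; have [d' d'0 hV] := total_diff_near dV e'0.
have [n nd] : exists n, side (w + l) n < Num.min d d'.
  have m0 : 0 < Num.min d d' by rewrite lt_min d0.
  pose n := Num.bound ((w + l) / Num.min d d'); exists n.
  rewrite /side ltr_pdivrMr ?exprn_gt0 // mulrC -ltr_pdivrMr //.
  apply: lt_trans (archi_boundP _) _; first by rewrite divr_ge0 ?addr_ge0 // ltW.
  by rewrite -natrX ltr_nat ltn_expl.
have sD : side w n + side l n = side (w + l) n by rewrite /side mulrDl.
have near (y : C) : rect (corner n).1 (corner n).2 (side w n) (side l n) y ->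
    `|Re y - Re z| + `|Im y - Im z| < Num.min d d'.
  move=> [/andP[? ?] /andP[? ?]]; apply: le_lt_trans nd; rewrite -sD.
  have [/andP[? ?] /andP[? ?]] := zn n.
  by apply: lerD; rewrite ler_norml; lra.
apply: le_trans (corner_flux n) _.
have c : forall z, rect (corner n).1 (corner n).2 (side w n) (side l n) z -> rcont U z /\ rcont V z.
  by move=> y /corner_rect; exact: UV_cont.
have := flux_local (side_ge0 n w0) (side_ge0 n l0) (zn n) c (ltW e'0) (p := p) (q := q) (r := r).
move=> /(_ _ _)/le_trans H.
apply: le_trans (ler_wpM2l _ (H _ _ _ (lexx _))) _.
- by rewrite exprn_ge0.
- by move=> y /near; rewrite lt_min => /andP[/hU ? _].
- by move=> y /near; rewrite lt_min => /andP[_ /hV].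
rewrite sD /side expr_div_n -exprM mulnC exprM.
rewrite (_ : 2 ^+ 2 = 4 :> R); last by ring.
have -> : 4 ^+ n * (2 * e' * ((w + l) ^+ 2 / 4 ^+ n)) = 2 * e' * (w + l) ^+ 2.
  by field; rewrite expf_neq0.
have eE : e = 2 * e' * ((w + l) ^+ 2 + 1) by rewrite /e'; field; rewrite gt_eqF.
by rewrite [leRHS]eE; apply: ler_wpM2l; [rewrite mulr_ge0 // ltW | rewrite lerDl].
Qed.
End Bisection.
End Goursat.

(** * The mean value property *)

Section MeanValue.
Variable R : realType.
Local Notation C := R[i].
Implicit Types (z w : C) (G : C -> C) (h k : C -> R).

Definition expi (t : R) : C := (cos t +i* sin t)%C.
Definition circ (w : C) (r t : R) : C := w + r%:C%C * expi t.

Lemma cabs_expi t : cabs (expi t) = 1.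
Proof. by rewrite cabs_sqrt /= cos2Dsin2 sqrtr1. Qed.

Lemma circ_dist w r t : 0 <= r -> cabs (circ w r t - w) = r.
Proof. by move=> r0; rewrite addrC addKr cabsM cabs_expi mulr1 cabs_real ger0_norm. Qed.

Lemma real_carath (f : R -> R) (t d : R) : is_derive t (1 : R) f d ->
  exists q : R -> R, [/\ {for t, continuous q}, q t = d &
    forall s, f s = f t + q s * (s - t)].
Proof.
move=> df; have fl : h^-1 *: (f (h *: 1 + t) - f t) @[h --> 0^'] --> d.
  have [dv <-] := df; exact: dv.
pose q s := if s == t then d else (f s - f t) / (s - t).
exists q; split; last first.
- move=> s; rewrite /q; case: eqVneq => [->|st]; first by ring.
  by rewrite divfK ?subr_eq0 //; ring.
- by rewrite /q eqxx.
have qt : q t = d by rewrite /q eqxx.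
move=> A; rewrite qt => /nbhs_ballP [e e0 eA].
have /fl/nbhs_ballP [r r0 rA] : nbhs d (ball d e) by apply: nbhsx_ballx.
apply/nbhs_ballP; exists r => // s st; apply: eA; rewrite /q.
case: eqVneq => [_|snt]; first exact: ballxx.
have := rA (s - t); rewrite /ball /= sub0r opprB distrC => H.
have : `|s - t| < r by rewrite distrC.
move=> /H; rewrite subr_eq0 => /(_ snt).
by rewrite /GRing.scale /= mulr1 subrK mulrC.
Qed.

Lemma rcont_compIm (q : R -> R) z : {for Im z, continuous q} -> rcont (fun w => q (Im w)) z.
Proof.
move=> cq; apply/rcontP => e e0.
have /cq/nbhs_ballP [d d0 dA] : nbhs (q (Im z)) (ball (q (Im z)) e) by apply: nbhsx_ballx.
exists d => // w wz; rewrite distrC; apply: dA; rewrite /ball /= distrC.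
by apply: le_lt_trans wz; rewrite -ImN -ImD Im_le_cabs.
Qed.

Lemma rcont_compRe (q : R -> R) z : {for Re z, continuous q} -> rcont (fun w => q (Re w)) z.
Proof.
move=> cq; apply/rcontP => e e0.
have /cq/nbhs_ballP [d d0 dA] : nbhs (q (Re z)) (ball (q (Re z)) e) by apply: nbhsx_ballx.
exists d => // w wz; rewrite distrC; apply: dA; rewrite /ball /= distrC.
by apply: le_lt_trans wz; rewrite -ReN -ReD Re_le_cabs.
Qed.

Lemma ccont_ReIm (f : C -> C) z : rcont (fun w => Re (f w)) z -> rcont (fun w => Im (f w)) z -> ccont f z.
Proof.
move=> cr ci; rewrite (_ : f = fun w => (Re (f w))%:C%C + 'i%C * (Im (f w))%:C%C).
  by apply: ccontD => //; apply: ccontM => //; exact: ccont_cst.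
by apply/funext => w; rewrite -complexE.
Qed.

(** Caratheodory's quotient of [t |-> exp (i t)], as a function on the plane of
    polar coordinates [z = r + i t]. *)
Lemma expi_carath t : exists q : C -> C, [/\ forall z, Im z = t -> ccont q z,
    forall z, Im z = t -> q z = 'i%C * expi t &
    forall z, expi (Im z) = expi t + q z * ((Im z)%:C%C - t%:C%C)].
Proof.
have [p [cp pt pE]] := real_carath (is_derive_cos t).
have [q [cq qt qE]] := real_carath (is_derive_sin t).
exists (fun z => (p (Im z) +i* q (Im z))%C); split.
- by move=> z zt; apply: ccont_ReIm; apply: rcont_compIm; rewrite zt.
- move=> z ->; rewrite pt qt /expi; apply/eqP; rewrite eq_complex /=.
  by apply/andP; split; apply/eqP; ring.
move=> z; apply/eqP; rewrite /expi eq_complex /= pE qE.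
by apply/andP; split; apply/eqP; ring.
Qed.

Lemma ccont_Re z : ccont (fun w => (Re w)%:C%C) z.
Proof. exact: (rcont_Re (ccont_id z)). Qed.

Lemma ccont_expi z : ccont (fun w => expi (Im w)) z.
Proof.
apply: ccont_ReIm => /=; apply: rcont_compIm; [exact: continuous_cos|exact: continuous_sin].
Qed.

Lemma total_diffM (U V : C -> R) z a b c d : total_diff U z a b -> total_diff V z c d ->
  total_diff (fun w => U w * V w) z (a * V z + U z * c) (b * V z + U z * d).
Proof.
move=> dU dV; have cV := total_diff_cont dV.
move: dU dV => [m [n [cm cn mz nz UE]]] [m' [n' [cm' cn' mz' nz' VE]]].
exists (fun w => m w * V w + U z * m' w), (fun w => n w * V w + U z * n' w); split.
- by apply: rcontD; apply: rcontM => //; exact: rcont_cst.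
- by apply: rcontD; apply: rcontM => //; exact: rcont_cst.
- by rewrite mz mz'.
- by rewrite nz nz'.
by move=> w; rewrite UE [V w in X in X = _]VE [V w]VE; ring.
Qed.

Lemma total_diff_Re (f : R -> R) z (d : R) : is_derive (Re z) (1 : R) f d ->
  total_diff (fun w => f (Re w)) z d 0.
Proof.
move=> /real_carath [q [cq qz fE]].
exists (fun w => q (Re w)), (fun=> 0); split => //; first exact: rcont_compRe.
  exact: rcont_cst.
by move=> w; rewrite fE; ring.
Qed.

(** The polar Cauchy-Riemann equation [r (Re G)_r = (Im G)_t] says that
    [(Re G, - Im G / r)] has zero divergence in the plane of polar coordinates,
    whose points [r + i t] are again encoded as complex numbers. *)
Lemma polar_balanced G w0 z : Re z != 0 -> cdiff G (circ w0 (Re z) (Im z)) ->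
  balanced (fun p => Re (G (circ w0 (Re p) (Im p))))
           (fun p => Im (G (circ w0 (Re p) (Im p))) * (Re p)^-1) z.
Proof.
move=> z0 [q cq GE].
have [k [ck kE EE]] := expi_carath (Im z).
have {}ck := ck z erefl; have {}kE := kE z erefl.
pose P (p : C) := circ w0 (Re p) (Im p).
have cP : ccont P z.
  rewrite /P /circ; apply: ccontD; first exact: ccont_cst.
  by apply: ccontM; [exact: ccont_Re | exact: ccont_expi].
pose m (p : C) := q (P p) * expi (Im p).
pose n (p : C) := q (P p) * ((Re z)%:C%C * k p).
have cm : ccont m z by apply: ccontM; [exact: ccont_comp cP cq | exact: ccont_expi].
have cn : ccont n z.
  apply: ccontM; first exact: ccont_comp cP cq.
  by apply: ccontM => //; exact: ccont_cst.
have GP p : G (P p) = G (P z) + m p * (Re p - Re z)%:C%C + n p * (Im p - Im z)%:C%C.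
  have EP : P p - P z = expi (Im p) * (Re p - Re z)%:C%C + (Re z)%:C%C * k p * (Im p - Im z)%:C%C.
    by rewrite /P /circ !rmorphB /= (EE p); ring.
  by rewrite GE -/(P z) EP /m /n; ring.
have ReGP p : Re (G (P p)) = Re (G (P z)) + Re (m p) * (Re p - Re z) + Re (n p) * (Im p - Im z).
  by rewrite GP !ReD !ReM /=; ring.
have ImGP p : Im (G (P p)) = Im (G (P z)) + Im (m p) * (Re p - Re z) + Im (n p) * (Im p - Im z).
  by rewrite GP !ImD !ImM /=; ring.
have nm : Im (n z) * (Re z)^-1 = Re (m z).
  have -> : n z = (Re z)%:C%C * ('i%C * m z) by rewrite /n /m kE; ring.
  by rewrite ImM ReM ImM /=; field.
have dU : total_diff (fun p => Re (G (P p))) z (Re (m z)) (Re (n z)).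
  by exists (fun p => Re (m p)), (fun p => Re (n p)); split => //; exact: rcont_Re.
have dV : total_diff (fun p => Im (G (P p))) z (Im (m z)) (Im (n z)).
  by exists (fun p => Im (m p)), (fun p => Im (n p)); split => //; exact: rcont_Im.
have dI : total_diff (fun p => (Re p)^-1) z (- (Re z) ^- 2 *: 1) 0.
  by apply: (@total_diff_Re (fun x => x^-1)); exact: is_deriveV.
have := total_diffM dV dI; rewrite mulr0 addr0 nm => dW.
by exists (Re (m z)), (Re (n z)); eexists; split; [exact: dU | exact: dW].
Qed.

Definition rmean h w r : R := (2 * pi)^-1 * seg_integral (fun t => h (circ w r t)) 0 (2 * pi).

Lemma circ_cont w r t : ccont (fun p => circ w (Re p) (Im p)) (r +i* t)%C.
Proof.
apply: ccontD; first exact: ccont_cst.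
by apply: ccontM; [exact: ccont_Re | exact: ccont_expi].
Qed.

Lemma circ_seg_continuous h w r a b : (forall t, rcont h (circ w r t)) ->
  seg_continuous (fun t => h (circ w r t)) a b.
Proof.
move=> ch t _; apply: (rcont_vert (U := fun p => h (circ w (Re p) (Im p))) (x := r)).
apply: (@ccont_comp _ (fun p => circ w (Re p) (Im p)) (fun z => (h z)%:C%C)).
  exact: circ_cont.
exact: ch.
Qed.

(** The flux through the rectangle [[r, s] x [0, 2 pi]] vanishes, and its two
    horizontal sides cancel because angle [0] and angle [2 pi] give the same
    point.  What is left is the difference of the two means. *)
Lemma mean_Re_indep G w r s R0 : 0 < r -> r <= s -> s < R0 ->
  (forall z, cball w R0 z -> cdiff G z) ->
  rmean (fun z => Re (G z)) w r = rmean (fun z => Re (G z)) w s.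
Proof.
move=> r0 rs sR dG; rewrite /rmean; congr (_ * _).
pose U p := Re (G (circ w (Re p) (Im p))).
pose V p := Im (G (circ w (Re p) (Im p))) * (Re p)^-1.
have pi2 : 0 <= 2 * pi :> R by rewrite mulr_ge0 // ltW // pi_gt0.
have rs0 : 0 <= s - r by rewrite subr_ge0.
have := @flux0 R U V r 0 (s - r) (2 * pi) rs0 pi2.
rewrite /flux !add0r [r + _]addrC subrK => H.
have VE x : V (x +i* (2 * pi))%C = V (x +i* 0)%C.
  by rewrite /V /circ /expi /= mulr_natl cos2pi sin2pi cos0 sin0.
rewrite (eq_seg_integral (f := fun x => V (x +i* (2 * pi))%C) (g := fun x => V (x +i* 0)%C)) in H; last by move=> x _; exact: VE.
apply/esym/eqP; rewrite -subr_eq0; apply/eqP.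
rewrite -[RHS]H; first by rewrite subrK.
move=> z [/andP[/= zr zs] _]; rewrite [r + _]addrC subrK in zs.
have z0 : 0 < Re z by apply: lt_le_trans zr.
apply: polar_balanced; first by rewrite gt_eqF.
apply: dG; rewrite /cball /= circ_dist ?(ltW z0) //.
exact: le_lt_trans sR.
Qed.

Lemma pi2_gt0 : 0 < 2 * pi :> R.
Proof. by rewrite mulr_gt0 // pi_gt0. Qed.

Lemma rmean_near_cst h w r c e : (forall t, rcont h (circ w r t)) ->
  (forall t, `|h (circ w r t) - c| <= e) -> `|rmean h w r - c| <= e.
Proof.
move=> ch hc; have := pi2_gt0 => p0.
have := @seg_integral_near_cst R (fun t => h (circ w r t)) c e 0 (2 * pi) (ltW p0) (circ_seg_continuous ch) (fun t _ => hc t).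
rewrite subr0 => H; rewrite -(ler_pM2r p0); apply: le_trans H.
rewrite -[leLHS](_ : `|(rmean h w r - c) * (2 * pi)| = _); last by rewrite normrM (gtr0_norm p0).
by rewrite mulrBl /rmean mulrAC mulVf ?mul1r // gt_eqF.
Qed.

(** The mean does not depend on the radius, and tends to the value at the
    centre when the radius tends to zero. *)
Lemma mean_Re G w r R0 : 0 < r -> r < R0 -> (forall z, cball w R0 z -> cdiff G z) ->
  rmean (fun z => Re (G z)) w r = Re (G w).
Proof.
move=> r0 rR dG; apply/eqP; rewrite -subr_eq0 -normr_le0.
apply/ler_addgt0Pl => e e0; rewrite addr0.
have dGw : cdiff G w by apply: dG; apply: cball_center; exact: lt_trans rR.
have /rcontP /(_ _ e0) [d d0 Gd] := rcont_Re (cdiff_ccont dGw).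
pose s := Num.min r (d / 2).
have s0 : 0 < s by rewrite lt_min r0 divr_gt0.
have sr : s <= r by rewrite ge_min lexx.
have sd : s < d by rewrite gt_min; apply/orP; right; lra.
rewrite -(mean_Re_indep s0 sr rR dG); apply: rmean_near_cst => t.
  apply: rcont_Re; apply: cdiff_ccont; apply: dG.
  by rewrite /cball /= circ_dist ?(ltW s0) // (le_lt_trans sr).
by apply: ltW; apply: Gd; rewrite circ_dist // ltW.
Qed.
End MeanValue.

(** * Circle means, subharmonic functions and the maximum principle *)

Section MonotoneIntegral.
Local Open Scope ereal_scope.
Context d (T : measurableType d) (R : realType) (mu : {measure set T -> \bar R}).
Implicit Types (f g : T -> \bar R) (D : set T).

(** The integral of a nonnegative function is a supremum over the simple
    functions below it, so it is monotone even where measurability is unknown. *)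
Lemma ge0_integral_mono D f g : (forall x, D x -> 0 <= f x) ->
  (forall x, D x -> f x <= g x) -> \int[mu]_(x in D) f x <= \int[mu]_(x in D) g x.
Proof.
move=> f0 fg; have g0 x : D x -> 0 <= g x by move=> Dx; exact: le_trans (f0 _ Dx) (fg _ Dx).
rewrite !ge0_integralE //; apply: le_ereal_sup => _ /= [h hf <-].
exists h => // x; apply: le_trans (hf x) _; rewrite /patch; case: ifPn => //.
by rewrite inE; exact: fg.
Qed.

Lemma integral_mono D f g : (forall x, D x -> f x <= g x) ->
  \int[mu]_(x in D) f x <= \int[mu]_(x in D) g x.
Proof.
move=> fg; have fgD : {in D, forall x, f x <= g x} by move=> x; rewrite inE; exact: fg.
rewrite (integralE _ _ f) (integralE _ _ g); apply: leeB.
  apply: ge0_integral_mono => x Dx; first exact: funepos_ge0.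
  by apply: (funepos_le fgD); rewrite inE.
apply: ge0_integral_mono => x Dx; first exact: funeneg_ge0.
by apply: (funeneg_le fgD); rewrite inE.
Qed.
End MonotoneIntegral.

Section CircleMeans.
Variable R : realType.
Local Notation C := R[i].
Local Notation mu := (@lebesgue_measure R).
Implicit Types (z w : C) (h k : C -> R) (u v : C -> \bar R) (U : set C).

Lemma circle_meanE u w r : circle_mean u w r =
  (((2 * pi)^-1)%:E * \int[mu]_(t in `[0%R, (2 * pi)%R]) u (circ w r t))%E.
Proof. by []. Qed.

Lemma pi2V_ge0 : 0 <= (2 * pi)^-1 :> R.
Proof. by rewrite invr_ge0 ltW // pi2_gt0. Qed.

Lemma circle_mean_mono u v w r : (forall t, (u (circ w r t) <= v (circ w r t))%E) ->
  (circle_mean u w r <= circle_mean v w r)%E.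
Proof.
move=> uv; rewrite !circle_meanE; apply: lee_wpmul2l; first by rewrite lee_fin pi2V_ge0.
by apply: integral_mono => t _.
Qed.

Lemma circle_mean_EFin h w r : (forall t, rcont h (circ w r t)) ->
  circle_mean (fun z => (h z)%:E) w r = (rmean h w r)%:E.
Proof.
move=> ch; rewrite circle_meanE /rmean EFinM; congr (_ * _)%E.
rewrite /seg_integral /Rintegral fineK //; apply: integrable_fin_num => //.
exact: (seg_continuous_integrable (circ_seg_continuous (a := 0) (b := 2 * pi) ch)).
Qed.

Lemma circle_mean_le u h w r : (forall t, rcont h (circ w r t)) ->
  (forall t, (u (circ w r t) <= (h (circ w r t))%:E)%E) ->
  (circle_mean u w r <= (rmean h w r)%:E)%E.
Proof. by move=> ch uh; rewrite -circle_mean_EFin //; exact: circle_mean_mono. Qed.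

Lemma rmean_cst c w r : rmean (fun=> c) w r = c.
Proof.
apply/eqP; rewrite -subr_eq0 -normr_le0; apply: rmean_near_cst => t; first exact: rcont_cst.
by rewrite subrr normr0.
Qed.

Lemma rmeanD h k w r : (forall t, rcont h (circ w r t)) -> (forall t, rcont k (circ w r t)) ->
  rmean (fun z => h z + k z) w r = rmean h w r + rmean k w r.
Proof. by move=> ch ck; rewrite /rmean seg_integralD; [rewrite mulrDr|exact: circ_seg_continuous..]. Qed.

Lemma rmeanZ c h w r : (forall t, rcont h (circ w r t)) ->
  rmean (fun z => c * h z) w r = c * rmean h w r.
Proof. by move=> ch; rewrite /rmean seg_integralZ; [rewrite mulrCA|exact: circ_seg_continuous]. Qed.

Lemma rmean_le h k w r : (forall t, rcont h (circ w r t)) -> (forall t, rcont k (circ w r t)) ->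
  (forall t, h (circ w r t) <= k (circ w r t)) -> rmean h w r <= rmean k w r.
Proof.
move=> ch ck hk; rewrite /rmean ler_wpM2l ?pi2V_ge0 //.
by apply: seg_integral_le => //; exact: circ_seg_continuous.
Qed.

Lemma eq_rmean h k w r : (forall t, h (circ w r t) = k (circ w r t)) -> rmean h w r = rmean k w r.
Proof. by move=> hk; rewrite /rmean; congr (_ * _); apply: eq_seg_integral => t _. Qed.

Definition strict_supermean h w :=
  exists2 rho : R, 0 < rho & forall r, 0 < r < rho -> rmean h w r < h w.

Lemma openCP U : open U <-> forall z, U z -> exists2 e : R, 0 < e & cball z e `<=` U.
Proof.
rewrite openE; split=> H z Uz; first by have /nbhsCP := H z Uz.
by apply/nbhsCP; exact: H.
Qed.

Lemma open_cball z (e : R) : open (cball z e).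
Proof.
apply/openCP => w zw; exists (e - cabs (w - z)); first by rewrite subr_gt0.
by move=> y; rewrite /cball /=; have := cabs_tri y w z; lra.
Qed.

Lemma closedCP U : closed U <-> forall z, ~ U z -> exists2 e : R, 0 < e & forall w, cball z e w -> ~ U w.
Proof.
split=> [/closed_openC /openCP H z /H [e e0 eU]|H]; first by exists e.
rewrite -openC; apply/openCP => z /H [e e0 eU]; by exists e.
Qed.

Lemma closureCP U z : closure U z <-> forall e : R, 0 < e -> exists2 w, U w & cabs (w - z) < e.
Proof.
split=> [cU e e0|H B /nbhsCP [e e0 eB]].
  have [|w [Uw zw]] := cU (cball z e); first by apply/nbhsCP; exists e.
  by exists w.
by have [w Uw wz] := H e e0; exists w; split => //; exact: eB.
Qed.

Lemma compact_cdisk (M : R) : compact [set w : C | cabs w <= M].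
Proof.
pose f (p : R * R) : C := (p.1 +i* p.2)%C.
have cf : continuous f.
  move=> [a b] A /nbhsCP [e e0 eA]; apply/nbhs_ballP; exists (e / 2); first by rewrite /= divr_gt0.
  move=> [x y] [/= xa yb]; apply: eA; apply: le_lt_trans (cabs_le_ReIm _) _ => /=.
  by move: xa yb; rewrite /ball /= distrC [`|b - y|]distrC; lra.
have cI : compact (f @` (`[- M, M] `*` `[- M, M])).
  apply: continuous_compact; first exact: continuous_subspaceT.
  by apply: compact_setX; exact: segment_compact.
apply: subclosed_compact cI _.
  apply/closedCP => z /negP; rewrite -ltNge => Mz; exists (cabs z - M); first by rewrite subr_gt0.
  by move=> w; rewrite /cball /= cabsB; have := cabs_sub_ge z w; lra.
move=> z /= zM; exists (Re z, Im z); last by rewrite /f /=; case: (z).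
by split => /=; rewrite in_itv /= -ler_norml; apply: le_trans zM; [exact: Re_le_cabs|exact: Im_le_cabs].
Qed.

Lemma limf_esup_leP v U z (c : R) :
  (limf_esup v (within U (nbhs z)) <= c%:E)%E <->
  forall e : R, 0 < e -> exists2 d : R, 0 < d &
    forall w, U w -> cabs (w - z) < d -> (v w <= (c + e)%:E)%E.
Proof.
split=> [H e e0|H].
  have : (limf_esup v (within U (nbhs z)) < (c + e)%:E)%E.
    by apply: le_lt_trans H _; rewrite lte_fin ltrDl.
  move=> /ereal_inf_lt [_ [V /nbhsCP [d d0 dV] <-]] Vc.
  exists d => // w Uw wz; apply: le_trans (ltW Vc); apply: ereal_sup_ubound.
  by exists w => //; exact: dV.
apply/lee_addgt0Pr => e e0; rewrite -EFinD.
have [d d0 dv] := H e e0.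
apply: (@le_trans _ _ (ereal_sup (v @` (U `&` cball z d)))).
  apply: ereal_inf_lbound; exists (U `&` cball z d) => //.
  by apply/nbhsCP; exists d => // w zw Uw.
by apply/ge_ereal_sup => _ /= [w [Uw zw] <-]; exact: dv.
Qed.

(** If [v - h] were positive somewhere, its supremum would be reached, by
    compactness and semicontinuity, at an interior point [y]; then
    [v y <= mean v <= mean h + max (v - h) < h y + max (v - h) = v y]. *)
Lemma comparison_strict U v h (M : R) : (forall w, U w -> cabs w <= M) ->
  subharmonic_on U v -> (forall w, U w -> rcont h w) ->
  (forall w, U w -> strict_supermean h w) ->
  (forall z, closure U z -> ~ U z -> forall e : R, 0 < e -> exists2 d : R, 0 < d &
     forall w, U w -> cabs (w - z) < d -> (v w <= (h w + e)%:E)%E) ->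
  forall w, U w -> (v w <= (h w)%:E)%E.
Proof.
move=> UM [vfin vusc vsub] ch sh hb w0 Uw0; rewrite leNgt; apply/negP => vh.
pose S (a : R) := exists2 w, U w & ((a + h w)%:E < v w)%E.
have real_v w (b : R) : U w -> (b%:E < v w)%E -> exists2 r : R, v w = r%:E & b < r.
  move=> Uw; have := vfin w Uw; case: (v w) => [r| |] //= _; rewrite lte_fin => br.
  by exists r.
have S_dense w (b : R) : U w -> ((b + h w)%:E < v w)%E -> exists2 a : R, S a & b < a.
  move=> Uw bv; have [r vr br] := real_v w _ Uw bv.
  exists ((b + (r - h w)) / 2); last by lra.
  by exists w => //; rewrite vr lte_fin; lra.
have [a0 Sa0 a00] : exists2 a : R, S a & 0 < a.
  by apply: (S_dense w0) => //; rewrite add0r.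
(* Superlevel sets of [v - h] form a filter base; a cluster point is a point
   where [v - h] reaches its supremum. *)
pose lev (a : R) := [set w : C | U w /\ ((a + h w)%:E < v w)%E].
pose F := filter_from S lev.
have FF : ProperFilter F.
  apply: filter_from_proper; last by move=> a [w Uw wa]; exists w.
  apply: filter_from_filter; first by exists a0.
  move=> a b Sa Sb; exists (Num.max a b); first by case: (leP a b).
  move=> w [Uw wab]; split; split => //; apply: le_lt_trans wab;
  by rewrite lee_fin lerD2r le_max lexx ?orbT.
have [] := @compact_cdisk M F FF.
  by exists a0 => // w [Uw _]; exact: UM.
move=> y [_ Fy].
have clus a (d : R) : S a -> 0 < d -> exists w, [/\ U w, ((a + h w)%:E < v w)%E & cabs (w - y) < d].
  move=> Sa d0; have [] := Fy (lev a) (cball y d).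
  - by exists a.
  - by apply/nbhsCP; exists d.
  by move=> w [[Uw wa] wy]; exists w.
have [Uy|nUy] := pselect (U y); last first.
  have cU : closure U y.
    by apply/closureCP => e e0; have [w [Uw _ wy]] := clus a0 e Sa0 e0; exists w.
  have [d d0 dv] := hb y cU nUy a0 a00.
  have [w [Uw wa wy]] := clus a0 d Sa0 d0.
  by have := lt_le_trans wa (dv w Uw wy); rewrite lte_fin addrC ltxx.
have ymax a : S a -> ((a + h y)%:E <= v y)%E.
  move=> Sa; rewrite leNgt; apply/negP => va.
  have [b vb ba] : exists2 b : R, (v y < b%:E)%E & b < a + h y.
    move: va; have := vfin y Uy; case: (v y) => [r| |] //= _.
      by rewrite lte_fin => ra; exists ((r + (a + h y)) / 2); rewrite ?lte_fin; lra.
    by move=> _; exists (a + h y - 1); rewrite ?ltNyr //; lra.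
  have /nbhsCP [d d0 dv] := vusc y Uy _ vb.
  have e0 : 0 < a + h y - b by lra.
  have /rcontP /(_ _ e0) [d' d'0 dh] := ch y Uy.
  have m0 : 0 < Num.min d d' by rewrite lt_min d0.
  have [w [Uw wa]] := clus a _ Sa m0; rewrite lt_min => /andP[/dv /(_ Uw) wb /dh].
  rewrite ltr_norml => /andP[h1 h2].
  by have := lt_trans wa wb; rewrite lte_fin; lra.
have [r vr ar] : exists2 r : R, v y = r%:E & 0 < r - h y.
  have := ymax _ Sa0; have := vfin y Uy; case: (v y) => [r| |] //= _.
  by rewrite lee_fin => ?; exists r => //; lra.
pose D := r - h y.
have vD w : U w -> (v w <= (h w + D)%:E)%E.
  move=> Uw; rewrite leNgt; apply/negP; rewrite addrC => /(S_dense w _ Uw) [a Sa Da].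
  by have := ymax a Sa; rewrite vr lee_fin /D in Da *; lra.
have [rho rho0 [rhoU vmean]] := vsub y Uy.
have [rho' rho'0 hmean] := sh y Uy.
pose s := Num.min rho rho' / 2.
have m0 : 0 < Num.min rho rho' by rewrite lt_min rho0.
have s0 : 0 < s by rewrite divr_gt0.
have [sr sr'] : s < rho /\ s < rho'.
  have : s < Num.min rho rho' by rewrite /s; lra.
  by rewrite lt_min => /andP[].
have circU t : U (circ y s t) by apply: rhoU => /=; rewrite circ_dist // ltW.
have chs t : rcont h (circ y s t) by apply: ch.
have := vmean s; rewrite (ltW s0) sr => /(_ isT) v1.
have cD (t : R) : rcont (fun=> D) (circ y s t) by exact: rcont_cst.
have := le_trans v1 (circle_mean_le (fun t => rcontD (chs t) (cD t)) (fun t => vD _ (circU t))).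
rewrite vr lee_fin rmeanD // rmean_cst => h1.
by have := hmean s; rewrite s0 sr' => /(_ isT); rewrite /D in h1; lra.
Qed.

Lemma compact_closed_disc w (r : R) : compact [set z : C | cabs (z - w) <= r].
Proof.
apply: (subclosed_compact _ (@compact_cdisk (cabs w + r))).
  apply/closedCP => z /negP; rewrite -ltNge => rz; exists (cabs (z - w) - r); first by rewrite subr_gt0.
  move=> y; rewrite /cball /=; have := cabs_tri z y w; rewrite [cabs (z - y)]cabsB; lra.
by move=> z /= zr; have := cabs_sub_ge z w; lra.
Qed.

Lemma compact_closedC (K : set C) : compact K -> closed K.
Proof.
by move=> cK; apply: compact_closed.
Qed.

Lemma circle_mean0 u w : circle_mean u w 0 = u w.
Proof.
rewrite circle_meanE.
have -> : (\int[mu]_(t in `[0%R, (2 * pi)%R]) u (circ w 0 t))%E =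
          (\int[mu]_(t in `[0%R, (2 * pi)%R]) cst (u w) t)%E.
  by apply: eq_integral => t _; rewrite /circ mul0r addr0.
rewrite integral_cst; last exact: (@measurable_itv R `[0%R, (2 * pi)%R]).
rewrite [X in (_ * (_ * X))%E](_ : _ = (2 * pi)%:E); last first.
  etransitivity; first exact: (@lebesgue_measure_itv R `[0%R, (2 * pi)%R]).
  by rewrite /= lte_fin pi2_gt0 -EFinB subr0.
rewrite [(u w * _)%E]muleC muleA -EFinM mulVf ?mul1e // gt_eqF //; exact: pi2_gt0.
Qed.

Lemma rcont_sqr_cabs z : rcont (fun w => cabs w ^+ 2) z.
Proof.
have := rcont_cabs (ccont_id z) => h.
exact: (rcontM h h).
Qed.

(** The squared modulus is strictly subharmonic: it differs on the circle from
    the real part of a polynomial by the constant [|w|^2 + r^2]. *)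
Lemma rmean_sqr_cabs w r : 0 < r -> rmean (fun z => cabs z ^+ 2) w r = cabs w ^+ 2 + r ^+ 2.
Proof.
move=> r0; pose h z := 2 * Re (conjc w * z + - (conjc w * w)).
have hE t : cabs (circ w r t) ^+ 2 = cabs w ^+ 2 + r ^+ 2 + h (circ w r t).
  have := congr1 (fun v : R => v ^+ 2) (cabs_expi t).
  rewrite /h /circ expr1n !sqr_cabs; case: (w) => a b; case: (expi t) => c d /= cd.
  rewrite !mul0r !subr0 !addr0.
  apply/eqP; rewrite -subr_eq0; apply/eqP.
  transitivity (r ^+ 2 * (c ^+ 2 + d ^+ 2 - 1)); first by ring.
  by rewrite cd subrr mulr0.
have chh z : rcont (fun z => Re (conjc w * z + - (conjc w * w))) z.
  by apply: rcont_Re; apply: cdiff_ccont; exact: cdiff_affine.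
have ch z : rcont h z by apply: rcontM; [exact: rcont_cst|exact: chh].
rewrite (@eq_rmean _ (fun z => (cabs w ^+ 2 + r ^+ 2) + h z)) //.
rewrite rmeanD; [|by move=> t; exact: rcont_cst|by move=> t; exact: ch].
rewrite rmean_cst rmeanZ; last by move=> t; exact: chh.
rewrite (mean_Re (R0 := r + 1)) //; [|by rewrite ltrDl|by move=> z _; exact: cdiff_affine].
by rewrite subrr mulr0 addr0.
Qed.

Definition supermean h w :=
  exists2 rho : R, 0 < rho & forall r, 0 < r < rho -> rmean h w r <= h w.

(** Adding [del (M^2 - |z|^2)] makes the supermean inequality strict without
    spoiling the boundary condition. *)
Lemma comparison_principle U v h (M : R) : open U -> (forall w, U w -> cabs w <= M) ->
  subharmonic_on U v -> (forall w, U w -> rcont h w) ->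
  (forall w, U w -> supermean h w) ->
  (forall z, closure U z -> ~ U z -> forall e : R, 0 < e -> exists2 d : R, 0 < d &
     forall w, U w -> cabs (w - z) < d -> (v w <= (h w + e)%:E)%E) ->
  forall w, U w -> (v w <= (h w)%:E)%E.
Proof.
move=> oU UM sv ch sh hb w Uw; apply/lee_addgt0Pr => e e0; rewrite -EFinD.
have M21 : 0 < M ^+ 2 + 1 by rewrite ltr_wpDl // sqr_ge0.
pose del := e / (M ^+ 2 + 1); have del0 : 0 < del by rewrite divr_gt0.
have delM : del * M ^+ 2 <= e.
  by rewrite /del mulrAC ler_pdivrMr // ler_wpM2l ?(ltW e0) // lerDl.
pose k z := h z + (del * M ^+ 2 + - del * cabs z ^+ 2).
have hk z : U z -> h z <= k z.
  move=> Uz; rewrite /k; have : cabs z ^+ 2 <= M ^+ 2.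
    by rewrite ler_sqr ?nnegrE ?cabs_ge0 ?(le_trans (cabs_ge0 _) (UM _ Uz)) // UM.
  by nra.
have cq z : rcont (fun z => del * M ^+ 2 + - del * cabs z ^+ 2) z.
  apply: rcontD; first exact: rcont_cst.
  by apply: rcontM; [exact: rcont_cst|exact: rcont_sqr_cabs].
have : (v w <= (k w)%:E)%E.
  apply: (comparison_strict UM sv) Uw => //.
  - by move=> z Uz; apply: rcontD; [exact: ch|exact: cq].
  - move=> z Uz; have [rho rho0 hm] := sh z Uz; have [d d0 dU] := (openCP _).1 oU z Uz.
    exists (Num.min rho d); first by rewrite lt_min rho0.
    move=> r /andP[r0]; rewrite lt_min => /andP[r1 r2].
    have ci t : U (circ z r t) by apply: dU; rewrite /cball /= circ_dist // ltW.
    have c3 t : rcont (fun y => cabs y ^+ 2) (circ z r t) by exact: rcont_sqr_cabs.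
    have c4 t : rcont (fun y => - del * cabs y ^+ 2) (circ z r t).
      by apply: rcontM; [exact: rcont_cst|exact: c3].
    have c5 t : rcont (fun=> del * M ^+ 2) (circ z r t) by exact: rcont_cst.
    have c1 t : rcont h (circ z r t) by exact: ch (ci t).
    rewrite /k (rmeanD c1 (fun t => rcontD (c5 t) (c4 t))) (rmeanD c5 c4) (rmeanZ _ c3).
    rewrite rmean_cst rmean_sqr_cabs //.
    have := hm r; rewrite r0 r1 => /(_ isT).
    by have := mulr_gt0 del0 (exprn_gt0 2 r0); lra.
  move=> z cUz nUz a a0; have [d d0 dv] := hb z cUz nUz a a0.
  exists d => // y Uy yz; apply: le_trans (dv y Uy yz) _.
  by rewrite lee_fin lerD2r hk.
move=> /le_trans; apply; rewrite lee_fin /k.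
by have := mulr_ge0 (ltW del0) (sqr_ge0 (cabs w)); lra.
Qed.

Lemma supermean_cst (c : R) w : supermean (fun=> c) w.
Proof. by exists 1 => // r _; rewrite rmean_cst. Qed.

Lemma supermean_Re U G w : open U -> (forall z, U z -> cdiff G z) -> U w ->
  supermean (fun z => Re (G z)) w.
Proof.
move=> oU dG Uw; have [d d0 dU] := (openCP _).1 oU w Uw.
exists d => // r /andP[r0 rd]; rewrite (mean_Re r0 rd) // => z /dU; exact: dG.
Qed.

(** At a point where [G] does not vanish, rotate [G] so that its value is
    positive and apply the mean value property to the real part. *)
Lemma subharmonic_cabs U G : open U -> (forall z, U z -> cdiff G z) ->
  subharmonic_on U (fun z => (cabs (G z))%:E).
Proof.
move=> oU dG; have cG z : U z -> rcont (fun z => cabs (G z)) z.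
  by move=> Uz; apply: rcont_cabs; exact: cdiff_ccont (dG _ Uz).
split; first by move=> z _; rewrite ltry.
  move=> z Uz a; have /rcontP H := cG z Uz.
  case: a => [a| |] //; last first.
    by move=> _; apply/nbhsCP; exists 1 => // w _ _; rewrite ltry.
  rewrite lte_fin => Ga; have [|d d0 dH] := H (a - cabs (G z)); first by rewrite subr_gt0.
  apply/nbhsCP; exists d => // w zw _; rewrite lte_fin.
  by have := dH w zw; rewrite ltr_norml => /andP[_]; lra.
move=> w Uw; have [d d0 dU] := (openCP _).1 oU w Uw.
exists d => //; split => // r /andP[r0 rd].
move: r0; rewrite le_eqVlt => /predU1P[<-|r0]; first by rewrite circle_mean0.
have ci t : U (circ w r t) by apply: dU; rewrite /cball /= circ_dist // ltW.
have c1 t : rcont (fun z => cabs (G z)) (circ w r t) by exact: cG.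
rewrite (circle_mean_EFin c1) lee_fin.
have [G0|G0] := eqVneq (G w) 0.
  rewrite G0 cabs0 -[leLHS](rmean_cst 0 w r); apply: rmean_le => //; last by move=> t; exact: cabs_ge0.
  by move=> t; exact: rcont_cst.
pose k := conjc (G w) / (cabs (G w))%:C%C.
have Gw0 : 0 < cabs (G w) by rewrite cabs_gt0.
have k1 : cabs k = 1 by rewrite /k cabsM cabsV cabsJ cabs_real gtr0_norm // mulfV // gt_eqF.
have kG : k * G w = (cabs (G w))%:C%C.
  rewrite /k mulrAC [conjc _ * _]mulrC -sqr_normc -cabsE expr2 mulfK //.
  by rewrite -cabs_gt0 cabs_real gtr0_norm.
have dk z : cball w d z -> cdiff (fun z => k * G z) z.
  by move=> /dU Uz; apply: cdiffM; [exact: cdiff_cst|exact: dG].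
have -> : cabs (G w) = Re (k * G w) by rewrite kG.
rewrite -(mean_Re r0 rd dk); apply: rmean_le => //.
  by move=> t; apply: rcont_Re; apply: cdiff_ccont; apply: dk; rewrite /cball /= circ_dist // ltW.
move=> t; apply: le_trans (ler_norm _) _; apply: le_trans (Re_le_cabs _) _.
by rewrite cabsM k1 mul1r.
Qed.

Lemma subharmonic_subset U V v : open V -> V `<=` U -> subharmonic_on U v -> subharmonic_on V v.
Proof.
move=> oV VU [vfin vusc vsub]; split.
- by move=> z /VU; exact: vfin.
- move=> z Vz a va; have := vusc z (VU _ Vz) a va.
  by apply: filterS => y H /VU.
move=> y Vy; have [rh rh0 [rhU H]] := vsub y (VU _ Vy).
have [e1 e10 yV] := (openCP _).1 oV y Vy.
exists (Num.min rh e1); first by rewrite lt_min rh0.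
split; first by move=> z; rewrite /= lt_min => /andP[_ h]; exact: yV.
by move=> s; rewrite lt_min => /andP[s0 /andP[s1 _]]; apply: H; rewrite s0.
Qed.

End CircleMeans.

(** * Approximation on the circle by finite Poisson sums *)

Section PoissonSums.
Variable R : realType.
Local Notation C := R[i].
Local Notation sqrtc := (@complex.sqrtc R).
Implicit Types (z w a x : C) (s : seq C).

Lemma cabs_lt1_sub_neq0 z : cabs z < 1 -> 1 - z != 0.
Proof. by move=> z1; rewrite subr_eq0; apply: contraTneq z1 => <-; rewrite cabs1 ltxx. Qed.

(** The nodes are the roots of unity of order [2 ^ k], obtained by repeated
    square roots from [1 / (1 - y) + 1 / (1 + y) = 2 / (1 - y^2)]. *)
Lemma circle_nodes k : exists s : seq C,
  [/\ size s = (2 ^ k)%N, forall a, a \in s -> cabs a = 1 &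
      forall x, cabs x < 1 ->
        \sum_(a <- s) (1 - x * a)^-1 = (2 ^ k)%:R / (1 - x ^+ (2 ^ k))].
Proof.
elim: k => [|k [s [ss s1 sE]]].
  exists [:: 1]; split=> // [a|x x1]; first by rewrite inE => /eqP ->; rewrite cabs1.
  by rewrite big_seq1 mulr1 expn0 expr1 mul1r.
exists (map sqrtc s ++ map (fun a => - sqrtc a) s).
have sq a : a \in s -> cabs (sqrtc a) = 1.
  move=> /s1 a1; apply/eqP; rewrite -(eqrXn2 (n := 2)) ?cabs_ge0 //.
  by rewrite -cabsX complex.sqr_sqrtc a1 expr1n.
split.
- by rewrite size_cat !size_map ss expnS mul2n addnn.
- move=> a; rewrite mem_cat => /orP[] /mapP[b bs ->]; rewrite ?cabsN; exact: sq.
move=> x x1; rewrite big_cat !big_map /= -big_split /=.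
have x21 : cabs (x ^+ 2) < 1 by rewrite cabsX exprn_ilt1 // cabs_ge0.
rewrite (eq_big_seq (fun a => 2 * (1 - x ^+ 2 * a)^-1)) => [|a aas].
  rewrite -big_distrr /= sE // mulrA expnS exprM natrM //.
have h1 : 1 - x * sqrtc a != 0.
  by apply: cabs_lt1_sub_neq0; rewrite cabsM sq // mulr1.
have h2 : 1 - x * - sqrtc a != 0.
  by apply: cabs_lt1_sub_neq0; rewrite cabsM cabsN sq // mulr1.
have -> : 1 - x ^+ 2 * a = (1 - x * sqrtc a) * (1 - x * - sqrtc a).
  by rewrite -[in LHS](complex.sqr_sqrtc a); ring.
by field; rewrite h1 h2.
Qed.

Lemma Re_sum (I : Type) (s : seq I) (F : I -> C) :
  Re (\sum_(i <- s) F i) = \sum_(i <- s) Re (F i).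
Proof. by apply: (big_morph (fun z => Re z)) => // z w; rewrite ReD. Qed.

Lemma cdiff_sum (I : Type) (s : seq I) (F : I -> C -> C) z :
  (forall i, cdiff (F i) z) -> cdiff (fun w => \sum_(i <- s) F i w) z.
Proof.
move=> dF; elim: s => [|i s IH].
  by rewrite (_ : (fun _ => _) = fun=> 0); [exact: cdiff_cst|apply/funext => w; rewrite big_nil].
rewrite (_ : (fun _ => _) = fun w => F i w + \sum_(j <- s) F j w); first exact: cdiffD.
by apply/funext => w; rewrite big_cons.
Qed.

Definition poisson (r : R) (y : C) : C := (1 + r%:C%C * y) / (1 - r%:C%C * y).

Lemma sqr_cabs_unit_sub (r : R) y : cabs y = 1 ->
  cabs (1 - r%:C%C * y) ^+ 2 = (1 - r) ^+ 2 + r * cabs (1 - y) ^+ 2.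
Proof.
move=> /(congr1 (fun v : R => v ^+ 2)); rewrite expr1n !sqr_cabs.
case: y => a b /= => ab; rewrite !mul0r !subr0 !addr0 !sub0r !sqrrN.
have -> : (1 - r * a) ^+ 2 + (r * b) ^+ 2 = 1 - 2 * r * a + r ^+ 2 * (a ^+ 2 + b ^+ 2) by ring.
have -> : (1 - a) ^+ 2 + b ^+ 2 = 1 - 2 * a + (a ^+ 2 + b ^+ 2) by ring.
by rewrite ab; ring.
Qed.

Lemma Re_poisson (r : R) y : cabs y = 1 -> 0 < r < 1 ->
  Re (poisson r y) = (1 - r ^+ 2) / cabs (1 - r%:C%C * y) ^+ 2.
Proof.
move=> y1 /andP[r0 r1].
rewrite /poisson ReM ReV.
have -> : Im (1 - r%:C%C * y)^-1 = - Im (1 - r%:C%C * y) / cabs (1 - r%:C%C * y) ^+ 2.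
  by rewrite sqr_cabs; case: (1 - _) => a b /=; rewrite mulNr.
rewrite mulrA mulrA -mulrBl; congr (_ / _).
move: y1 => /(congr1 (fun v : R => v ^+ 2)); rewrite expr1n !sqr_cabs.
case: y => a b /= => ab; rewrite !mul0r !subr0 !add0r.
have -> : 1 - r ^+ 2 = 1 - r ^+ 2 * (a ^+ 2 + b ^+ 2) by rewrite ab mulr1.
by ring.
Qed.

Lemma poisson_ge0 (r : R) y : cabs y = 1 -> 0 < r < 1 -> 0 <= Re (poisson r y).
Proof.
move=> y1 r01; rewrite Re_poisson //; case/andP: r01 => r0 r1.
by rewrite divr_ge0 ?sqr_ge0 // subr_ge0 exprn_ile1 // ltW.
Qed.

(** The Poisson kernel has a small second moment around its pole, because
    [|1 - r y|^2 >= r |1 - y|^2] on the unit circle. *)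
Lemma poisson_concentrated (r : R) y : cabs y = 1 -> 0 < r < 1 ->
  cabs (1 - y) ^+ 2 * Re (poisson r y) <= (1 - r ^+ 2) / r.
Proof.
move=> y1 r01; rewrite Re_poisson //; case/andP: r01 => r0 r1.
have n0 : 0 < cabs (1 - r%:C%C * y) ^+ 2.
  by rewrite exprn_gt0 // cabs_gt0 cabs_lt1_sub_neq0 // cabsM y1 mulr1 cabs_real ger0_norm // ltW.
rewrite mulrCA; apply: ler_wpM2l; first by rewrite subr_ge0 exprn_ile1 // ltW.
rewrite ler_pdivrMr // ler_pdivlMl // sqr_cabs_unit_sub //.
by rewrite lerDr sqr_ge0.
Qed.

Lemma poissonE (r : R) y : r%:C%C * y != 1 -> poisson r y = 2 * (1 - r%:C%C * y)^-1 - 1.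
Proof. by move=> ry; rewrite /poisson; field; rewrite subr_eq0 eq_sym. Qed.

Lemma pow2_small (r e : R) : 0 < r < 1 -> 0 < e -> exists k, r ^+ (2 ^ k) < e.
Proof.
move=> /andP[r0 r1] e0.
have r1' : `|r| < 1 by rewrite ger0_norm // ltW.
have /cvgrPdist_lt /(_ _ e0) [k _ ke] := cvg_expr r1'.
exists k; have := ke k (leqnn k); rewrite sub0r normrN ger0_norm ?exprn_ge0 ?(ltW r0) //.
by apply: le_lt_trans; apply: ler_wiXn2l; rewrite ?(ltW r0) ?(ltW r1) // ltnW // ltn_expl.
Qed.

(** A Riemann sum of the Poisson integral of [X] at radius [r].  Its kernel has
    total mass close to one when the number of nodes is large, and small second
    moment when [r] is close to one, which suffices against a Lipschitz function. *)
Lemma Lipschitz_approx (X : C -> R) (L : R) (e : R) : 0 <= L ->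
  (forall z w, `|X z - X w| <= L * cabs (z - w)) -> 0 < e ->
  exists2 Q : C -> C, exists2 rho : R, 1 < rho & (forall z, cabs z < rho -> cdiff Q z) &
    forall z, cabs z = 1 -> `|Re (Q z) - X z| <= e.
Proof.
move=> L0 XL e0.
pose eta := e / 8; have eta0 : 0 < eta by rewrite divr_gt0.
pose del := Num.min (1 / 2) (e * eta / (16 * (L ^+ 2 + 1))).
have L21 : 0 < L ^+ 2 + 1 by rewrite ltr_wpDl // sqr_ge0.
have del0 : 0 < del by rewrite lt_min !divr_gt0 // mulr_gt0.
have del2 : del <= 1 / 2 by rewrite ge_min lexx.
have delL : L ^+ 2 / eta * (4 * del) <= e / 4.
  have : del * (16 * (L ^+ 2 + 1)) <= e * eta.
    by rewrite -ler_pdivlMr ?mulr_gt0 // ge_min lexx orbT.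
  rewrite mulrAC ler_pdivrMr // => H.
  have := mulr_ge0 (sqr_ge0 L) (ltW del0); nra.
pose r := 1 - del; have r01 : 0 < r < 1 by rewrite /r; apply/andP; split; lra.
have [r0 r1] := andP r01.
pose B : R := `|X 0| + L.
have B0 : 0 <= B by rewrite addr_ge0.
have XB z : cabs z = 1 -> `|X z| <= B.
  move=> z1; rewrite /B -(subrK (X 0) (X z)) addrC; apply: le_trans (ler_normD _ _) _.
  by rewrite lerD2l; apply: le_trans (XL _ _) _; rewrite subr0 z1 mulr1.
have q0 : 0 < Num.min (1 / 4) (e / (8 * (B + 1))).
  by rewrite lt_min !divr_gt0 // mulr_gt0 // ltr_wpDl.
have [k] := pow2_small r01 q0; set N := (2 ^ k)%N.
rewrite lt_min => /andP[rN1 rN2].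
have [s [ss s1 sE]] := circle_nodes k; rewrite -/N in ss sE.
have N0 : 0 < N%:R :> R by rewrite ltr0n expn_gt0.
have NC0 : N%:R != 0 :> C by rewrite pnatr_eq0 -lt0n expn_gt0.
(* The node [a] carries the pole at the conjugate of [a].  The test on [cabs a]
   makes every summand differentiable, whether or not [a] is a node. *)
pose Q z : C := \sum_(a <- s) (if cabs a == 1 then (N%:R^-1 * X (conjc a))%:C%C * poisson r (z * a) else 0).
have QE z : Q z = \sum_(a <- s) (N%:R^-1 * X (conjc a))%:C%C * poisson r (z * a).
  by apply: eq_big_seq => a /s1 ->; rewrite eqxx.
exists Q.
  exists r^-1; first by rewrite invf_gt1.
  move=> z zr; apply: cdiff_sum => a; case: eqP => [a1|_]; last exact: cdiff_cst.
  apply: cdiffM; first exact: cdiff_cst.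
  have d1 : cdiff (fun w => r%:C%C * (w * a)) z.
    apply: cdiffM; first exact: cdiff_cst.
    by apply: cdiffM; [exact: cdiff_id|exact: cdiff_cst].
  apply: cdiffM; first by apply: cdiffD => //; exact: cdiff_cst.
  apply: cdiffV; last by apply: cdiffB => //; exact: cdiff_cst.
  apply: cabs_lt1_sub_neq0; rewrite !cabsM a1 mulr1 cabs_real ger0_norm ?(ltW r0) //.
  by rewrite mulrC -ltr_pdivlMr // div1r.
move=> z z1.
pose K a := Re (poisson r (z * a)).
have za1 a : a \in s -> cabs (z * a) = 1 by move=> /s1 a1; rewrite cabsM z1 a1 mulr1.
have K0 a : a \in s -> 0 <= K a by move=> /za1 ?; exact: poisson_ge0.
have ReQ : Re (Q z) = \sum_(a <- s) N%:R^-1 * X (conjc a) * K a.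
  by rewrite QE Re_sum; apply: eq_bigr => a _; rewrite ReM /= mul0r subr0.
pose x := (r%:C%C * z) ^+ N.
have rz1 : cabs (r%:C%C * z) < 1 by rewrite cabsM z1 mulr1 cabs_real ger0_norm // ltW.
have xr : cabs x = r ^+ N by rewrite cabsX cabsM z1 mulr1 cabs_real ger0_norm // ltW.
pose S := \sum_(a <- s) N%:R^-1 * K a.
have S1 : `|S - 1| <= 4 * r ^+ N.
  have -> : S - 1 = Re (2 * x / (1 - x)) :> R.
    have x1 : 1 - x != 0 by apply: cabs_lt1_sub_neq0; rewrite xr; lra.
    have nE : \sum_(a <- s) (1 : C) = N%:R by rewrite big_const_seq count_predT iter_addr_0 ss.
    have -> : 2 * x / (1 - x) =
        \sum_(a <- s) N%:R^-1 * (2 * (1 - r%:C%C * z * a)^-1 - 1) - 1.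
      by rewrite -big_distrr /= sumrB -big_distrr /= sE // nE -/x; field; rewrite NC0 x1.
    rewrite ReD ReN /= Re_sum.
    congr (_ - _); apply: eq_big_seq => a aas.
    have h : r%:C%C * (z * a) != 1.
      by rewrite mulrA eq_sym -subr_eq0 cabs_lt1_sub_neq0 // cabsM (s1 _ aas) mulr1.
    have NCE : (N%:R : C)^-1 = (N%:R^-1)%:C%C by rewrite fmorphV rmorph_nat.
    by rewrite /K poissonE // !mulrA NCE ReM /= mul0r subr0.
  have H := Re_le_cabs (2 * x / (1 - x)); apply: (le_trans H); rewrite cabsM cabsV cabsM xr.
  have h : 1 / 2 <= cabs (1 - x) by have := cabs_sub_ge 1 x; rewrite cabs1 xr; lra.
  have h0 : 0 < cabs (1 - x) by lra.
  rewrite ler_pdivrMr // -[2](rmorph_nat (real_complex R)) cabs_real ger0_norm //.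
  have := exprn_ge0 N (ltW r0); nra.
have S2 : S <= 2 by move: S1; rewrite ler_norml => /andP[? ?]; lra.
have split1 : Re (Q z) - X z = \sum_(a <- s) N%:R^-1 * (X (conjc a) - X z) * K a + X z * (S - 1).
  rewrite ReQ /S mulrBr mulr1 big_distrr /= addrA -big_split /=; congr (_ - _).
  by apply: eq_bigr => a _; ring.
rewrite split1; apply: le_trans (ler_normD _ _) _.
have T2 : `|X z * (S - 1)| <= e / 2.
  have H := ler_pM (normr_ge0 _) (normr_ge0 _) (XB _ z1) S1.
  rewrite normrM; apply: (le_trans H).
  move: rN2; rewrite ltr_pdivlMr ?mulr_gt0 ?ltr_wpDl // => h.
  have := mulr_ge0 B0 (exprn_ge0 N (ltW r0)); have := exprn_ge0 N (ltW r0); nra.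
have T1 : `|\sum_(a <- s) N%:R^-1 * (X (conjc a) - X z) * K a| <= e / 2.
  have H := ler_norm_sum s (fun a => N%:R^-1 * (X (conjc a) - X z) * K a) xpredT. apply: (le_trans H).
  apply: (@le_trans _ _ (\sum_(a <- s) (eta * (N%:R^-1 * K a) + N%:R^-1 * (e / 4)))).
    rewrite big_seq [leRHS]big_seq; apply: ler_sum => a aas.
    rewrite !normrM (ger0_norm (K0 _ aas)) ger0_norm ?invr_ge0 ?ler0n //.
    rewrite mulrCA -mulrA -mulrDr ler_wpM2l ?invr_ge0 ?ler0n //.
    pose t := cabs (1 - z * a).
    have Xt : `|X (conjc a) - X z| <= L * t.
      apply: (le_trans (XL (conjc a) z)); rewrite ler_wpM2l // /t.
      have -> : 1 - z * a = (conjc a - z) * a.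
        rewrite mulrBl; congr (_ - _); rewrite mulrC -sqr_normc -cabsE (s1 _ aas).
        by rewrite expr1n.
      by rewrite cabsM (s1 _ aas) mulr1.
    (* The weight [L t] is traded for its square, which the kernel controls. *)
    have Lt : L * t <= eta + L ^+ 2 / eta * t ^+ 2.
      rewrite -subr_ge0.
      have -> : eta + L ^+ 2 / eta * t ^+ 2 - L * t = eta * ((1 - L * t / eta / 2) ^+ 2 + 3 / 4 * (L * t / eta) ^+ 2).
        by field; rewrite gt_eqF.
      by rewrite mulr_ge0 ?(ltW eta0) // addr_ge0 ?sqr_ge0 // mulr_ge0 ?sqr_ge0.
    have H1 := ler_wpM2r (K0 _ aas) (le_trans Xt Lt); apply: (le_trans H1).
    rewrite mulrDl lerD2l.
    have := poisson_concentrated (za1 _ aas) r01; rewrite -/(K a) -/t => h.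
    have h4 : (1 - r ^+ 2) / r <= 4 * del.
      by rewrite ler_pdivrMr // /r; nra.
    have L2 : 0 <= L ^+ 2 / eta by rewrite divr_ge0 ?sqr_ge0 // ltW.
    have -> : L ^+ 2 / eta * t ^+ 2 * K a = L ^+ 2 / eta * (t ^+ 2 * K a) by rewrite mulrA.
    by apply: (le_trans _ delL); apply: (ler_wpM2l L2); exact: (le_trans h h4).
  rewrite big_split /= -big_distrr /= -/S big_const_seq count_predT iter_addr_0 ss.
  have -> : N%:R^-1 * (e / 4) *+ N = e / 4 by rewrite -mulr_natr; field; rewrite gt_eqF.
  by rewrite /eta; nra.
by apply: le_trans (lerD T1 T2) _; lra.
Qed.
End PoissonSums.

(** * Lipschitz majorants of upper semicontinuous functions *)

Section UpperSemicontinuous.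
Variable R : realType.
Local Notation C := R[i].
Local Notation mu := (@lebesgue_measure R).
Variable F : C -> \bar R.
Hypothesis Ffin : forall c, cabs c = 1 -> (F c < +oo)%E.
Hypothesis Fusc : forall c (a : \bar R), cabs c = 1 -> (F c < a)%E ->
  exists2 d : R, 0 < d & forall c', cabs c' = 1 -> cabs (c' - c) < d -> (F c' < a)%E.

Lemma compact_circle : compact [set c : C | cabs c = 1].
Proof.
apply: (subclosed_compact _ (@compact_cdisk R 1)); last by move=> z /= ->.
apply/closedCP => z /= /eqP z1; exists `|cabs z - 1|; first by rewrite normr_gt0 subr_eq0.
move=> w wz w1; move: wz; rewrite /cball /= -w1 => wz.
have h1 := cabs_sub_ge z w; have h2 := cabs_sub_ge w z; rewrite cabsB in h1.
by move: wz; rewrite ltNge ler_norml => /negP; apply; apply/andP; split; lra.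
Qed.

Lemma usc_bounded : exists2 M : R, 0 <= M & forall c, cabs c = 1 -> (F c <= M%:E)%E.
Proof.
have /compact_near_coveringP /(_ R (pinfty_nbhs R) (fun M c => cabs c = 1 -> (F c <= M%:E)%E) _) H := compact_circle.
have [|M [_ HM]] := H.
  move=> c c1; have [b Fb] : exists b : R, (F c < b%:E)%E.
    have := Ffin c1; case: (F c) => [s| |] //= _; last by exists 0; rewrite ltNyr.
    by exists (s + 1); rewrite lte_fin ltrDl.
  have [d d0 dF] := Fusc c1 Fb.
  exists (cball c d, [set M | b <= M]).
    split => /=; [apply/nbhsCP; exists d => // | apply: nbhs_pinfty_ge; exact: num_real].
  move=> [c' M] /= [cc' bM] c'1; apply: le_trans (ltW (dF _ c'1 cc')) _.
  by rewrite lee_fin.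
exists (Num.max 0 (M + 1)); first by rewrite le_max lexx.
move=> c c1; have /HM : M < M + 1 by rewrite ltrDl.
move=> /(_ c c1 c1)/le_trans; apply.
by rewrite lee_fin le_max lexx orbT.
Qed.

Definition trunc (n : nat) c : R := fine (maxe (F c) (- n%:R)%:E).
(** The sup-convolution of the truncated function with the cone [- n |z|]: the
    least [n]-Lipschitz majorant of [max (F, - n)] on the unit circle. *)
Definition supconv (n : nat) (z : C) : R :=
  sup [set trunc n c - n%:R * cabs (z - c) | c in [set c | cabs c = 1]].

Variable M : R.
Hypothesis M0 : 0 <= M.
Hypothesis FM : forall c, cabs c = 1 -> (F c <= M%:E)%E.

Lemma truncE n c : cabs c = 1 -> (trunc n c)%:E = maxe (F c) (- n%:R)%:E.
Proof.
move=> c1; rewrite /trunc fineK // fin_numE.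
have := Ffin c1; case: (F c) => [s| |] //= _; rewrite ?maxNye //.
by rewrite -EFin_max.
Qed.

Lemma trunc_le n c (a : R) : cabs c = 1 -> (F c <= a%:E)%E -> - n%:R <= a -> trunc n c <= a.
Proof. by move=> c1 Fa na; rewrite -lee_fin truncE // ge_max Fa lee_fin. Qed.

Lemma trunc_ge n c : cabs c = 1 -> (F c <= (trunc n c)%:E)%E.
Proof. by move=> c1; rewrite truncE // le_max lexx. Qed.

Lemma trunc_leM n c : cabs c = 1 -> trunc n c <= M.
Proof. by move=> c1; apply: trunc_le => //; [exact: FM|rewrite (le_trans _ M0) // oppr_le0]. Qed.

Lemma supconv_has_sup n z :
  has_sup [set trunc n c - n%:R * cabs (z - c) | c in [set c | cabs c = 1]].
Proof.
split; first by exists (trunc n 1 - n%:R * cabs (z - 1)), 1 => //; exact: cabs1.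
exists M => _ [c /= c1 <-]; apply: le_trans (trunc_leM n c1).
by rewrite gerBl mulr_ge0 // cabs_ge0.
Qed.

Lemma supconv_ub n z c : cabs c = 1 -> trunc n c - n%:R * cabs (z - c) <= supconv n z.
Proof. by move=> c1; apply: ub_le_sup; [exact: (supconv_has_sup n z).2|exists c]. Qed.

Lemma supconv_le n z (a : R) : (forall c, cabs c = 1 -> trunc n c - n%:R * cabs (z - c) <= a) ->
  supconv n z <= a.
Proof. by move=> H; apply: ge_sup; [exact: (supconv_has_sup n z).1|move=> _ [c /= /H ? <-]]. Qed.

Lemma supconv_leM n z : supconv n z <= M.
Proof.
apply: supconv_le => c c1; apply: le_trans (trunc_leM n c1).
by rewrite gerBl mulr_ge0 // cabs_ge0.
Qed.

Lemma supconv_Lipschitz n z w : `|supconv n z - supconv n w| <= n%:R * cabs (z - w).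
Proof.
have H y y' : supconv n y <= supconv n y' + n%:R * cabs (y - y').
  apply: supconv_le => c c1; have := supconv_ub n y' c1.
  have : n%:R * cabs (y' - c) <= n%:R * (cabs (y - y') + cabs (y - c)).
    by rewrite ler_wpM2l // [cabs (y - y')]cabsB cabs_tri.
  by rewrite mulrDr; lra.
rewrite ler_norml; have := H z w; have := H w z; rewrite [cabs (w - z)]cabsB; lra.
Qed.

Lemma supconv_ge n c : cabs c = 1 -> (F c <= (supconv n c)%:E)%E.
Proof.
move=> c1; apply: le_trans (trunc_ge n c1) _; rewrite lee_fin.
by have := supconv_ub n c c1; rewrite subrr cabs0 mulr0 subr0.
Qed.

Lemma supconv_mono n m z : (n <= m)%N -> supconv m z <= supconv n z.
Proof.
move=> nm; apply: supconv_le => c c1; apply: le_trans (supconv_ub n z c1).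
apply: lerB; last by rewrite ler_wpM2r ?cabs_ge0 // ler_nat.
rewrite -lee_fin !truncE // ge_max !le_max lexx /= lee_fin lerN2 ler_nat nm orbT //.
Qed.

(** Away from a neighbourhood of [c] the cone of slope [n] has gone below [a];
    inside it semicontinuity gives [F < a]. *)
Lemma supconv_near c (a : R) : cabs c = 1 -> (F c < a%:E)%E ->
  exists N, forall n, (N <= n)%N -> supconv n c <= a.
Proof.
move=> c1 Fa; have [d d0 dF] := Fusc c1 Fa.
pose N := Num.bound (Num.max `|a| ((M + `|a|) / d)); exists N => n Nn.
have Nlt : Num.max `|a| ((M + `|a|) / d) < n%:R.
  apply: lt_le_trans (archi_boundP _) _; first by rewrite le_max normr_ge0.
  by rewrite ler_nat.
move: Nlt; rewrite gt_max => /andP[an]; rewrite ltr_pdivrMr // => Mn.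
have na : - n%:R <= a by have := ler_norm (- a); rewrite normrN; lra.
apply: supconv_le => c' c'1; have [cc'|cc'] := ltP (cabs (c' - c)) d.
  apply: (@le_trans _ _ (trunc n c')); first by rewrite gerBl mulr_ge0 // cabs_ge0.
  by apply: trunc_le => //; apply: ltW; exact: dF.
have h1 := trunc_leM n c'1; rewrite cabsB.
have h2 : n%:R * d <= n%:R * cabs (c' - c) by rewrite ler_wpM2l.
by have := ler_norm (- a); rewrite normrN; lra.
Qed.

Lemma rcont_supconv n z : rcont (supconv n) z.
Proof. exact: Lipschitz_rcont (ler0n _ n) (supconv_Lipschitz n). Qed.

Let G n (t : R) : \bar R := (M - supconv n (expi t))%:E.

Lemma supconv_lim t : limn (fun n => G n t) = (M%:E - F (expi t))%E.
Proof.
have e1 := cabs_expi t.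
have Gub n : (G n t <= M%:E - F (expi t))%E.
  by rewrite /G EFinB; apply: leeB => //; exact: supconv_ge.
have Gnd : {homo (fun n => G n t) : n m / (n <= m)%N >-> (n <= m)%E}.
  by move=> n m nm; rewrite /G lee_fin lerB // supconv_mono.
have cG := ereal_nondecreasing_cvgn Gnd.
rewrite (cvg_lim _ cG) //; apply/eqP; rewrite eq_le; apply/andP; split.
  by apply: ge_ereal_sup => _ [n _ <-].
have real_le (b : R) : (b%:E < M%:E - F (expi t))%E -> (b%:E <= ereal_sup (range (fun n => G n t)))%E.
  move=> bF; have Fa : (F (expi t) < (M - b)%:E)%E.
    move: bF; have := Ffin e1; case: (F (expi t)) => [s| |] //= _; last by rewrite ltNyr.
    by rewrite -EFinB !lte_fin; lra.
  have [N HN] := supconv_near e1 Fa.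
  apply: (@le_trans _ _ (G N t)); last by apply: ereal_sup_ubound; exists N.
  by rewrite /G lee_fin; have := HN N (leqnn N); lra.
have := Ffin e1; case FE: (F (expi t)) => [s| |] //= _.
  apply/lee_subgt0Pr => e e0; rewrite -!EFinB; apply: real_le.
  by rewrite FE -EFinB lte_fin; lra.
rewrite /= leye_eq; apply/eqP/eq_infty => b; apply: real_le.
by rewrite FE /= ltry.
Qed.

(** Monotone convergence for [M - supconv n], which increases to [M - F]. *)
Lemma supconv_mean_cvg (a : R) :
  (forall n, a * (2 * pi) <= seg_integral (fun t => supconv n (expi t)) 0 (2 * pi)) ->
  ((a * (2 * pi))%:E <= \int[mu]_(t in `[0%R, (2 * pi)%R]) F (expi t))%E.
Proof.
move=> aX; pose D : set R := `[0%R, (2 * pi)%R]%classic.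
have mD := @measurable_itv R `[0%R, (2 * pi)%R].
have csc n : seg_continuous (fun t => supconv n (expi t)) 0 (2 * pi).
  have -> : (fun t => supconv n (expi t)) = (fun t => supconv n (circ 0 1 t)).
    by apply/funext => t; rewrite /circ add0r mul1r.
  by apply: circ_seg_continuous => t; exact: rcont_supconv.
have cM : seg_continuous (fun=> M) 0 (2 * pi) by exact: seg_continuous_cst.
have iG n : mu.-integrable D (G n).
  exact: (seg_continuous_integrable (seg_continuousD cM (seg_continuousN (csc n)))).
have mG n := measurable_int mu (iG n).
have G0 n x : D x -> (0 <= G n x)%E.
  by move=> _; rewrite /G lee_fin subr_ge0 supconv_leM.
have Gnd x : D x -> {homo (fun n => G n x) : n m / (n <= m)%N >-> (n <= m)%E}.
  by move=> _ n m nm; rewrite /G lee_fin lerB // supconv_mono.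
have H := cvg_monotone_convergence (mu := mu) mD mG G0 Gnd.
have HE : (fun x => limn (fun n => G n x)) = (fun t => M%:E - F (expi t))%E.
  by apply/funext => t; exact: supconv_lim.
have IG n : (\int[mu]_(x in `[0%R, (2 * pi)%R]) G n x <= ((M - a) * (2 * pi))%:E)%E.
  have -> : (\int[mu]_(x in `[0%R, (2 * pi)%R]) G n x)%E = (seg_integral (fun t => M - supconv n (expi t)) 0 (2 * pi))%:E.
    by rewrite /seg_integral /Rintegral fineK //; apply: integrable_fin_num => //; exact: iG.
  have IM0 : seg_integral (fun=> M) 0 (2 * pi) = M * (2 * pi) by rewrite seg_integral_cst ?subr0 // ltW // pi2_gt0.
  rewrite lee_fin (seg_integralB cM (csc n)) IM0 mulrBl.
  by have := aX n; lra.
have IM : (\int[mu]_(x in `[0%R, (2 * pi)%R]) (M%:E - F (expi x)) <= ((M - a) * (2 * pi))%:E)%E.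
  rewrite -HE; rewrite -(cvg_lim _ H) //; apply: lime_le; last by near=> n; exact: IG.
  by apply/cvg_ex; eexists; exact: H.
pose K (t : R) : \bar R := (M%:E - F (expi t))%E.
have K0 t : (0 <= K t)%E.
  have := FM (cabs_expi t); rewrite /K; have := Ffin (cabs_expi t).
  by case: (F (expi t)) => [s| |] // _; rewrite ?lee_fin ?subr_ge0 //= leey.
have GK x : D x -> G n x @[n --> \oo] --> K x.
  move=> Dx; rewrite /K -supconv_lim; apply: ereal_nondecreasing_is_cvgn.
  exact: Gnd.
have mK := measurable_realfun.emeasurable_fun_cvg (fun n => G n) K mG GK.
have iK : mu.-integrable D K.
  apply/integrableP; split => //.
  under eq_integral do rewrite gee0_abs //.
  by apply: le_lt_trans IM _; rewrite ltry.
have iM : mu.-integrable D (fun=> M%:E) by exact: (seg_continuous_integrable cM).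
have FE t : F (expi t) = (M%:E - K t)%E.
  rewrite /K; case: (F (expi t)) (Ffin (cabs_expi t)) => [s| |] //= _.
  by rewrite -!EFinB; congr EFin; ring.
under eq_integral do rewrite FE.
rewrite integralB //.
have -> : (\int[mu]_(x in `[0%R, (2 * pi)%R]) M%:E)%E = (M * (2 * pi))%:E.
  have <- : seg_integral (fun=> M) 0 (2 * pi) = M * (2 * pi) by rewrite seg_integral_cst ?subr0 // ltW // pi2_gt0.
  by rewrite /seg_integral /Rintegral fineK //; apply: integrable_fin_num.
apply: (@le_trans _ _ ((M * (2 * pi))%:E - ((M - a) * (2 * pi))%:E)%E).
  by rewrite -EFinB lee_fin; lra.
exact: leeB.
Unshelve. all: by end_near.
Qed.
End UpperSemicontinuous.

(** * Conformal invariance of subharmonicity *)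

Section ConformalInvariance.
Variable R : realType.
Local Notation C := R[i].
Local Notation mu := (@lebesgue_measure R).
Implicit Types (z w y : C) (u v : C -> \bar R) (U V : set C).

(** It suffices to prove the submean inequality for Lipschitz majorants, since
    their means decrease to the mean of [u]. *)
Lemma submean_of_majorants u w r (a : R) :
  (forall c, cabs c = 1 -> (u (w + r%:C%C * c)%R < +oo)%E) ->
  (forall c (b : \bar R), cabs c = 1 -> (u (w + r%:C%C * c)%R < b)%E ->
     exists2 d : R, 0 < d & forall c', cabs c' = 1 -> cabs (c' - c) < d ->
       (u (w + r%:C%C * c')%R < b)%E) ->
  (forall (X : C -> R) (L : R), 0 <= L -> (forall x y, `|X x - X y| <= L * cabs (x - y)) ->
     (forall c, cabs c = 1 -> (u (w + r%:C%C * c)%R <= (X c)%:E)%E) -> a <= rmean X 0 1) ->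
  (a%:E <= circle_mean u w r)%E.
Proof.
move=> ufin uusc H; pose F c := u (w + r%:C%C * c)%R.
have [M M0 FM] := @usc_bounded R F ufin uusc.
have p0 := pi2_gt0 R.
rewrite circle_meanE lee_pdivlMl // -EFinM mulrC.
apply: (supconv_mean_cvg (F := F) ufin uusc M0 FM) => n.
have := H (supconv F n) n%:R (ler0n _ _) (supconv_Lipschitz ufin M0 FM n)
  (fun c c1 => supconv_ge ufin M0 FM n c1).
rewrite /rmean; have -> : (fun t => supconv F n (circ 0 1 t)) = (fun t => supconv F n (expi t)).
  by apply/funext => t; rewrite /circ add0r mul1r.
by rewrite ler_pdivlMl // mulrC.
Qed.

Section Biholomorphism.
Variables (U V : set C) (f g : C -> C) (v : C -> \bar R) (M : R).
Hypotheses (oU : open U) (UM : forall y, U y -> cabs y <= M).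
Hypothesis sv : subharmonic_on U v.
Hypotheses (fU : forall z, V z -> U (f z)) (cf : forall z, V z -> ccont f z).
Hypotheses (dg : forall y, U y -> cdiff g y).
Hypotheses (fK : forall z, V z -> g (f z) = z) (gK : forall y, U y -> f (g y) = y).

(** Approximate [X] on the circle by [Re Q].  The function [Re (Q o T o g)],
    where [T] maps the given disc to the unit disc, is the real part of a
    holomorphic function on the image of the disc, and up to [e / 4] it majorizes
    [v] on the boundary of that image; so it majorizes [v] at [f w], where its
    value is the mean of [Re Q]. *)
Lemma majorant_in_disc w (r : R) (X : C -> R) (L : R) : 0 < r ->
  (forall z, cabs (z - w) <= r -> V z) -> 0 <= L ->
  (forall x y, `|X x - X y| <= L * cabs (x - y)) ->
  (forall c, cabs c = 1 -> (v (f (w + r%:C%C * c)%R) <= (X c)%:E)%E) ->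
  (v (f w) <= (rmean X 0 1)%:E)%E.
Proof.
move=> r0 rV L0 XL vX.
have [vfin vusc vsub] := sv.
apply/lee_addgt0Pr => e e0; rewrite -EFinD.
have e30 : 0 < e / 4 by rewrite divr_gt0.
have [Q [rho rho1 dQ] QX] := Lipschitz_approx L0 XL e30.
have rC0 : r%:C%C != 0 :> C by rewrite -cabs_gt0 cabs_real gtr0_norm.
have rr : cabs (r^-1)%:C%C = r^-1 by rewrite cabs_real ger0_norm // invr_ge0 ltW.
pose T z : C := (r^-1)%:C%C * z + - ((r^-1)%:C%C * w).
have TE z : T z = (r^-1)%:C%C * (z - w) by rewrite /T; ring.
have absT z : cabs (T z) = cabs (z - w) / r by rewrite TE cabsM rr mulrC.
have dQT z : cabs (z - w) < r * rho -> cdiff (fun z => Q (T z)) z.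
  move=> zr; apply: cdiff_comp; first exact: cdiff_affine.
  by apply: dQ; rewrite absT ltr_pdivrMr // mulrC.
(* The image of the open disc under [f]. *)
pose W := U `&` [set y | cabs (g y - w) < r].
have VW y : W y -> V (g y) by move=> [_ /= /ltW]; exact: rV.
have oW : open W.
  apply/openCP => y [Uy gy].
  have [e1 e10 yU] := (openCP _).1 oU y Uy.
  have d0 : 0 < r - cabs (g y - w) by rewrite subr_gt0.
  have [d d00 yg] := cdiff_ccont (dg Uy) d0.
  exists (Num.min e1 d); first by rewrite lt_min e10.
  move=> y'; rewrite /cball /= lt_min => /andP[h1 h2]; split; first exact: yU.
  have := yg y' h2; have := cabs_tri (g y') (g y) w; rewrite /=; lra.
have sW : subharmonic_on W v by apply: (subharmonic_subset oW _ sv) => y [].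
pose G y := Q (T (g y)) + (e / 4)%:C%C.
have ReG y : Re (G y) = Re (Q (T (g y))) + e / 4 by rewrite ReD.
have dG y : U y -> cabs (g y - w) < r * rho -> cdiff G y.
  move=> Uy gy; apply: cdiffD; last exact: cdiff_cst.
  by apply: (cdiff_comp (f := g) (g := fun z => Q (T z))); [exact: dg|exact: dQT].
have dGW y : W y -> cdiff G y.
  by move=> [Uy /= gy]; apply: dG => //; apply: lt_trans gy _; rewrite ltr_pMr.
have bd y : closure W y -> ~ W y -> forall a : R, 0 < a -> exists2 d : R, 0 < d &
     forall y', W y' -> cabs (y' - y) < d -> (v y' <= (Re (G y') + a)%:E)%E.
  move=> cWy nWy a a0.
  have : closed (f @` [set z | cabs (z - w) <= r]).
    apply: compact_closedC; apply: continuous_compact; last exact: compact_closed_disc.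
    apply: continuous_in_subspaceT => z; rewrite inE /= => zr.
    by apply/continuous_ccont; apply: cf; exact: rV.
  (* The image of the closed disc is compact, so a boundary point of [W] is the
     image of a point on the circle. *)
  have Wsub : W `<=` f @` [set z | cabs (z - w) <= r].
    by move=> y' [Uy' /= gy']; exists (g y'); [exact: ltW|exact: gK].
  move=> clf; have := closure_subset Wsub cWy; move/closure_id : clf => <-.
  move=> [z zr zy]; have Vz := rV z zr.
  have Uy : U y by rewrite -zy; exact: fU.
  have gy : g y = z by rewrite -zy fK.
  have zr' : cabs (z - w) = r.
    apply/eqP; rewrite eq_le zr /= leNgt; apply/negP => zr'.
    by apply: nWy; split => //=; rewrite gy.
  have Tz1 : cabs (T z) = 1 by rewrite absT zr' divff // gt_eqF.
  have zE : z = w + r%:C%C * T z.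
    by rewrite TE mulrA -rmorphM mulfV ?gt_eqF // mul1r addrC subrK.
  have vy : (v y < (Re (G y) + a / 2)%:E)%E.
    rewrite -zy {1}zE; apply: le_lt_trans (vX _ Tz1) _; rewrite lte_fin.
    rewrite zy ReG gy.
    by have := QX _ Tz1; rewrite ler_norml => /andP[h1 h2]; lra.
  have /nbhsCP [d d0 dv] := vusc y Uy _ vy.
  have a20 : 0 < a / 2 by rewrite divr_gt0.
  have dGy : cdiff G y by apply: dG => //; rewrite gy zr' ltr_pMr.
  have /rcontP /(_ _ a20) [d' d'0 dh] := rcont_Re (cdiff_ccont dGy).
  exists (Num.min d d'); first by rewrite lt_min d0.
  move=> y' Wy'; rewrite lt_min => /andP[/dv /(_ Wy'.1) h1 /dh].
  rewrite ltr_norml => /andP[h2 h3]; apply: le_trans (ltW h1) _.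
  by rewrite lee_fin; lra.
have Ww : W (f w).
  have Vw : V w by apply: rV; rewrite subrr cabs0 ltW.
  by split; [exact: fU|rewrite /= fK // subrr cabs0].
have WM y : W y -> cabs y <= M by move=> [/UM].
have Vw : V w by apply: rV; rewrite subrr cabs0 ltW.
have := comparison_principle oW WM sW (fun y Wy => rcont_Re (cdiff_ccont (dGW y Wy)))
  (fun y => supermean_Re oW dGW) bd Ww.
move=> /le_trans; apply; rewrite lee_fin ReG fK //.
have m1 : rmean (fun z => Re (Q (T z))) w r = Re (Q (T w)).
  by apply: (mean_Re (R0 := r * rho)) => //; rewrite ltr_pMr.
have m2 : rmean (fun z => Re (Q (T z))) w r = rmean (fun z => Re (Q z)) 0 1.
  rewrite /rmean; congr (_ * _); apply: eq_seg_integral => t _; congr (Re (Q _)).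
  rewrite TE /circ add0r mul1r addrC addKr mulrA -rmorphM mulVf ?gt_eqF //.
  by rewrite mul1r.
have cX z : rcont X z := Lipschitz_rcont z L0 XL.
have m3 : rmean (fun z => Re (Q z)) 0 1 <= rmean X 0 1 + e / 4.
  rewrite -[e / 4 in leRHS](rmean_cst (e / 4) 0 1).
  have c1 t : rcont X (circ 0 1 t) by exact: cX.
  have c2 t : rcont (fun=> e / 4) (circ 0 1 t) by exact: rcont_cst.
  have cc (t : R) : cabs (circ (0 : C) 1 t) = 1 by rewrite /circ add0r mul1r cabs_expi.
  rewrite -(rmeanD c1 c2); apply: rmean_le.
  - by move=> t; apply: rcont_Re; apply: cdiff_ccont; apply: dQ; rewrite cc.
  - by move=> t; exact: rcontD.
  by move=> t; have := QX _ (cc t); rewrite ler_norml => /andP[? ?]; lra.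
by rewrite -m1 m2; lra.
Qed.

(** The constant [c] is carried along because the means of [v] may be infinite,
    where they are not additive. *)
Lemma subharmonic_conformal (c : R) : open V ->
  subharmonic_on V (fun z => v (f z) + c%:E)%E.
Proof.
move=> oV; have [vfin vusc vsub] := sv.
have uusc w (a : \bar R) : V w -> (v (f w) + c%:E < a)%E ->
    exists2 d : R, 0 < d & forall z, V z -> cabs (z - w) < d -> (v (f z) + c%:E < a)%E.
  move=> Vw; rewrite -lteBrDr // => va.
  have /nbhsCP [d d0 dv] := vusc _ (fU Vw) _ va.
  have [d' d'0 fd] := cf Vw d0.
  exists d' => // z Vz /fd /dv /(_ (fU Vz)).
  by rewrite lteBrDr.
have ufin z : V z -> (v (f z) + c%:E < +oo)%E.
  by move=> /fU /vfin; case: (v (f z)) => [s| |] //= _; rewrite -EFinD ltry.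
split => //.
- move=> w Vw a /(uusc _ _ Vw) [d d0 H]; apply/nbhsCP; exists d => // z zw Vz.
  exact: H.
move=> w Vw; have [rho rho0 rhoV] := (openCP _).1 oV w Vw.
exists rho => //; split => // r /andP[r0 rr].
move: r0; rewrite le_eqVlt => /predU1P[<-|r0]; first by rewrite circle_mean0.
have rV z : cabs (z - w) <= r -> V z.
  by move=> zr; apply: rhoV; exact: le_lt_trans zr rr.
have cd x : cabs (w + r%:C%C * x - w) = r * cabs x.
  by rewrite addrC addKr cabsM cabs_real gtr0_norm.
have [[a va]|->] : (exists a, v (f w) = a%:E) \/ v (f w) = -oo%E.
  have := vfin _ (fU Vw); case: (v (f w)) => [a| |] //= _; [left|right] => //.
  by exists a.
  rewrite va -EFinD; apply: submean_of_majorants.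
  - by move=> x x1; apply: ufin; apply: rV; rewrite cd x1 mulr1.
  - move=> x b x1 xb; have Vx : V (w + r%:C%C * x) by apply: rV; rewrite cd x1 mulr1.
    have [d d0 H] := uusc _ _ Vx xb.
    exists (d / r); first by rewrite divr_gt0.
    move=> x' x'1; rewrite ltr_pdivlMr // => xx'; apply: H.
      by apply: rV; rewrite cd x'1 mulr1.
    by rewrite opprD addrACA subrr add0r -mulrBr cabsM cabs_real gtr0_norm // mulrC.
  - move=> X L L0 XL vX.
    have XL' x y : `|(X x - c) - (X y - c)| <= L * cabs (x - y).
      by rewrite (_ : X x - c - (X y - c) = X x - X y) //; ring.
    have cX z : rcont X z := Lipschitz_rcont z L0 XL.
    have := majorant_in_disc r0 rV L0 XL'; rewrite va.
    have c1 t : rcont X (circ 0 1 t) by exact: cX.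
    have c2 t : rcont (fun=> - c) (circ 0 1 t) by exact: rcont_cst.
    rewrite (rmeanD c1 c2) rmean_cst lee_fin lerBrDr; apply => x x1.
    by have := vX x x1; rewrite EFinB leeBrDr.
by rewrite /= leNye.
Qed.
End Biholomorphism.
End ConformalInvariance.

(** * Harnack's inequality *)

Section Harnack.
Variable R : realType.
Local Notation C := R[i].
Implicit Types (z w y a b : C) (v : C -> \bar R) (h : C -> R) (U : set C) (F G : C -> C).

(** A weak Schwarz lemma that avoids removable singularities: [F^2 / (z - a)]
    tends to zero at [a], so the maximum principle applies on the punctured disc
    and gives [|F b|^2 <= (2 / rho) |b - a|]. *)
Lemma schwarz_half F a (rho : R) : 0 < rho ->
  (forall z, cball a rho z -> cdiff F z) -> (forall z, cball a rho z -> cabs (F z) <= 1) ->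
  F a = 0 -> forall b, cabs (b - a) <= rho / 8 -> cabs (F b) <= 1 / 2.
Proof.
move=> rho0 dF F1 Fa b ba.
have [->|bna] := eqVneq b a; first by rewrite Fa cabs0; lra.
pose U := cball a (rho / 2) `&` [set z | z != a].
have r20 : 0 < rho / 2 by rewrite divr_gt0.
have oU : open U.
  apply: openI; first exact: open_cball.
  apply/openCP => z /= za; exists (cabs (z - a)); first by rewrite cabs_gt0 subr_eq0.
  by move=> y; rewrite /cball /= cabsB; apply: contraTneq => ->; rewrite ltxx.
have Usub z : U z -> cball a rho z by move=> [h _]; move: h; rewrite /cball /=; lra.
pose G z := F z ^+ 2 * (z - a)^-1.
have dU z : U z -> cdiff G z.
  move=> Uz; apply: cdiffM; first by apply: cdiffX; exact: dF (Usub _ Uz).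
  apply: cdiffV; first by rewrite subr_eq0; exact: Uz.2.
  by apply: cdiffB; [exact: cdiff_id|exact: cdiff_cst].
have GE z : cabs (G z) = cabs (F z) ^+ 2 / cabs (z - a) by rewrite cabsM cabsV cabsX.
have UM z : U z -> cabs z <= cabs a + rho / 2.
  by move=> [h _]; move: h; rewrite /cball /=; have := cabs_sub_ge z a; lra.
have bdry z : closure U z -> ~ U z -> forall e : R, 0 < e -> exists2 d : R, 0 < d &
     forall w, U w -> cabs (w - z) < d -> ((cabs (G w))%:E <= (2 / rho + e)%:E)%E.
  move=> cUz nUz e e0.
  have r2e : 0 < 2 / rho by rewrite divr_gt0.
  have [za|za] := eqVneq z a.
    have dFa : cdiff F a by apply: dF; exact: cball_center.
    have [q cq FE] := dFa.
    have [d d0 dq] := cq 1 ltr01.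
    pose K := cabs (q a) + 1; have K0 : 0 < K by rewrite ltr_wpDl // cabs_ge0.
    exists (Num.min d (e / K ^+ 2)); first by rewrite lt_min d0 divr_gt0 // exprn_gt0.
    move=> w Uw; rewrite za lt_min ltr_pdivlMr ?exprn_gt0 // => /andP[wd we].
    have w0 : 0 < cabs (w - a) by rewrite cabs_gt0 subr_eq0; exact: Uw.2.
    have qK : cabs (q w) <= K by have := dq w wd; have := cabs_sub_ge (q w) (q a); rewrite /K; lra.
    rewrite lee_fin GE FE Fa add0r cabsM exprMn expr2 mulrA mulfK ?gt_eqF //.
    have : cabs (q w) ^+ 2 * cabs (w - a) <= K ^+ 2 * cabs (w - a).
      by rewrite ler_wpM2r ?cabs_ge0 // ler_sqr ?nnegrE ?cabs_ge0 // ltW.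
    by rewrite [K ^+ 2 * _]mulrC -expr2; lra.
  have zr : rho / 2 <= cabs (z - a).
    by rewrite leNgt; apply/negP => h; apply: nUz; split.
  have z0 : 0 < cabs (z - a) by exact: lt_le_trans zr.
  have : rcont (fun w => (cabs (w - a))^-1) z.
    apply: rcontV; first by rewrite gt_eqF.
    by apply: rcont_cabs; apply: ccontB; [exact: ccont_id|exact: ccont_cst].
  move=> /rcontP /(_ _ e0) [d d0 dH]; exists d => // w Uw wz; rewrite lee_fin GE.
  have h1 := dH w wz; rewrite ltr_norml in h1; have /andP[_ h2] := h1.
  have h3 : (cabs (z - a))^-1 <= 2 / rho.
    by rewrite -[2 / rho]invrK invf_div lef_pV2 // posrE.
  have h4 : cabs (F w) ^+ 2 <= 1 by rewrite exprn_ile1 ?cabs_ge0 // F1 //; exact: Usub.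
  have h5 : 0 <= (cabs (w - a))^-1 by rewrite invr_ge0 cabs_ge0.
  by nra.
have Ub : U b by split => //; rewrite /cball /=; lra.
have := comparison_principle oU UM (subharmonic_cabs oU dU) (fun w _ => rcont_cst _ w)
  (fun w _ => supermean_cst _ w) bdry Ub.
have b0 : 0 < cabs (b - a) by rewrite cabs_gt0 subr_eq0.
rewrite lee_fin GE ler_pdivrMr // => h.
have : cabs (F b) ^+ 2 <= (1 / 2) ^+ 2.
  apply: le_trans h _; rewrite mulrC mulrA ler_pdivrMr //; nra.
by rewrite ler_sqr ?nnegrE ?cabs_ge0 // divr_ge0.
Qed.

(** Compose [F] with the Moebius map of the right half-plane onto the unit disc
    that sends [F a] to zero. *)
Lemma harnack_disc F a (rho : R) : 0 < rho ->
  (forall z, cball a rho z -> cdiff F z) -> (forall z, cball a rho z -> 0 < Re (F z)) ->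
  forall b, cabs (b - a) <= rho / 8 -> Re (F a) / 3 <= Re (F b).
Proof.
move=> rho0 dF F0 b ba.
have Fa0 : 0 < Re (F a) by apply: F0; exact: cball_center.
have Bb : cball a rho b by rewrite /cball /=; lra.
have Fb0 := F0 b Bb.
have n0 z : cball a rho z -> F z + conjc (F a) != 0.
  move=> /F0 Fz0; apply/negP => /eqP/(congr1 (fun x : C => Re x)); rewrite ReD.
  by case: (F a) Fa0 => p q /= p0 h; lra.
pose f z := (F z - F a) * (F z + conjc (F a))^-1.
have : cabs (f b) <= 1 / 2.
  apply: (schwarz_half rho0) ba.
  - move=> z Bz; apply: cdiffM.
      by apply: cdiffB; [exact: dF|exact: cdiff_cst].
    apply: cdiffV; first exact: n0.
    by apply: cdiffD; [exact: dF|exact: cdiff_cst].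
  - move=> z Bz; rewrite /f cabsM cabsV ler_pdivrMr ?cabs_gt0 ?n0 // mul1r.
    rewrite -ler_sqr ?nnegrE ?cabs_ge0 // !sqr_cabs.
    have := F0 z Bz; case: (F a) Fa0 => p q /= p0; case: (F z) => x y /= x0.
    by have := mulr_gt0 p0 x0; nra.
  - by rewrite /f subrr mul0r.
rewrite /f cabsM cabsV ler_pdivrMr ?cabs_gt0 ?n0 // => h.
have : cabs (F b - F a) ^+ 2 <= (1 / 2 * cabs (F b + conjc (F a))) ^+ 2.
  by rewrite ler_sqr ?nnegrE ?mulr_ge0 ?cabs_ge0.
rewrite exprMn !sqr_cabs.
case: (F a) Fa0 => p q /= p0; case: (F b) Fb0 => x y /= x0 hh.
rewrite leNgt; apply/negP => xp.
have h1 : 0 < p - x - (x + p) / 2 by lra.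
have h2 : 0 < p - x + (x + p) / 2 by lra.
have h3 := mulr_gt0 h1 h2; have h4 := sqr_ge0 (y - q).
by move: hh; rewrite !expr2 in h4 *; lra.
Qed.

Section Chain.
Variables (D : set C) (k0 : C).
Hypotheses (oD : open D) (cD : connected D) (Dk0 : D k0).

Definition comparable (c : R) k := forall F, (forall z, D z -> cdiff F z) ->
  (forall z, D z -> 0 < Re (F z)) -> c * Re (F k0) <= Re (F k).

Lemma comparable_near a b (rho c : R) : 0 < rho -> cball a rho `<=` D ->
  cabs (b - a) <= rho / 8 -> comparable c a -> comparable (c / 3) b.
Proof.
move=> rho0 aD ab ca F dF F0.
have := harnack_disc rho0 (fun z Bz => dF z (aD z Bz)) (fun z Bz => F0 z (aD z Bz)) ab.
by have := ca F dF F0; lra.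
Qed.

(** By [harnack_disc] both the set of comparable points and its complement in
    [D] are open. *)
Lemma all_comparable k : D k -> exists2 c : R, 0 < c & comparable c k.
Proof.
pose S := [set k | D k /\ exists2 c : R, 0 < c & comparable c k].
pose T := [set k | D k /\ ~ exists2 c : R, 0 < c & comparable c k].
have SD : S = D.
  apply: cD.
  - exists k0; split => //; exists 1 => //; rewrite /comparable => F _ _.
    by rewrite mul1r.
  - exists S; last by rewrite setIidr // => z [].
    apply/openCP => a [Da [c c0 ca]]; have [rho rho0 aD] := (openCP _).1 oD a Da.
    exists (rho / 8); first by rewrite divr_gt0.
    move=> b; rewrite /cball /= => ab; split; first by apply: aD; rewrite /cball /=; lra.
    exists (c / 3); first by rewrite divr_gt0.
    exact: (comparable_near rho0 aD (ltW ab) ca).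
  - exists (~` T).
      apply: open_closedC; apply/openCP => a [Da na].
      have [rho rho0 aD] := (openCP _).1 oD a Da.
      exists (rho / 16); first by rewrite divr_gt0.
      move=> b; rewrite /cball /= => ab; split; first by apply: aD; rewrite /cball /=; lra.
      move=> [c c0 cb]; apply: na; exists (c / 3); first by rewrite divr_gt0.
      apply: (@comparable_near b a (rho / 2)) cb; first by rewrite divr_gt0.
        move=> z; rewrite /cball /= => zb; apply: aD; rewrite /cball /=.
        by have := cabs_tri z b a; lra.
      by rewrite cabsB; lra.
    apply/seteqP; split=> [z [Dz h]|z [Dz nT]]; first by split => // -[_].
    by split => //; apply: contrapT => h; apply: nT; split.
by rewrite -SD => -[].
Qed.

Lemma harnack_compact (K : set C) : compact K -> K `<=` D ->
  exists2 c : R, 0 < c & forall k, K k -> comparable c k.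
Proof.
move=> cK KD.
have /compact_near_coveringP /(_ R (0^'+)%classic (fun c k => comparable c k) _) H := cK.
have [|/= e e0 HK] := H.
  move=> k Kk; have Dk := KD _ Kk; have [c c0 ck] := all_comparable Dk.
  have [rho rho0 kD] := (openCP _).1 oD k Dk.
  exists (cball k (rho / 8), [set x | 0 < x <= c / 3]).
    split => /=; first by apply/nbhsCP; exists (rho / 8) => //; rewrite divr_gt0.
    have c3 : 0 < c / 3 by rewrite divr_gt0.
    near=> x; apply/andP; split; near: x; [exact: nbhs_right_gt|exact: nbhs_right_le].
  move=> [b x] [/= kb /andP[x0 xc]] F dF F0.
  have := comparable_near rho0 kD (ltW kb) ck dF F0.
  by have := F0 _ Dk0; nra.
exists (e / 2); first by rewrite divr_gt0.
move=> k Kk; apply: HK => //=; last by rewrite divr_gt0.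
by rewrite /ball /= sub0r normrN gtr0_norm ?divr_gt0 //; lra.
Unshelve. all: by end_near.
Qed.
End Chain.
End Harnack.

(** * Holomorphic roots on the unit disk *)

Section Roots.
Variable R : realType.
Local Notation C := R[i].
Local Notation sqrtc := (@complex.sqrtc R).
Implicit Types (z w y a b : C) (g S : C -> C).

Lemma Re_sqrtc_ge0 z : 0 <= Re (sqrtc z).
Proof. by case: z => a b; rewrite /= sqrtr_ge0. Qed.

Lemma Re_sqrtc_gt0 z : 0 < Re z -> 0 < Re (sqrtc z).
Proof.
rewrite -{1}(complex.sqr_sqrtc z); have := Re_sqrtc_ge0 z.
case: (sqrtc z) => a b /= a0 h; rewrite lt_neqAle a0 andbT.
by apply: contraTneq h => <-; rewrite mul0r sub0r -leNgt oppr_le0 -expr2 sqr_ge0.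
Qed.

(** The quotient is [1 / (sqrt z + sqrt z0)], and the principal root has
    nonnegative real part, so the denominator stays away from zero. *)
Lemma cdiff_sqrtc z0 : 0 < Re z0 -> cdiff sqrtc z0.
Proof.
move=> /Re_sqrtc_gt0 s0.
have ge z : Re (sqrtc z0) <= cabs (sqrtc z + sqrtc z0).
  apply: le_trans (Re_le_cabs _); apply: le_trans (ler_norm _).
  by rewrite ReD lerDr Re_sqrtc_ge0.
have n0 z : sqrtc z + sqrtc z0 != 0 by rewrite -cabs_gt0; exact: lt_le_trans (ge z).
have E z : sqrtc z - sqrtc z0 = (sqrtc z + sqrtc z0)^-1 * (z - z0).
  apply: (mulfI (n0 z)); rewrite mulrA mulfV // mul1r.
  rewrite -[in RHS](complex.sqr_sqrtc z) -[in X in _ = _ - X](complex.sqr_sqrtc z0); ring.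
have cs : ccont sqrtc z0.
  move=> e e0; exists (e * Re (sqrtc z0)); first by rewrite mulr_gt0.
  move=> z zz; rewrite E cabsM cabsV mulrC ltr_pdivrMr; last by rewrite cabs_gt0.
  by apply: lt_le_trans zz _; rewrite ler_wpM2l // ltW.
exists (fun z => (sqrtc z + sqrtc z0)^-1).
  by apply: ccontV => //; apply: ccontD => //; exact: ccont_cst.
by move=> z; rewrite -E addrC subrK.
Qed.

Lemma cdiff_prod (I : eqType) (s : seq I) (F : I -> C -> C) z :
  (forall i, i \in s -> cdiff (F i) z) -> cdiff (fun w => \prod_(i <- s) F i w) z.
Proof.
elim: s => [|i s IH] dF.
  by rewrite (_ : (fun _ => _) = fun=> 1); [exact: cdiff_cst|apply/funext => w; rewrite big_nil].
rewrite (_ : (fun _ => _) = fun w => F i w * \prod_(j <- s) F j w).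
  apply: cdiffM; first by apply: dF; rewrite mem_head.
  by apply: IH => j js; apply: dF; rewrite in_cons js orbT.
by apply/funext => w; rewrite big_cons.
Qed.

Lemma uniform_ratio (K : set C) g : compact K -> (forall z, K z -> ccont g z) ->
  (forall z, K z -> g z != 0) ->
  exists2 d : R, 0 < d & forall x y, K x -> cabs (x - y) < d -> cabs (g x - g y) < cabs (g y).
Proof.
move=> cK cg g0.
have /compact_near_coveringP /(_ R (0^'+)%classic
  (fun d x => forall y, cabs (x - y) < d -> cabs (g x - g y) < cabs (g y)) _) H := cK.
have [|/= e e0 HK] := H.
  move=> x Kx; have gx0 : 0 < cabs (g x) / 4 by rewrite divr_gt0 // cabs_gt0 g0.
  have [d d0 gd] := cg x Kx _ gx0.
  have d20 : 0 < d / 2 by rewrite divr_gt0.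
  exists (cball x (d / 2), [set r | r <= d / 2]).
    split => /=; first by apply/nbhsCP; exists (d / 2).
    exact: nbhs_right_le.
  move=> [x' r] [/= xx' rd] y xy.
  have h1 := gd x' (lt_trans xx' _); have {}h1 : cabs (g x' - g x) < cabs (g x) / 4.
    by apply: h1; lra.
  have h2 : cabs (g y - g x) < cabs (g x) / 4.
    apply: gd; have := cabs_tri y x' x; rewrite [cabs (y - x')]cabsB.
    by move: xx'; rewrite /cball /=; lra.
  have := cabs_tri (g x') (g x) (g y); rewrite [cabs (g x - g y)]cabsB.
  have := cabs_sub_ge (g x) (g y); rewrite [cabs (g x - g y)]cabsB; lra.
have e20 : 0 < e / 2 by rewrite divr_gt0.
exists (e / 2) => // x y Kx xy; apply: (HK (e / 2)) => //=.
by rewrite /ball /= sub0r normrN gtr0_norm //; lra.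
Qed.

Lemma Re_ratio_gt0 a b : cabs (a - b) < cabs b -> 0 < Re (a / b).
Proof.
move=> ab; have b0 : b != 0 by rewrite -cabs_gt0 (le_lt_trans _ ab) // cabs_ge0.
have : cabs (a / b - 1) < 1.
  by rewrite -(divff b0) -mulrBl cabsM cabsV ltr_pdivrMr ?mul1r // cabs_gt0.
move=> h; have := Re_le_cabs (a / b - 1); rewrite ReD ReN /= => h2.
by have := le_lt_trans h2 h; rewrite ltr_norml => /andP[h3 _]; lra.
Qed.

(** Telescoping along the ray: [g z] is [g 0] times the product of the ratios
    [g ((j + 1) z / n) / g (j z / n)].  For large [n] these have positive real
    part, where the principal root is holomorphic. *)
Lemma sqrt_on_disc g (rho r : R) : 0 < rho -> rho < r ->
  (forall z, cball 0 r z -> cdiff g z) -> (forall z, cball 0 r z -> g z != 0) ->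
  exists S, [/\ forall z, cball 0 rho z -> cdiff S z,
    forall z, cball 0 rho z -> S z ^+ 2 = g z & S 0 = sqrtc (g 0)].
Proof.
move=> rho0 rr dg g0.
have Kr z : cabs (z - 0) <= rho -> cball 0 r z by move=> zr; exact: le_lt_trans zr rr.
have [d d0 gd] := uniform_ratio (compact_closed_disc (w := 0) (r := rho))
  (fun z Kz => cdiff_ccont (dg z (Kr z Kz))) (fun z Kz => g0 z (Kr z Kz)).
pose n := (Num.bound (rho / d)).+1.
have n0 : 0 < n%:R :> R by rewrite ltr0n.
have nd : rho / n%:R < d.
  rewrite ltr_pdivrMr // mulrC -ltr_pdivrMr //.
  by apply: lt_trans (archi_boundP _) _; rewrite ?divr_ge0 ?(ltW rho0) ?(ltW d0) // ltr_nat.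
pose p j y : C := (j%:R / n%:R : R)%:C%C * y.
have pr j y : (j <= n)%N -> cabs (p j y) <= cabs y.
  move=> jn; rewrite cabsM cabs_real ger0_norm ?divr_ge0 ?ler0n //.
  by rewrite ler_piMl ?cabs_ge0 // ler_pdivrMr // mul1r ler_nat.
have pB j y : (j <= n)%N -> cball 0 rho y -> cball 0 rho (p j y).
  by move=> jn; rewrite /cball /= !subr0; apply: le_lt_trans; exact: pr.
have Brr y : cball 0 rho y -> cball 0 r y by move=> h; apply: lt_trans rr.
have ratio j y : (j < n)%N -> cball 0 rho y -> 0 < Re (g (p j.+1 y) / g (p j y)).
  move=> jn Ry; apply: Re_ratio_gt0; apply: gd; first exact: ltW (pB j.+1 y jn Ry).
  rewrite /p -mulrBl -rmorphB cabsM cabs_real.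
  have -> : j.+1%:R / n%:R - j%:R / n%:R = n%:R^-1 :> R.
    by rewrite -mulrBl -natrB // subSn // subnn mul1r.
  rewrite ger0_norm ?invr_ge0 ?ler0n // mulrC; apply: le_lt_trans nd.
  by rewrite ler_wpM2r ?invr_ge0 ?ler0n // ltW //; move: Ry; rewrite /cball /= subr0.
exists (fun y => sqrtc (g 0) * \prod_(j <- index_iota 0 n) sqrtc (g (p j.+1 y) / g (p j y))).
split.
- move=> z Rz; apply: cdiffM; first exact: cdiff_cst.
  apply: cdiff_prod => j; rewrite mem_index_iota => /andP[_ jn].
  apply: (cdiff_comp (f := fun y => g (p j.+1 y) / g (p j y)) (g := sqrtc)); last first.
    exact: cdiff_sqrtc (ratio j z jn Rz).
  have dp i : cdiff (p i) z by apply: cdiffM; [exact: cdiff_cst|exact: cdiff_id].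
  have dgp i : (i <= n)%N -> cdiff (fun y => g (p i y)) z.
    by move=> ni; apply: cdiff_comp => //; apply: dg; apply: Brr; exact: pB.
  apply: cdiffM; first exact: dgp.
  by apply: cdiffV; [apply: g0; apply: Brr; apply: pB => //; exact: ltnW|apply: dgp; exact: ltnW].
- move=> z Rz; rewrite exprMn complex.sqr_sqrtc -prodrXl.
  rewrite (eq_bigr (fun j => g (p j.+1 z) / g (p j z))); last first.
    by move=> j _; rewrite complex.sqr_sqrtc.
  rewrite (telescope_prodf (f := fun j => g (p j z))) //; last first.
    by move=> k /andP[_ kn]; apply: g0; apply: Brr; apply: pB => //; exact: ltnW.
  rewrite /p mul0r rmorph0 mul0r divff ?gt_eqF // rmorph1 mul1r mulrC divfK //.
  by apply: g0; rewrite /cball /= subrr cabs0 (lt_trans rho0).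
rewrite big1 ?mulr1 // => j _; rewrite /p !mulr0 divff ?complex.sqrtc1 //.
by apply: g0; rewrite /cball /= subrr cabs0 (lt_trans rho0).
Qed.

(** Along the ray to [z] the quotient of the two roots is continuous with values
    [1] and [- 1], hence constant. *)
Lemma sqrt_unique S S' (rho : R) : (forall z, cball 0 rho z -> ccont S z) ->
  (forall z, cball 0 rho z -> ccont S' z) -> (forall z, cball 0 rho z -> S z != 0) ->
  (forall z, cball 0 rho z -> S z ^+ 2 = S' z ^+ 2) -> S 0 = S' 0 ->
  forall z, cball 0 rho z -> S z = S' z.
Proof.
move=> cS cS' S0 SS' S00 z Rz.
have Rt (t : R) : 0 <= t <= 1 -> cball 0 rho (t%:C%C * z).
  move=> /andP[t0 t1]; move: Rz; rewrite /cball /= !subr0 cabsM cabs_real ger0_norm //.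
  by apply: le_lt_trans; rewrite ler_piMl ?cabs_ge0.
pose q (t : R) : C := S' (t%:C%C * z) / S (t%:C%C * z).
have q2 t : 0 <= t <= 1 -> q t = 1 \/ q t = -1.
  move=> /Rt R1; have : q t ^+ 2 = 1.
    by rewrite /q expr_div_n -SS' // divff // expf_neq0 // S0.
  by move=> /eqP; rewrite sqrf_eq1 => /orP[/eqP|/eqP]; [left|right].
have q0 : q 0 = 1.
  rewrite /q mul0r -S00 divff // S0 //; have := Rt 0; rewrite mul0r; apply.
  by rewrite lexx ler01.
have cq : {within `[0, 1], continuous (fun t : R => Re (q t))}.
  apply: continuous_in_subspaceT => t; rewrite inE /= in_itv /= => t01.
  pose Q y := S' ((Re y)%:C%C * z) / S ((Re y)%:C%C * z).
  have cl : ccont (fun y => (Re y)%:C%C * z) (t +i* 0)%C.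
    by apply: ccontM; [exact: ccont_Re|exact: ccont_cst].
  have cQ : ccont Q (t +i* 0)%C.
    apply: ccontM; first exact: (ccont_comp cl (cS' _ (Rt t t01))).
    apply: ccontV; first exact: S0 (Rt t t01).
    exact: (ccont_comp cl (cS _ (Rt t t01))).
  exact: (rcont_horiz (rcont_Re cQ)).
have one01 : 0 <= (1 : R) <= 1 by rewrite lexx ler01.
have [q1|q1] := q2 1 one01.
  move: q1; rewrite /q mul1r => /(congr1 (fun x => x * S z)).
  by rewrite divfK ?mul1r // S0.
have [] := IVT ler01 cq (v := 0).
  by rewrite q0 q1 /= ge_min le_max oppr_le0 !ler01 orbT.
move=> t; rewrite in_itv /= => /q2 [] -> /= /eqP; last rewrite oppr_eq0; by rewrite oner_eq0.
Qed.

(** The roots on the discs of radius [r m] agree where they are both defined;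
    [N z] is the index of a disc that contains [z]. *)
Lemma sqrt_on_unit_disk g : (forall z, unit_disk R z -> cdiff g z) ->
  (forall z, unit_disk R z -> g z != 0) ->
  exists S, (forall z, unit_disk R z -> cdiff S z) /\ (forall z, unit_disk R z -> S z ^+ 2 = g z).
Proof.
move=> dg g0.
pose r (m : nat) : R := 1 - (m.+2%:R)^-1.
have r0 m : 0 < r m by rewrite subr_gt0 invf_lt1 ?ltr1n // ltr0n.
have r1 m : r m < 1 by rewrite ltrBlDr ltrDl invr_gt0 ltr0n.
have rmono m m' : (m <= m')%N -> r m <= r m'.
  by move=> mm'; rewrite lerB // lef_pV2 ?posrE ?ltr0n // ler_nat ltnS.
have B1 z : cball 0 1 z -> unit_disk R z by rewrite /cball /unit_disk /= subr0.
have Br m z : cball 0 (r m) z -> unit_disk R z.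
  by rewrite /cball /unit_disk /= subr0 => /lt_trans; apply.
have /choice [T HT] : forall m, exists S, [/\ forall z, cball 0 (r m) z -> cdiff S z,
    forall z, cball 0 (r m) z -> S z ^+ 2 = g z & S 0 = sqrtc (g 0)].
  move=> m; apply: (sqrt_on_disc (r0 m) (r1 m)).
    by move=> z /B1; exact: dg.
  by move=> z /B1; exact: g0.
have T0 m z : cball 0 (r m) z -> T m z != 0.
  have [_ TE _] := HT m; move=> zr; have := g0 z (Br _ _ zr).
  by rewrite -TE // expf_eq0.
have Tle m m' z : (m <= m')%N -> cball 0 (r m) z -> T m z = T m' z.
  move=> mm'; have [dT TE Tz] := HT m; have [dT' TE' Tz'] := HT m'.
  have mono y : cball 0 (r m) y -> cball 0 (r m') y by move=> h; apply: lt_le_trans (rmono _ _ mm').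
  apply: sqrt_unique.
  - by move=> y /dT /cdiff_ccont.
  - by move=> y /mono /dT' /cdiff_ccont.
  - exact: T0.
  - by move=> y yr; rewrite TE // TE' //; exact: mono.
  - by rewrite Tz Tz'.
have Teq m m' z : cball 0 (r m) z -> cball 0 (r m') z -> T m z = T m' z.
  by move=> h h'; have [/Tle ->|/ltnW /Tle ->] := leqP m m'.
pose N z := Num.bound ((1 - cabs z)^-1).
have Nz z : unit_disk R z -> cball 0 (r (N z)) z.
  rewrite /unit_disk /cball /= subr0 => z1; have d0 : 0 < 1 - cabs z by rewrite subr_gt0.
  rewrite /r ltrBrDl -ltrBrDr -[ltRHS]invrK ltf_pV2 ?posrE ?ltr0n ?invr_gt0 //.
  apply: lt_trans (archi_boundP _) _; first by rewrite invr_ge0 ltW.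
  by rewrite ltr_nat -/(N z) ltnS leqnSn.
exists (fun z => T (N z) z); split=> z z1; last by have [_ -> //] := HT (N z); exact: Nz.
have [dT _ _] := HT (N z).
have zN := Nz z z1; have d0 : 0 < r (N z) - cabs z by move: zN; rewrite /cball /= subr0 subr_gt0.
apply: (cdiff_near d0 (f := T (N z))); last exact: dT.
move=> w wz; have wN : cball 0 (r (N z)) w.
  by rewrite /cball /= subr0; have := cabs_sub_ge w z; lra.
by apply: Teq => //; apply: Nz; exact: Br wN.
Qed.

Lemma root2_on_unit_disk k g : (forall z, unit_disk R z -> cdiff g z) ->
  (forall z, unit_disk R z -> g z != 0) ->
  exists S, (forall z, unit_disk R z -> cdiff S z) /\
            (forall z, unit_disk R z -> S z ^+ (2 ^ k) = g z).
Proof.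
elim: k g => [|k IH] g dg g0; first by exists g.
have [S [dS SE]] := sqrt_on_unit_disk dg g0.
have [|T [dT TE]] := IH S dS.
  by move=> z z1; have := g0 z z1; rewrite -SE // expf_eq0.
by exists T; split=> // z z1; rewrite expnSr exprM TE // SE.
Qed.
End Roots.

(** * A barrier at an omitted value *)

Section Barrier.
Variable R : realType.
Local Notation C := R[i].
Local Notation disk := (unit_disk R).
Implicit Types (z w y p : C) (f g : C -> C) (v : C -> \bar R).

Lemma unit_diskE : disk = cball 0 1.
Proof. by apply/seteqP; split=> z; rewrite /unit_disk /cball /= subr0. Qed.

Lemma open_unit_disk : open disk.
Proof. by rewrite unit_diskE; exact: open_cball. Qed.

Lemma compact_image (K : set C) g : compact K -> (forall z, K z -> ccont g z) ->
  compact (g @` K).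
Proof.
move=> cK cg; apply: continuous_compact => //.
by apply: continuous_in_subspaceT => z; rewrite inE => Kz; apply/continuous_ccont; exact: cg.
Qed.

Lemma bernoulli_pow (x : R) n : 0 <= x <= 1 -> n%:R * (1 - x) * x ^+ n <= 1 - x ^+ n.
Proof.
move=> /andP[x0 x1]; elim: n => [|n IH]; first by rewrite !mul0r expr0 subrr.
have e0 := exprn_ge0 n x0; have e1 : x ^+ n <= 1 by rewrite exprn_ile1.
rewrite -natr1 exprS; set t := x ^+ n in IH e0 e1 *.
have h1 : x * (n%:R * (1 - x) * t) <= x * (1 - t) by rewrite ler_wpM2l.
have h2 : x * t <= 1 by rewrite mulr_ile1.
have h3 : 0 <= (1 - x) * (1 - x * t) by rewrite mulr_ge0 // subr_ge0.
by nra.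
Qed.

Variables (Delta K : set C).
Hypotheses (oD : open Delta) (cD : connected Delta).
Hypotheses (cK : compact K) (KD : K `<=` Delta).

(** The bound is uniform in the maps [f], [g] and the omitted value [p]: the
    only constants are those of Harnack's inequality for [K] in [Delta], and the
    distance from the base point [k0] to the complement of [Delta], which
    contains [p]. *)
Lemma barrier_bound k0 : Delta k0 -> exists2 c : R, 0 < c &
  forall (k : nat) f g p v,
  (forall z, disk z -> cdiff f z) -> (forall z, disk z -> disk (f z)) ->
  (forall w, Delta w -> cdiff g w) -> (forall w, Delta w -> disk (g w)) ->
  (forall w, Delta w -> f (g w) = w) ->
  ~ (f @` disk) p -> cabs p < 3 ->
  subharmonic_on (disk `\` g @` K) v ->
  (forall y, (g @` K) y -> forall e : R, 0 < e -> exists2 d : R, 0 < d &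
     forall w, (disk `\` g @` K) w -> cabs (w - y) < d -> (v w <= (1 + e)%:E)%E) ->
  (forall y, ~ disk y -> forall e : R, 0 < e -> exists2 d : R, 0 < d &
     forall w, (disk `\` g @` K) w -> cabs (w - y) < d -> (v w <= e%:E)%E) ->
  forall w, Delta w -> ~ K w -> cabs (w - p) <= 4 * (1 / 2) ^+ (2 ^ k) ->
    (v (g w) <= (c / (2 ^ k)%:R)%:E)%E.
Proof.
move=> Dk0.
have [cK' cK'0 hcK] := harnack_compact oD cD Dk0 cK KD.
have [d0 d00 k0D] := (openCP _).1 oD k0 Dk0.
pose q := d0 / 4; have q0 : 0 < q by rewrite divr_gt0.
pose C1 := (cK' * q)^-1; have C10 : 0 < C1 by rewrite invr_gt0 mulr_gt0.
exists (2 * C1); first by rewrite mulr_gt0.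
move=> k f g p v df fd dg gd fg pf p3 sv vK vD w Dw nKw wp.
pose N := (2 ^ k)%N; have N0 : (0 < N)%N by rewrite expn_gt0.
have N0R : 0 < N%:R :> R by rewrite ltr0n.
have nDp : ~ Delta p by move=> Dp; apply: pf; exists (g p); [exact: gd|exact: fg].
(* The factor [1 / 4] brings the modulus below one, as [|f y - p| < 4]. *)
pose G y := (f y - p) / 4%:R.
have c4 : cabs (4%:R : C) = 4 by rewrite -(rmorph_nat (real_complex R)) cabs_real ger0_norm.
have absG y : cabs (G y) = cabs (f y - p) / 4 by rewrite cabsM cabsV c4.
have dG y : disk y -> cdiff G y.
  move=> dy; apply: cdiffM; last exact: cdiff_cst.
  by apply: cdiffB; [exact: df|exact: cdiff_cst].
have G0 y : disk y -> G y != 0.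
  move=> dy; rewrite -cabs_gt0 absG divr_gt0 // cabs_gt0 subr_eq0.
  by apply/eqP => fp; apply: pf; exists y.
have G1 y : disk y -> cabs (G y) < 1.
  move=> dy; rewrite absG ltr_pdivrMr // mul1r.
  have := cabsD (f y) (- p); rewrite cabsN.
  by have := fd _ dy; rewrite /unit_disk /=; lra.
have [S [dS SE]] := root2_on_unit_disk k dG G0; rewrite -/N in SE.
have absS y : disk y -> cabs (S y) ^+ N = cabs (f y - p) / 4.
  by move=> dy; rewrite -cabsX SE // absG.
have S1 y : disk y -> cabs (S y) < 1.
  move=> dy; rewrite -(ltr_pXn2r N0) ?nnegrE ?cabs_ge0 // expr1n absS // -absG.
  exact: G1.
pose y0 := g k0; have dy0 : disk y0 by exact: gd.
have Sy0 : S y0 != 0.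
  by have := G0 _ dy0; rewrite -SE // expf_eq0 N0.
pose x := cabs (S y0); have x0 : 0 < x by rewrite cabs_gt0.
have x1 : x < 1 by exact: S1.
(* The rotation that makes [S] positive at [y0]; it makes [A y0] real, which
   bounds [Re (1 / A)] from below there. *)
pose c := conjc (S y0) / x%:C%C.
have c1 : cabs c = 1 by rewrite /c cabsM cabsV cabsJ cabs_real gtr0_norm // mulfV // gt_eqF.
have cS : c * S y0 = x%:C%C.
  rewrite /c mulrAC [conjc _ * _]mulrC -sqr_normc -cabsE expr2 mulfK //.
  by rewrite -cabs_gt0 cabs_real gtr0_norm.
pose A y := N%:R%:C%C * (1 - c * S y).
have ReA y : disk y -> N%:R * (1 - cabs (S y)) <= Re (A y).
  move=> dy; rewrite /A ReM /= mul0r subr0 ler_wpM2l ?ler0n // ReD ReN /= lerB //.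
  by apply: le_trans (ler_norm _) _; apply: le_trans (Re_le_cabs _) _; rewrite cabsM c1 mul1r.
have ReA0 y : disk y -> 0 < Re (A y).
  by move=> dy; apply: lt_le_trans (ReA y dy); rewrite mulr_gt0 // subr_gt0 S1.
have A0 y : disk y -> A y != 0.
  by move=> /ReA0 h; apply: contraTneq h => ->; rewrite ltxx.
pose B y := (A y)^-1.
have dB y : disk y -> cdiff B y.
  move=> dy; apply: cdiffV; first exact: A0.
  apply: cdiffM; first exact: cdiff_cst.
  apply: cdiffB; first exact: cdiff_cst.
  by apply: cdiffM; [exact: cdiff_cst|exact: dS].
have ReB0 y : disk y -> 0 < Re (B y).
  by move=> dy; rewrite /B ReV divr_gt0 ?ReA0 // exprn_gt0 // cabs_gt0 A0.
have ReB y : disk y -> Re (B y) <= (N%:R * (1 - cabs (S y)))^-1.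
  move=> dy; have h0 : 0 < N%:R * (1 - cabs (S y)) by rewrite mulr_gt0 // subr_gt0 S1.
  have h1 : 0 < cabs (A y) by rewrite cabs_gt0 A0.
  apply: (@le_trans _ _ (cabs (A y))^-1).
    have := Re_le_cabs (B y); rewrite /B cabsV; apply: le_trans; exact: ler_norm.
  rewrite lef_pV2 ?posrE //; apply: le_trans (ReA y dy) _.
  by apply: le_trans (ler_norm _) (Re_le_cabs _).
(* [N (1 - x) <= x ^ - N], and [x ^ N = |k0 - p| / 4 >= d0 / 4]. *)
have ReBk0 : q <= Re (B y0).
  have -> : B y0 = ((N%:R * (1 - x))^-1)%:C%C.
    by rewrite /B /A cS fmorphV rmorphM rmorphB rmorph1.
  rewrite /= -[q]invrK lef_pV2 ?posrE ?invr_gt0 ?mulr_gt0 ?subr_gt0 //.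
  have qx : q <= x ^+ N.
    rewrite /x absS // fg // ler_pM2r ?invr_gt0 // leNgt; apply/negP => h.
    by apply: nDp; apply: k0D; rewrite /cball /= cabsB.
  have x01 : 0 <= x <= 1 by rewrite !ltW.
  have := bernoulli_pow N x01 => h.
  have xN0 : 0 < x ^+ N by rewrite exprn_gt0.
  apply: (@le_trans _ _ (x ^+ N)^-1); last by rewrite lef_pV2 ?posrE.
  by rewrite -[leRHS]mul1r ler_pdivlMr //; apply: le_trans h _; rewrite gerBl ltW.
pose h y := Re (C1%:C%C * B y).
have hE y : h y = C1 * Re (B y) by rewrite /h ReM /= mul0r subr0.
have dh y : disk y -> cdiff (fun y => C1%:C%C * B y) y.
  by move=> dy; apply: cdiffM; [exact: cdiff_cst|exact: dB].
have chh y : disk y -> rcont h y by move=> /dh /cdiff_ccont /rcont_Re.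
have hK y : (g @` K) y -> 1 <= h y.
  move=> [k' Kk' <-]; rewrite hE /C1 mulrC ler_pdivlMr ?mulr_gt0 // mul1r.
  have cmp := hcK k' Kk' (fun w => B (g w)).
  have dBg z : Delta z -> cdiff (fun w => B (g w)) z.
    by move=> Dz; apply: cdiff_comp; [exact: dg|apply: dB; exact: gd].
  have Bg0 z : Delta z -> 0 < Re (B (g z)) by move=> /gd; exact: ReB0.
  apply: le_trans (cmp dBg Bg0); rewrite -/y0.
  by rewrite ler_wpM2l // ltW.
have cgK : closed (g @` K).
  apply: compact_closedC; apply: compact_image => // z Kz.
  by apply: cdiff_ccont; apply: dg; exact: KD.
have oU : open (disk `\` g @` K) by exact: (openI open_unit_disk (closed_openC cgK)).
have U1 y : (disk `\` g @` K) y -> cabs y <= 1 by move=> [dy _]; exact: ltW.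
have Ugw : (disk `\` g @` K) (g w).
  split; first exact: gd.
  by move=> [k' Kk' gk']; apply: nKw; rewrite -(fg _ Dw) -gk' fg //; exact: KD.
have comp : (v (g w) <= (h (g w))%:E)%E.
  apply: (comparison_principle oU U1 sv) Ugw.
  - by move=> y [dy _]; exact: chh.
  - by move=> y Uy; apply: (supermean_Re oU) => // z [dz _]; exact: dh.
  move=> y cUy nUy e e0; have [dy|ndy] := pselect (disk y).
    have gKy : (g @` K) y by apply: contrapT => n; apply: nUy.
    have e20 : 0 < e / 2 by rewrite divr_gt0.
    have [d d'0 vd] := vK y gKy _ e20.
    have /rcontP /(_ _ e20) [d' d''0 hd] := chh y dy.
    exists (Num.min d d'); first by rewrite lt_min d'0.
    move=> w' Uw'; rewrite lt_min => /andP[/(vd _ Uw') /le_trans + /hd].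
    rewrite ltr_norml => h1 /andP[h2 _]; apply: h1; rewrite lee_fin.
    by have := hK y gKy; lra.
  have [d d'0 vd] := vD y ndy e e0; exists d => // w' Uw' /(vd _ Uw') /le_trans; apply.
  rewrite lee_fin lerDr hE; apply: mulr_ge0; first exact: ltW.
  by apply: ltW; apply: ReB0; exact: Uw'.1.
apply: le_trans comp _; rewrite lee_fin hE.
have Sw : cabs (S (g w)) <= 1 / 2.
  rewrite -(ler_pXn2r N0) ?nnegrE ?cabs_ge0 // absS ?fg //; last exact: gd.
  by rewrite ler_pdivrMr // mulrC.
have := ReB _ (gd _ Dw) => h1.
have h2 : (N%:R * (1 - cabs (S (g w))))^-1 <= 2 / N%:R.
  rewrite -[2 / _]invrK invf_div lef_pV2 ?posrE ?divr_gt0 ?mulr_gt0 ?subr_gt0 //; last first.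
    by apply: S1; exact: gd.
  by rewrite ler_pM2l //; lra.
rewrite mulrAC [2 / _ * C1]mulrC ler_wpM2l ?(ltW C10) //; exact: le_trans h1 h2.
Qed.
End Barrier.

(** * Transport of Perron families *)

Section PerronComparison.
Variable R : realType.
Local Notation C := R[i].
Local Notation disk := (unit_disk R).
Implicit Types (z w y p : C) (v u : C -> \bar R) (U V : set C).

Lemma boundary_notin U z : open U -> boundary U z -> ~ U z.
Proof. by move=> /interior_id oU [_]; rewrite oU. Qed.

Lemma in_boundary U z : open U -> closure U z -> ~ U z -> boundary U z.
Proof. by move=> /interior_id oU cz nz; split; rewrite ?oU. Qed.

Lemma perron_family_limsup U f v z : open U -> perron_family U f v -> ~ U z ->
  forall e : R, 0 < e -> exists2 d : R, 0 < d &
    forall w, U w -> cabs (w - z) < d -> (v w <= (f z + e)%:E)%E.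
Proof.
move=> oU [_ H] nUz e e0; have [cz|ncz] := pselect (closure U z).
  exact: (limf_esup_leP v U z (f z)).1 (H z (in_boundary oU cz nUz)) e e0.
have /closedCP := @closed_closure _ U => /(_ z ncz) [d d0 dH]; exists d => // w Uw wz.
by case: (dH w wz); exact: subset_closure.
Qed.

Lemma perron_familyI U f v : open U -> subharmonic_on U v ->
  (forall z, closure U z -> ~ U z -> forall e : R, 0 < e -> exists2 d : R, 0 < d &
    forall w, U w -> cabs (w - z) < d -> (v w <= (f z + e)%:E)%E) ->
  perron_family U f v.
Proof.
move=> oU sv H; split=> // z bz; apply/limf_esup_leP; apply: H.
  by case: bz.
exact: boundary_notin bz.
Qed.

Lemma indic_le1 (B : set C) z : \1_B z <= 1 :> R.
Proof. by rewrite indicE; case: (_ \in _). Qed.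

Lemma indic_ge0 (B : set C) z : 0 <= \1_B z :> R.
Proof. by rewrite indicE ler0n. Qed.

Lemma indic_boundary0 (B : set C) z : closed B -> ~ B z -> \1_(boundary B) z = 0 :> R.
Proof.
move=> cB nB; rewrite indicE memNset // => -[]; rewrite -(closure_id B).1 //.
Qed.

Lemma indic_boundary1 U (B : set C) z : B z -> closure U z -> (forall w, U w -> ~ B w) ->
  \1_(boundary B) z = 1 :> R.
Proof.
move=> Bz cU UB; rewrite indicE mem_set //; split; first exact: subset_closure.
by move=> iB; have [w [Uw /interior_subset Bw]] := cU _ (open_nbhs_nbhs (conj (open_interior B) iB)); exact: UB Uw Bw.
Qed.

Section Transport.
Variables (Delta K : set C) (f g : C -> C).
Hypotheses (oD : open Delta) (Ddisk : Delta `<=` disk).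
Hypotheses (cK : compact K) (KD : K `<=` Delta).
Hypotheses (df : forall z, disk z -> cdiff f z) (fd : forall z, disk z -> disk (f z)).
Hypotheses (dg : forall w, Delta w -> cdiff g w).
Hypotheses (fD : forall w, Delta w -> Delta (f w)) (gD : forall w, Delta w -> Delta (g w)).
Hypotheses (fg : forall w, Delta w -> f (g w) = w) (gf : forall w, Delta w -> g (f w) = w).

Let gK := g @` K.
Let U := Delta `\` K.
Let V := Delta `\` gK.
Let W := disk `\` gK.

Lemma closedK : closed K. Proof. exact: compact_closedC. Qed.

Lemma gK_Delta : gK `<=` Delta.
Proof. by move=> _ [k Kk <-]; apply: gD; exact: KD. Qed.

Lemma closed_gK : closed gK.
Proof.
apply: compact_closedC; apply: compact_image => // z Kz.
by apply: cdiff_ccont; apply: dg; exact: KD.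
Qed.

Lemma open_slit_petal : open U.
Proof. exact: (openI oD (closed_openC closedK)). Qed.

Lemma open_slit_image : open V.
Proof. exact: (openI oD (closed_openC closed_gK)). Qed.

Lemma open_slit_disk : open W.
Proof. exact: (openI (@open_unit_disk R) (closed_openC closed_gK)). Qed.

Lemma fVU w : V w -> U (f w).
Proof.
move=> [Dw ngK]; split; first exact: fD.
by move=> Kfw; apply: ngK; exists (f w) => //; exact: gf.
Qed.

Lemma gUV w : U w -> V (g w).
Proof.
move=> [Dw nK]; split; first exact: gD.
move=> [k Kk gk]; apply: nK; rewrite -(fg Dw) -gk fg //; exact: KD.
Qed.

Lemma disk_le1 w : disk w -> cabs w <= 1. Proof. by move=> /ltW. Qed.

(** A competitor [v] in the petal is pulled back by [f], cut at zero, and extended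
    by zero to the disk. *)
Lemma perron_image_ge z : U z ->
  (perron_solution U \1_(boundary K) z <= perron_solution W \1_(boundary gK) (g z))%E.
Proof.
move=> Uz; apply: ge_ereal_sup => _ [v vP <-]; have [sv _] := vP.
have oU := open_slit_petal; have oV := open_slit_image; have oW := open_slit_disk.
have svf : subharmonic_on V (fun z => v (f z) + 0%:E)%E.
  apply: (@subharmonic_conformal R U V f g v 1 oU _ sv) => //.
  - by move=> y [Dy _]; apply: disk_le1; exact: Ddisk.
  - exact: fVU.
  - by move=> y [Dy _]; apply: cdiff_ccont; apply: df; exact: Ddisk.
  - by move=> y [Dy _]; exact: dg.
  - by move=> y [Dy _]; exact: gf.
  - by move=> y [Dy _]; exact: fg.
have svf' : (fun z => v (f z) + 0%:E)%E = (fun z => v (f z)).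
  by apply/funext => y; rewrite adde0.
rewrite svf' in svf; have [ffin fusc fsub] := svf.
pose v1 y := if y \in V then maxe (v (f y)) 0%E else 0%E.
have v1V y : V y -> v1 y = maxe (v (f y)) 0%E by move=> Vy; rewrite /v1 mem_set.
have v1N y : ~ V y -> v1 y = 0%E by move=> Vy; rewrite /v1 memNset.
have v1ge0 y : (0 <= v1 y)%E.
  by rewrite /v1; case: ifP => // _; rewrite le_max lexx orbT.
have v1fin y : (v1 y < +oo)%E.
  rewrite /v1; case: ifPn => [|_]; last by rewrite ltry.
  by rewrite inE => Vy; rewrite gt_max ffin // ltry.
(* The extension is continuous by zero across the boundary of [Delta]: the set
   where [v >= a], together with [K], is a compact subset of [Delta], and so is
   its image under [g]. *)
have small y (a : R) : ~ Delta y -> 0 < a -> exists2 d : R, 0 < d &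
    forall w, V w -> cabs (w - y) < d -> (v (f w) < a%:E)%E.
  move=> nDy a0.
  pose F := [set w | Delta w /\ (K w \/ ~ (v w < a%:E)%E)].
  have cF : compact F.
    apply: (subclosed_compact _ (@compact_cdisk R 1)); last by move=> w [/Ddisk /disk_le1].
    apply/closedCP => w nFw; have [Dw|nDw] := pselect (Delta w).
      have nKw : ~ K w by move=> Kw; apply: nFw; split=> //; left.
      have va : (v w < a%:E)%E by apply: contrapT => h; apply: nFw; split=> //; right.
      have Uw : U w by [].
      have [_ vusc _] := sv; have /nbhsCP [d d0 dv] := vusc w Uw _ va.
      have [d' d'0 dU] := (openCP _).1 oU w Uw.
      exists (Num.min d d'); first by rewrite lt_min d0.
      move=> y' yw; rewrite /cball /= lt_min in yw; have /andP[y1 y2] := yw.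
      by move=> [Dy' [Ky'|nv]]; [case: (dU y' y2)|apply: nv; apply: dv => //; exact: dU].
    have nUw : ~ U w by move=> [].
    have nKw : ~ K w by move=> /KD.
    have a20 : 0 < a / 2 by rewrite divr_gt0.
    have [d d0 dv] := perron_family_limsup oU vP nUw a20.
    have /closedCP /(_ w nKw) [d' d'0 dK] := closedK.
    exists (Num.min d d'); first by rewrite lt_min d0.
    move=> y' yw; rewrite /cball /= lt_min in yw; have /andP[y1 y2] := yw.
    have nK' := dK y' y2; move=> [Dy' [//|]]; apply.
    apply: le_lt_trans (dv y' (conj Dy' nK') y1) _.
    by rewrite indic_boundary0 ?add0r ?lte_fin //; [lra|exact: closedK].
  have cgF : closed (g @` F).
    apply: compact_closedC; apply: compact_image => // w [Dw _].
    by apply: cdiff_ccont; exact: dg.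
  have ny : ~ (g @` F) y by move=> [w [Dw _] gw]; apply: nDy; rewrite -gw; exact: gD.
  have /closedCP /(_ y ny) [d d0 dH] := cgF.
  exists d => // w Vw wy; apply: contrapT => h; apply: (dH w wy).
  exists (f w); last by apply: gf; exact: Vw.1.
  by split; [apply: fD; exact: Vw.1|right].
have VW : V `<=` W by move=> y [/Ddisk Dy ny].
have s1 : subharmonic_on W v1.
  split=> // [y Wy a|y Wy].
    have [Vy|nVy] := pselect (V y).
      rewrite v1V // gt_max => /andP[va a0].
      have /nbhsCP [d d0 dv] := fusc y Vy a va; have [d' d'0 dV] := (openCP _).1 oV y Vy.
      apply/nbhsCP; exists (Num.min d d'); first by rewrite lt_min d0.
      move=> w; rewrite /cball /= lt_min => /andP[w1 w2] _.
      have Vw : V w by exact: dV.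
      by rewrite v1V // gt_max a0 andbT; exact: dv.
    rewrite v1N // => a0; have nDy : ~ Delta y by move=> Dy; apply: nVy; split=> //; exact: Wy.2.
    have [b b0 ba] : exists2 b : R, 0 < b & (b%:E <= a)%E.
      case: a a0 => [a| |] //; first by rewrite lte_fin => a0; exists a.
      by move=> _; exists 1; rewrite ?leey.
    have [d d0 dv] := small y b nDy b0.
    apply/nbhsCP; exists d => // w wy _; have [Vw|nVw] := pselect (V w); last by rewrite v1N.
    by rewrite v1V // gt_max a0 andbT; exact: lt_le_trans (dv w Vw wy) ba.
  have mean_ge0 r : (0 <= circle_mean v1 y r)%E.
    rewrite circle_meanE mule_ge0 ?lee_fin ?pi2V_ge0 //.
    by apply: integral_ge0 => t _.
  have [d0 d00 dW] := (openCP _).1 oW y Wy.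
  have [Vy|nVy] := pselect (V y); last first.
    by exists d0 => //; split=> // r _; rewrite v1N.
  have [rho rho0 [rhoV fm]] := fsub y Vy.
  exists rho => //; split; first by move=> w /rhoV /VW.
  move=> r rr; rewrite v1V // ge_max mean_ge0 andbT.
  apply: le_trans (fm r rr) _; apply: circle_mean_mono => t.
  have Vc : V (circ y r t) by apply: rhoV; rewrite /= circ_dist; case/andP: rr.
  by rewrite v1V // le_max lexx.
apply: (@le_trans _ _ (v1 (g z))).
  by rewrite v1V; [rewrite fg ?le_max ?lexx //; exact: Uz.1|exact: gUV].
apply: ereal_sup_ubound; exists v1 => //; apply: perron_familyI => // y cWy nWy e e0.
have [Dy|nDy] := pselect (Delta y); last first.
  have [d d0 dv] := small y e nDy e0; exists d => // w Ww wy.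
  have e1 : (e%:E <= (\1_(boundary gK) y + e)%:E)%E by rewrite lee_fin lerDr indic_ge0.
  apply: le_trans e1; have [Vw|nVw] := pselect (V w); last by rewrite v1N // lee_fin ltW.
  by rewrite v1V // ge_max lee_fin (ltW e0) andbT; apply: ltW; exact: dv.
have gKy : gK y by apply: contrapT => n; apply: nWy; split=> //; exact: Ddisk.
have -> : \1_(boundary gK) y = 1 :> R by apply: (indic_boundary1 gKy cWy) => w [].
have Kfy : K (f y) by have [k Kk <-] := gKy; rewrite fg //; exact: KD.
have nUf : ~ U (f y) by move=> [].
have [d d0 dv] := perron_family_limsup oU vP nUf e0.
have [d' d'0 fdd] := cdiff_ccont (df (Ddisk Dy)) d0.
exists d' => // w Ww wy; have [Vw|nVw] := pselect (V w); last by rewrite v1N // lee_fin addr_ge0 // ltW.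
rewrite v1V // ge_max lee_fin addr_ge0 ?(ltW e0) // andbT.
apply: le_trans (dv _ (fVU Vw) (fdd w wy)) _.
by rewrite lee_fin lerD2r indic_le1.
Qed.

(** A competitor in the disk is pulled back by [g]; the barrier, applied at an
    omitted value close to the given boundary point of [Delta], shows that it is at
    most [e] near the boundary of [Delta]. *)
Lemma perron_image_le z (c e eta : R) (k : nat) : U z -> 0 <= e -> 0 < eta -> eta <= 1 ->
  eta <= 2 * (1 / 2) ^+ (2 ^ k) -> c / (2 ^ k)%:R <= e ->
  (forall p v, ~ (f @` disk) p -> cabs p < 3 -> subharmonic_on W v ->
    (forall y, gK y -> forall e : R, 0 < e -> exists2 d : R, 0 < d &
       forall w, W w -> cabs (w - y) < d -> (v w <= (1 + e)%:E)%E) ->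
    (forall y, ~ disk y -> forall e : R, 0 < e -> exists2 d : R, 0 < d &
       forall w, W w -> cabs (w - y) < d -> (v w <= e%:E)%E) ->
    forall w, Delta w -> ~ K w -> cabs (w - p) <= 4 * (1 / 2) ^+ (2 ^ k) ->
      (v (g w) <= (c / (2 ^ k)%:R)%:E)%E) ->
  (forall y, closure Delta y -> ~ Delta y -> exists2 p, ~ (f @` disk) p & cabs (y - p) < eta) ->
  (perron_solution W \1_(boundary gK) (g z) <= perron_solution U \1_(boundary K) z + e%:E)%E.
Proof.
move=> Uz e0 eta0 eta1 etak ce barrier gap; apply: ge_ereal_sup => _ [v vP <-]; have [sv _] := vP.
have oU := open_slit_petal; have oV := open_slit_image; have oW := open_slit_disk.
have VW : V `<=` W by move=> y [/Ddisk Dy ny].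
have svg : subharmonic_on U (fun z => v (g z) + (- e)%:E)%E.
  apply: (@subharmonic_conformal R V U g f v 1 oV _ (subharmonic_subset oV VW sv)) => //.
  - by move=> y [Dy _]; apply: disk_le1; exact: Ddisk.
  - exact: gUV.
  - by move=> y [Dy _]; apply: cdiff_ccont; exact: dg.
  - by move=> y [Dy _]; apply: df; exact: Ddisk.
  - by move=> y [Dy _]; exact: fg.
  - by move=> y [Dy _]; exact: gf.
have vK y : gK y -> forall e : R, 0 < e -> exists2 d : R, 0 < d &
     forall w, W w -> cabs (w - y) < d -> (v w <= (1 + e)%:E)%E.
  move=> gKy a a0; have nW : ~ W y by move=> [].
  have [d d0 dv] := perron_family_limsup oW vP nW a0; exists d => // w Ww wy.
  by apply: le_trans (dv w Ww wy) _; rewrite lee_fin lerD2r indic_le1.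
have vD y : ~ disk y -> forall e : R, 0 < e -> exists2 d : R, 0 < d &
     forall w, W w -> cabs (w - y) < d -> (v w <= e%:E)%E.
  move=> ndy a a0; have nW : ~ W y by move=> [].
  have [d d0 dv] := perron_family_limsup oW vP nW a0; exists d => // w Ww wy.
  apply: le_trans (dv w Ww wy) _; rewrite indic_boundary0 ?add0r //; first exact: closed_gK.
  by move=> /gK_Delta /Ddisk.
have : (v (g z) + (- e)%:E <= perron_solution U \1_(boundary K) z)%E.
  apply: ereal_sup_ubound; exists (fun z => v (g z) + (- e)%:E)%E => //.
  apply: perron_familyI => // y cUy nUy a a0.
  have [Ky|nKy] := pselect (K y).
    have -> : \1_(boundary K) y = 1 :> R by apply: (indic_boundary1 Ky cUy) => w [].
    have gKy : gK (g y) by exists y.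
    have [d d0 dv] := vK _ gKy a a0.
    have [d' d'0 gd'] := cdiff_ccont (dg (KD Ky)) d0.
    exists d' => // w Uw wy; have := dv _ (VW _ (gUV Uw)) (gd' w wy).
    move=> h; apply: le_trans h; rewrite -[leRHS]adde0; apply: leeD => //.
    by rewrite lee_fin oppr_le0.
  have nDy : ~ Delta y by move=> Dy; apply: nUy.
  have cDy : closure Delta y by apply: closure_subset cUy => w [].
  have [p pf yp] := gap y cDy nDy.
  exists eta => // w Uw wy.
  have p3 : cabs p < 3.
    have cy : cabs y <= 1.
      have := closure_subset (fun w (Dw : Delta w) => disk_le1 (Ddisk Dw)) cDy.
      by rewrite -(closure_id _).1 //; apply: compact_closedC; exact: compact_cdisk.
    by have := cabs_sub_ge p y; rewrite cabsB; lra.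
  have wp : cabs (w - p) <= 4 * (1 / 2) ^+ (2 ^ k).
    by have := cabs_tri w y p; lra.
  have := barrier p v pf p3 sv vK vD w Uw.1 Uw.2 wp => h.
  rewrite EFinN leeBlDr // -EFinD; apply: le_trans h _; rewrite lee_fin.
  by have := @indic_ge0 (boundary K) y; lra.
by rewrite EFinN leeBlDr.
Qed.
End Transport.
End PerronComparison.

(** * Topology of the petal and the limit *)

Section PetalTopology.
Variable R : realType.
Local Notation C := R[i].
Local Notation disk := (unit_disk R).
Implicit Types (z w y p x : C) (A : set C).

Lemma connected_cball z (e : R) : 0 < e -> connected (cball z e).
Proof.
move=> e0; pose seg w := (fun t : R => z + t%:C%C * (w - z)) @` `[0, 1].
have segB w : cball z e w -> seg w `<=` cball z e.
  move=> zw y [t]; rewrite /= in_itv /= => /andP[t0 t1] <-.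
  rewrite /cball /= addrC addKr cabsM cabs_real ger0_norm //.
  by apply: le_lt_trans zw; rewrite ler_piMl ?cabs_ge0.
have -> : cball z e = \bigcup_(w in cball z e) seg w.
  apply/seteqP; split=> [w zw|w [y zy yw]]; last exact: segB zy w yw.
  exists w => //; exists 1; first by rewrite /= in_itv /= lexx ler01.
  by rewrite mul1r addrC subrK.
apply: bigcup_connected.
  exists z => w _; exists 0; first by rewrite /= in_itv /= lexx ler01.
  by rewrite mul0r addr0.
move=> w _; apply: connected_continuous_connected; first exact: segment_connected.
apply: continuous_in_subspaceT => t _ A /nbhsCP [d d0 dA].
apply/nbhs_ballP; exists (d / (cabs (w - z) + 1)).
  by rewrite /= divr_gt0 // ltr_wpDl // cabs_ge0.
move=> s; rewrite /ball /= distrC ltr_pdivlMr ?ltr_wpDl ?cabs_ge0 // => ts.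
apply: dA; rewrite /cball /= opprD addrACA subrr add0r -mulrBl -rmorphB cabsM cabs_real.
by apply: le_lt_trans ts; rewrite ler_wpM2l // lerDl.
Qed.

Lemma component_absorbs_ball A x w y (e : R) : A x -> connected_component A x w ->
  cball y e w -> cball y e `<=` A -> cball y e `<=` connected_component A x.
Proof.
move=> Ax [B [Bx BA cB] Bw] yw yA z yz.
have e0 : 0 < e by exact: le_lt_trans (cabs_ge0 _) yw.
exists (B `|` cball y e); last by right.
split; [by left|by move=> u [/BA|/yA]|].
apply: connectedU => //; last exact: connected_cball.
by exists w.
Qed.

Lemma open_component A x : open A -> A x -> open (connected_component A x).
Proof.
move=> oA Ax; apply/openCP => w cw.
have Aw : A w := connected_component_sub cw.
have [e e0 wA] := (openCP _).1 oA w Aw.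
by exists e => //; apply: (component_absorbs_ball Ax cw _ wA); exact: cball_center.
Qed.

Lemma component_boundary A x y : open A -> A x -> closure (connected_component A x) y ->
  ~ connected_component A x y -> ~ A y.
Proof.
move=> oA Ax /closureCP cy ny Ay; apply: ny.
have [e e0 yA] := (openCP _).1 oA y Ay; have [w cw wy] := cy e e0.
by apply: (component_absorbs_ball Ax cw wy yA); exact: cball_center.
Qed.
End PetalTopology.

Section Convergence.
Variable R : realType.
Local Open Scope ereal_scope.

(** Harmonic measure is an extended real by definition, hence the infinite
    limits. *)
Lemma ereal_squeeze_ninfty (F : R -> \bar R) (L : \bar R) :
  (forall t : R, (t < 0)%R -> L <= F t) ->
  (forall e : R, (0 < e)%R -> exists s : R, forall t : R, (t < s)%R -> F t <= L + e%:E) ->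
  F t @[t --> ninfty_nbhs R] --> L.
Proof.
move=> LF FL.
have lt0 : \forall t \near ninfty_nbhs R, (t < 0)%R by apply: nbhs_ninfty_lt; exact: num_real.
case: L LF FL => [l| |] LF FL.
- apply/fine_cvgP; split.
    have [s Hs] := FL 1%R ltr01.
    have lts : \forall t \near ninfty_nbhs R, (t < s)%R by apply: nbhs_ninfty_lt; exact: num_real.
    near=> t; have h1 : l%:E <= F t by apply: LF; near: t.
    have h2 : F t <= l%:E + 1%:E by apply: Hs; near: t.
    by rewrite fin_numElt (lt_le_trans (ltNyr _) h1) (le_lt_trans h2) // -EFinD ltry.
  apply/cvgrPdist_le => e e0; have [s Hs] := FL e e0.
  have lts : \forall t \near ninfty_nbhs R, (t < s)%R by apply: nbhs_ninfty_lt; exact: num_real.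
  near=> t; have h1 : l%:E <= F t by apply: LF; near: t.
  have h2 : F t <= l%:E + e%:E by apply: Hs; near: t.
  move: h1 h2 => /=; case: (F t) => [r| |] //=; rewrite -?EFinD ?lee_fin => h1 h2.
  by rewrite ler_norml; lra.
- apply: cvg_near_cst; near=> t; apply/eqP; rewrite -leye_eq; apply: LF; near: t.
  exact: lt0.
- have [s Hs] := FL 1%R ltr01.
  have lts : \forall t \near ninfty_nbhs R, (t < s)%R by apply: nbhs_ninfty_lt; exact: num_real.
  apply: cvg_near_cst; near=> t; apply/eqP; rewrite -leeNy_eq.
  by apply: (Hs t); near: t.
Unshelve. all: by end_near.
Qed.
End Convergence.

Theorem theorem1p2 (R : realType) (phi : R -> R[i] -> R[i]) (tau : R[i])
    (Delta K : set R[i])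
    (phi_semigroup : holomorphic_semigroup phi)
    (phi_non_elliptic : non_elliptic phi tau)
    (Delta_petal : petal phi tau Delta)
    (K_compact : compact K) (K_Delta : K `<=` Delta) (K_nonpolar : ~ polar K)
    (z : R[i]) (z_Delta : (Delta `\` K) z) :
  harmonic_measure (petal_flow phi Delta t z)
      (boundary (petal_flow phi Delta t @` K))
      (unit_disk R `\` (petal_flow phi Delta t @` K)) @[t --> -oo]
    --> harmonic_measure z (boundary K) (Delta `\` K).
Proof.
have [_ _ comp _ aut grp _ _] := Delta_petal.
have [holo self id0 semD _] := phi_semigroup.
have [x Wx DE] := comp.
set W := backward_invariant_set phi in Wx DE.
have oW : open W° := open_interior W.
have oD : open Delta by rewrite DE; exact: open_component.
have cD : connected Delta by rewrite DE; exact: component_connected.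
have DW : Delta `<=` W.
  by rewrite DE => w /connected_component_sub /interior_subset.
have Ddisk : Delta `<=` unit_disk R.
  move=> w /DW /(_ 0 (lexx _)) [y dy <-]; rewrite id0 //.
have flow0 w : Delta w -> petal_flow phi Delta 0 w = w.
  by move=> Dw; rewrite /petal_flow lexx id0 //; exact: Ddisk.
have flowD t w : Delta w -> Delta (petal_flow phi Delta t w).
  by move=> Dw; have [_ [/(_ w) + _ _] _] := aut t; apply.
have flow_diff t w : Delta w -> cdiff (petal_flow phi Delta t) w.
  by move=> Dw; have [h _ _] := aut t; apply: derivable_cdiff; exact: h.
have flowE s : 0 <= s -> petal_flow phi Delta s = phi s by move=> s0; rewrite /petal_flow s0.
have fg s w : 0 <= s -> Delta w -> phi s (petal_flow phi Delta (- s) w) = w.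
  by move=> s0 Dw; rewrite -flowE // -grp // subrr flow0.
have gf s w : 0 <= s -> Delta w -> petal_flow phi Delta (- s) (phi s w) = w.
  by move=> s0 Dw; rewrite -[in LHS](flowE s) // -grp // addNr flow0.
have df s w : 0 <= s -> unit_disk R w -> cdiff (phi s) w.
  by move=> s0 dw; apply: derivable_cdiff; exact: holo.
have fD s w : 0 <= s -> Delta w -> Delta (phi s w).
  by move=> s0 Dw; rewrite -flowE //; exact: flowD.
have Dz : Delta z := z_Delta.1.
(* The kernel property of [Delta]: its boundary points are limits of points
   omitted by [phi s], uniformly, by compactness and because the images
   decrease. *)
have gap (eta : R) : 0 < eta -> exists s0 : R, forall s, s0 <= s -> forall y,
    closure Delta y -> ~ Delta y -> exists2 p, ~ (phi s @` unit_disk R) p & cabs (y - p) < eta.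
  move=> eta0.
  have cB : compact (closure Delta `\` Delta).
    apply: (subclosed_compact _ (@compact_cdisk R 1)).
      by apply: closedI; [exact: closed_closure|exact: open_closedC].
    move=> y [cy _]; have := closure_subset (fun w (Dw : Delta w) => disk_le1 (Ddisk _ Dw)) cy.
    by rewrite -(closure_id _).1 //; apply: compact_closedC; exact: compact_cdisk.
  have /compact_near_coveringP /(_ R (pinfty_nbhs R) (fun s y =>
    exists2 p, ~ (phi s @` unit_disk R) p & cabs (y - p) < eta) _) H := cB.
  have [|s1 [_ Hs]] := H.
    move=> y [cy nDy].
    have nWy : ~ W° y.
      by apply: (component_boundary oW Wx); rewrite -DE.
    have eta20 : 0 < eta / 2 by rewrite divr_gt0.
    have [p yp nWp] : exists2 p, cball y (eta / 2) p & ~ W p.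
      apply: contrapT => h; apply: nWy; apply/nbhsCP; exists (eta / 2) => // p yp.
      by apply: contrapT => nWp; apply: h; exists p.
    have [s1 s10 ps1] : exists2 s1, 0 <= s1 & ~ (phi s1 @` unit_disk R) p.
      apply: contrapT => h; apply: nWp => s s0.
      by apply: contrapT => ns; apply: h; exists s.
    exists (cball y (eta / 2), [set s | s1 <= s]).
      split => /=; first by apply/nbhsCP; exists (eta / 2).
      by apply: nbhs_pinfty_ge; exact: num_real.
    move=> [y' s] [/= yy' s1s]; exists p.
      have ss1 : 0 <= s - s1 by rewrite subr_ge0.
      move=> [w dw wp]; apply: ps1; exists (phi (s - s1) w); first exact: (self _ ss1 w dw).
      by rewrite -(semD _ _ ss1 s10 w dw) addrC subrK.
    have := cabs_tri y' y p; rewrite [cabs (y - p)]cabsB.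
    by move: yy' yp; rewrite /cball /=; lra.
  exists (s1 + 1) => s ss y cy nDy; apply: (Hs s) => //.
  by rewrite (lt_le_trans _ ss) // ltrDl.
apply: ereal_squeeze_ninfty => [t t0|e e0].
  have s0 : 0 <= - t by rewrite oppr_ge0 ltW.
  rewrite /harmonic_measure.
  have := @perron_image_ge R Delta K (phi (- t)) (petal_flow phi Delta t) oD Ddisk K_compact
    K_Delta (fun w => df _ w s0) (flow_diff t) (fun w => fD _ w s0) (flowD t) _ _ z z_Delta.
  apply=> w Dw; first by rewrite -{2}[t]opprK fg.
  by rewrite -{1}[t]opprK gf.
have [c c0 barrier] := barrier_bound oD cD K_compact K_Delta Dz.
(* [c / 2 ^ k <= e], and [2 eta <= 4 / 2 ^ (2 ^ k)] makes the barrier apply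
   within distance [eta] of a boundary point. *)
pose k := Num.bound (c / e).
have ck : c / (2 ^ k)%:R <= e.
  rewrite ler_pdivrMr ?ltr0n ?expn_gt0 // mulrC -ler_pdivrMr //; apply: ltW.
  apply: lt_trans (archi_boundP _) _; first by rewrite divr_ge0 // ltW.
  by rewrite ltr_nat ltn_expl.
pose eta := Num.min 1 (2 * (1 / 2) ^+ (2 ^ k)) : R.
have eta0 : 0 < eta by rewrite lt_min ltr01 mulr_gt0 // exprn_gt0.
have [s0 Hs] := gap eta eta0.
exists (- Num.max 0 s0) => t; rewrite ltrNr gt_max => /andP[t0 ts].
have t0' : 0 <= - t by exact: ltW.
rewrite /harmonic_measure.
have fgt w : Delta w -> phi (- t) (petal_flow phi Delta t w) = w.
  by move=> Dw; rewrite -{2}[t]opprK fg.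
have gft w : Delta w -> petal_flow phi Delta t (phi (- t) w) = w.
  by move=> Dw; rewrite -{1}[t]opprK gf.
apply: (@perron_image_le R Delta K (phi (- t)) (petal_flow phi Delta t) oD Ddisk K_compact
    K_Delta (fun w => df _ w t0') (flow_diff t) (flowD t) fgt gft
    z c e eta k z_Delta (ltW e0) eta0) => //.
- by rewrite /eta ge_min lexx.
- by rewrite /eta ge_min lexx orbT.
- move=> p v pf p3 sv vK vD; apply: (barrier k (phi (- t)) (petal_flow phi Delta t) p v) => //.
  + by move=> w; exact: df.
  + by move=> w; exact: self.
  + exact: flow_diff.
  + by move=> w /(flowD t) /Ddisk.
by move=> y cy ny; apply: Hs => //; exact: ltW.
Qed.
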